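(* Let $\{G_t,t\ge0\}$ be a one-dimensional centered Gaussian process with covariance $R(s,t)=\mathbb{E}(G_sG_t)$, let $\mu\in\mathbb{R}$ and $\sigma>0$ be parameters, and let $X_t=\mu t+\sigma G_t$, $t\ge0$. Let $0<t_1<t_2<\cdots$ be observation times, and for each $n$ let $\mathbf t=(t_1,\dots,t_n)'$, $\mathbf X=(X_{t_1},\dots,X_{t_n})'$, $\mathbf V=(R(t_i,t_j))_{i,j=1}^n$, and $$\hat\mu_n=\frac{\mathbf t'\mathbf V^{-1}\mathbf X}{\mathbf t'\mathbf V^{-1}\mathbf t},\qquad \hat\sigma_n^2=\frac1n\,\frac{(\mathbf X'\mathbf V^{-1}\mathbf X)(\mathbf t'\mathbf V^{-1}\mathbf t)-(\mathbf t'\mathbf V^{-1}\mathbf X)^2}{\mathbf t'\mathbf V^{-1}\mathbf t}.$$ Consider the hypotheses: (H1) there exist constants $c>0$ and $\beta<2$ such that $\mathbb{E}(G_t^2)\le c\,t^\beta$ for all $t\ge0$; (H2) for every $n$, the matrix $\mathbf V=(R(t_i,t_j))_{i,j=1}^n$ is strictly positive definite. Then: \begin{enumerate} \item If (H1) and (H2) hold and there are constants $\alpha>0$, $c_1,c_2>0$ with $c_1n^\alpha\le t_n\le c_2 n^\alpha$ for all $n$, then $\hat\mu_n\to\mu$ almost surely and $\hat\sigma_n^2\to\sigma^2$ almost surely as $n\to\infty$. \item If (H2) holds, then with $Y_n=\frac1\sigma\sqrt{\mathbf t'\mathbf V^{-1}\mathbf t}\,(\hat\mu_n-\mu)$ and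 $Q_n=\frac{1}{\sigma^2}\sqrt{\frac n2}\,(\hat\sigma_n^2-\sigma^2)$, the random vector $(Y_n,Q_n)'$ converges in law to the bivariate standard normal distribution $N_2(\mathbf 0,\mathbf I)$ as $n\to\infty$, where $\mathbf I$ is the $2\times2$ identity matrix. \item If (H2) holds, then with $\bar Q_n=Q_n-\mathbb{E}(Q_n)$ and $\Phi(z)=\int_{-\infty}^z\frac{1}{\sqrt{2\pi}}e^{-x^2/2}\,dx$: (a) $\sup_{z\in\mathbb{R}}|P(\bar Q_n\le z)-\Phi(z)|\le \frac{\sqrt{2n-1}}{n}$ for every $n$; (b) for every $z\in\mathbb{R}$, $\frac{n}{\sqrt{2n-1}}\left(P(\bar Q_n\le z)-\Phi(z)\right)\to -\frac{\Phi^{(3)}(z)}{3}$ as $n\to\infty$, where $\Phi^{(3)}(z)=(z^2-1)\frac{1}{\sqrt{2\pi}}e^{-z^2/2}$ is the third derivative of $\Phi$; (c) there exist a constant $C\in(0,1)$ and an integer $n_0\ge1$ such that for every $n\ge n_0$, $$C<\frac{n}{\sqrt{2n-1}}\sup_{z\in\mathbb{R}}|P(\bar Q_n\le z)-\Phi(z)|\le 1.$$ \end{enumerate}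
   Context: $X_t$ is the solution of $dX_t=\mu\,dt+\sigma\,dG_t$, $X_0=0$; $\hat\mu_n,\hat\sigma_n^2$ are the maximum likelihood estimators of $\mu,\sigma^2$ based on $\mathbf X$. A symmetric matrix is strictly positive definite if its quadratic form is positive on nonzero vectors. *)

(* Defs.v *)
From HB Require Import structures.
From mathcomp Require Import all_boot all_order all_algebra.
From mathcomp Require Import all_classical all_reals all_analysis.
From mathcomp Require Import normal_distribution.
Set Implicit Arguments. Unset Strict Implicit. Unset Printing Implicit Defensive.
Import Order.TTheory GRing.Theory Num.Theory.
Import numFieldNormedType.Exports.
Local Open Scope classical_set_scope.
Local Open Scope ring_scope.

Section Defs.
Context {R : realType} {d : measure_display} {T : measurableType d}.
Variable P : probability T R.

Definition centered_normal_law (v : R) : set R -> \bar R :=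
  fun A => if 0 < v then normal_prob 0 (Num.sqrt v) A else (\1_A (0 : R))%:E.

Definition is_centered_gaussian (X : T -> R) : Prop :=
  measurable_fun setT X /\
  exists v : R, 0 <= v /\
    forall A : set R, measurable A -> P (X @^-1` A) = centered_normal_law v A.

Definition centered_gaussian_process (G : R -> T -> R) : Prop :=
  (forall s, measurable_fun setT (G s)) /\
  forall (k : nat) (s a : 'I_k -> R), (forall i, 0 <= s i) ->
    is_centered_gaussian (fun w => \sum_(i < k) a i * G (s i) w).

Definition cov_fun (G : R -> T -> R) (s u : R) : R :=
  fine ('E_P[(fun w => G s w * G u w)%R])%E.

Definition Xproc (G : R -> T -> R) (mu sigma : R) (s : R) (w : T) : R :=
  mu * s + sigma * G s w.

(* observation vector t = (t_1,...,t_n)'  (t_{i+1} is [t i]) *)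
Definition tvec (t : nat -> R) (n : nat) : 'cV[R]_n := \col_(i < n) t i.

Definition Xvec (G : R -> T -> R) (mu sigma : R) (t : nat -> R) (n : nat)
  (w : T) : 'cV[R]_n := \col_(i < n) Xproc G mu sigma (t i) w.

Definition Vmat (G : R -> T -> R) (t : nat -> R) (n : nat) : 'M[R]_n :=
  \matrix_(i < n, j < n) cov_fun G (t i) (t j).

Definition bform {n : nat} (u : 'cV[R]_n) (M : 'M[R]_n) (v : 'cV[R]_n) : R :=
  (u^T *m M *m v) 0 0.

Definition pos_def {n : nat} (M : 'M[R]_n) : Prop :=
  forall v : 'cV[R]_n, v != 0 -> 0 < bform v M v.

Definition mu_hat G mu sigma t (n : nat) (w : T) : R :=
  bform (tvec t n) (invmx (Vmat G t n)) (Xvec G mu sigma t n w) /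
  bform (tvec t n) (invmx (Vmat G t n)) (tvec t n).

Definition sigma2_hat G mu sigma t (n : nat) (w : T) : R :=
  let Vi := invmx (Vmat G t n) in
  let X := Xvec G mu sigma t n w in
  let tt := tvec t n in
  n%:R^-1 * ((bform X Vi X * bform tt Vi tt - (bform tt Vi X) ^+ 2)
             / bform tt Vi tt).

Definition Y_n G mu sigma t (n : nat) (w : T) : R :=
  sigma^-1 * Num.sqrt (bform (tvec t n) (invmx (Vmat G t n)) (tvec t n))
  * (mu_hat G mu sigma t n w - mu).

Definition Q_n G mu sigma t (n : nat) (w : T) : R :=
  (sigma ^+ 2)^-1 * Num.sqrt (n%:R / 2) * (sigma2_hat G mu sigma t n w - sigma ^+ 2).

Definition Qbar_n G mu sigma t (n : nat) (w : T) : R :=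
  Q_n G mu sigma t n w - fine ('E_P[Q_n G mu sigma t n])%E.

Definition std_normal2 := (normal_prob (0 : R) 1 \x normal_prob (0 : R) 1)%E.

Definition cvg_law_std_normal2 (Z : nat -> T -> R * R) : Prop :=
  forall f : R * R -> R, continuous f -> (exists M : R, forall p, `|f p| <= M) ->
    (fun n => fine ('E_P[(fun w => f (Z n w))%R])%E) @ \oo -->
      fine (\int[std_normal2]_p (f p)%:E)%E.

Definition prob_le (Xi : T -> R) (z : R) : R := fine (P [set w | Xi w <= z]).

End Defs.

Section Std.
Context {R : realType}.
Definition phi (x : R) : R := normal_pdf 0 1 x.
Definition Phi (z : R) : R := fine (normal_prob (0 : R) 1 `]-oo, z]).
Definition Phi3 (z : R) : R := (z ^+ 2 - 1) * phi z.
End Std.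

Definition kolmogorov_dist {R : realType} {d} {T : measurableType d}
  (P : probability T R) (Xi : T -> R) : R :=
  sup [set `|prob_le P Xi z - Phi z| | z in [set: R]].

(* Main.v *)
(* Completing [V^-1 t], normalized, to a [V]-orthonormal basis shows that [Y_n] is
   standard normal and that [n sigma2_hat / sigma^2] is a sum [W] of [n - 1] squares of
   standard normal variables, independent of [Y_n]. Gaussian integration by parts gives
   [E (W g W) = (n - 1) E (g W) + 2 E (W g' W)], which for the standardized variable
   [X = Qbar_n] reads [E (X g X) = E ((a + b X) g' X)] with [a = (n - 1) / n] and
   [b = 2 / sqrt (2 n)]. If [f] solves the Stein equation of the indicator of ]-oo, z],
   then [P (X <= z) - Phi z = E ((1 - a - b X) f' X)]; as [|f'| <= 1] and
   [E (1 - a - b X)^2 = (2 n - 1) / n^2], Cauchy-Schwarz yields the Kolmogorov bound.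
   Using the identity once more evaluates [E (X f' X)] up to [O (n^(-1/2))], which is the
   Edgeworth limit and hence the lower bound. The joint limit law follows by conditioning
   on [W], independence turning a bounded continuous function of [(Y_n, Q_n)] into one of
   [Q_n] alone. Almost sure convergence follows from moments that are summable in [n]:
   the fourth moment of [X] is bounded, and [mu_hat - mu = sigma Y_n / sqrt tau] where
   [tau = t' V^-1 t] grows polynomially since [t_n^2 <= V_nn tau] by Cauchy-Schwarz. *)

(* Gaussian integration by parts yields Stein identities for functions of class C^1, but the
   solution [fz] for an indicator has a kink at [z]. The relation [stein_pair] therefore records the
   integral identity alone, which survives dominated limits, and kinked pairs are reached by
   composing their branches with smoothed ramps. Laws and independence are compared through
   integrals of real cosines with a free phase; convolution with a small normal law makes these
   transforms decide equality, one coordinate at a time. After the reduction to [Y_n] and [W], the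
   law of [W] enters only through [chi2_stein], never through a density. The Edgeworth term is
   computable because [3 x f' x - Phi3 z] is itself the side [g' - x g] of a Stein equation with an
   explicit solution [g], so that a second use of the identity gains another factor [b]. *)
Require Import Defs.
From HB Require Import structures.
From mathcomp Require Import all_boot all_order all_algebra.
From mathcomp Require Import all_classical all_reals all_analysis.
From mathcomp Require Import measurable_realfun normal_distribution.
From mathcomp Require Import ring lra zify.
Set Implicit Arguments.
Unset Strict Implicit.
Unset Printing Implicit Defensive.
Import Order.TTheory GRing.Theory Num.Theory.
Import numFieldNormedType.Exports.
Local Open Scope classical_set_scope.
Local Open Scope ring_scope.

(** * Integration *)

Section integration.
Context {R : realType} d (T : measurableType d).
Variable m : {measure set T -> \bar R}.
Implicit Types f g : T -> R.

Lemma integrable_measurable f :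
  m.-integrable setT (EFin \o f) -> measurable_fun setT f.
Proof. by move=> /integrableP[/measurable_EFinP]. Qed.

Lemma integrable_dom f g : measurable_fun setT f ->
  (forall x, `|f x| <= g x) -> m.-integrable setT (EFin \o g) ->
  m.-integrable setT (EFin \o f).
Proof.
move=> mf fg ig; apply: le_integrable ig => //; first exact/measurable_EFinP.
by move=> x _ /=; rewrite lee_fin (le_trans (fg x))// ler_norm.
Qed.

Lemma integrableD_fin f g : m.-integrable setT (EFin \o f) ->
  m.-integrable setT (EFin \o g) ->
  m.-integrable setT (EFin \o (fun x => f x + g x)).
Proof. by move=> i1 i2; apply: eq_integrable (integrableD measurableT i1 i2). Qed.

Lemma integrableB_fin f g : m.-integrable setT (EFin \o f) ->
  m.-integrable setT (EFin \o g) ->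
  m.-integrable setT (EFin \o (fun x => f x - g x)).
Proof. by move=> i1 i2; apply: eq_integrable (integrableB measurableT i1 i2). Qed.

Lemma integrableZ_fin r f : m.-integrable setT (EFin \o f) ->
  m.-integrable setT (EFin \o (fun x => r * f x)).
Proof. by move=> i1; apply: eq_integrable (integrableZl measurableT r i1). Qed.

Lemma integrable_sum_fin (I : Type) (s : seq I) (p : pred I) (F : I -> T -> R) :
  (forall i, p i -> m.-integrable setT (EFin \o F i)) ->
  m.-integrable setT (EFin \o (fun x => \sum_(i <- s | p i) F i x)).
Proof.
move=> iF; elim: s => [|a s IH].
  under eq_fun do rewrite /= big_nil.
  exact: integrable0.
have [pa|pa] := boolP (p a); rewrite [X in EFin \o X](_ : _ = fun x =>
  (if p a then F a x else 0) + \sum_(i <- s | p i) F i x).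
- by rewrite pa; apply: integrableD_fin => //; exact: iF.
- by apply/funext => x; rewrite big_cons pa.
- rewrite (negbTE pa); apply: eq_integrable IH => // x _ /=.
  by rewrite add0r.
- by apply/funext => x; rewrite big_cons (negbTE pa) add0r.
Qed.

Lemma Rintegral_sum (I : Type) (s : seq I) (p : pred I) (F : I -> T -> R) :
  (forall i, p i -> m.-integrable setT (EFin \o F i)) ->
  \int[m]_x (\sum_(i <- s | p i) F i x) = \sum_(i <- s | p i) \int[m]_x (F i x).
Proof.
move=> iF; elim: s => [|a s IH].
  by rewrite big_nil; under eq_Rintegral do rewrite big_nil; rewrite Rintegral_cst// mul0r.
rewrite big_cons -IH; under eq_Rintegral do rewrite big_cons.
case: ifP => // pa; rewrite RintegralD//; first exact: iF.
exact: integrable_sum_fin.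
Qed.

Lemma Rintegral_dominated (f_ : nat -> T -> R) f g :
  (forall n, measurable_fun setT (f_ n)) ->
  (forall x, f_ n x @[n --> \oo] --> f x) ->
  m.-integrable setT (EFin \o g) ->
  (forall n x, `|f_ n x| <= g x) ->
  \int[m]_x f_ n x @[n --> \oo] --> \int[m]_x f x.
Proof.
move=> mf fc ig fg.
have mfl : measurable_fun setT f by apply: (@measurable_fun_cvg _ _ _ _ f_) => // x _; exact: fc.
have [] := @dominated_convergence _ _ _ m _ measurableT
   (fun n => EFin \o f_ n) (EFin \o f) (EFin \o g).
- by move=> n; apply/measurable_EFinP.
- exact/measurable_EFinP.
- by apply: aeW => x _; apply: cvg_EFin; [exact: nearW|exact: fc].
- by [].
- by apply: aeW => x n _ /=; rewrite lee_fin.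
move=> ifl _ h; rewrite /Rintegral; apply: fine_cvg.
rewrite fineK//; exact: integrable_fin_num.
Qed.

End integration.

Section probability_integration.
Context {R : realType} d (T : measurableType d) (P : probability T R).

Lemma integrable_bounded (f : T -> R) M : measurable_fun setT f ->
  (forall x, `|f x| <= M) -> P.-integrable setT (EFin \o f).
Proof.
move=> mf fM; apply: (@integrable_dom _ _ _ _ _ (cst M)) => //.
exact: finite_measure_integrable_cst.
Qed.

Lemma Rintegral_prob_cst (c : R) : \int[P]_x c = c.
Proof. by rewrite Rintegral_cst//= probability_setT mulr1. Qed.

Lemma normr_Rintegral_le (f : T -> R) M : measurable_fun setT f ->
  (forall x, `|f x| <= M) -> `|\int[P]_x f x| <= M.
Proof.
move=> mf fM; have i := integrable_bounded mf fM.
apply: (le_trans (le_normr_Rintegral measurableT i)).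
rewrite -[leRHS]Rintegral_prob_cst; apply: le_Rintegral => //.
  apply: (@integrable_bounded _ M) => [|x]; first exact: measurableT_comp.
  by rewrite normr_id.
exact: finite_measure_integrable_cst.
Qed.

End probability_integration.

Section fubini.
Context {R : realType} d1 d2 (T1 : measurableType d1) (T2 : measurableType d2).
Variables (m1 : {sigma_finite_measure set T1 -> \bar R})
  (m2 : {sigma_finite_measure set T2 -> \bar R}).
Variable f : T1 -> T2 -> R.
Hypothesis f12 : (m1 \x m2)%E.-integrable setT (fun p => (f p.1 p.2)%:E).

Lemma Rfubini1 : (forall x, m2.-integrable setT (EFin \o f x)) ->
  \int[m1]_x \int[m2]_y f x y = \int[(m1 \x m2)%E]_p f p.1 p.2.
Proof.
move=> i2; rewrite /Rintegral -integral12_prod_meas1//.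
congr fine; apply: eq_integral => x _.
by rewrite /fubini_F fineK//; apply: integrable_fin_num => //; exact: i2.
Qed.

Lemma Rfubini2 : (forall y, m1.-integrable setT (EFin \o f ^~ y)) ->
  \int[m2]_y \int[m1]_x f x y = \int[(m1 \x m2)%E]_p f p.1 p.2.
Proof.
move=> i2; rewrite /Rintegral -integral21_prod_meas1//.
congr fine; apply: eq_integral => x _.
by rewrite /fubini_G fineK//; apply: integrable_fin_num => //; exact: i2.
Qed.
End fubini.

Section caratheodory.
Context {R : realType} d (T : measurableType d).

(** Rounding [b] down to the grid of mesh [1 / (n + 1)] gives functions whose preimages are
    countable unions of rectangles; continuity in [b] makes [F] their pointwise limit. *)
Lemma measurable_fun_caratheodory (F : T -> R -> R) :
  (forall b, measurable_fun setT (F ^~ b)) -> (forall w, continuous (F w)) ->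
  measurable_fun setT (fun p : T * R => F p.1 p.2).
Proof.
move=> mF cF.
pose r n (b : R) : R := (Num.floor (n.+1%:R * b))%:~R / n.+1%:R.
have rc b : r n b @[n --> \oo] --> b.
  apply/cvgrPdist_le => e e0; near=> n.
  have n0 : 0 < n.+1%:R :> R by [].
  rewrite /r -{1}(mulKf (lt0r_neq0 n0) b) mulrC -mulrBl normrM.
  rewrite ger0_norm ?subr_ge0 ?floor_le//.
  rewrite normfV gtr0_norm// ler_pdivrMr//.
  apply: (@le_trans _ _ 1).
    by rewrite lerBlDr addrC -intrD1 ltW// floorD1_gt.
  rewrite mulrC -ler_pdivrMr// div1r (@le_trans _ _ n%:R) ?ler_nat//; near: n.
  exact: nbhs_infty_ger.
apply: (@measurable_fun_cvg _ _ _ _ (fun n (p : T * R) => F p.1 (r n p.2))).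
  move=> n _ A mA; rewrite setTI.
  rewrite [X in measurable X](_ : _ = \bigcup_(k in [set: int])
     ([set w | A (F w (k%:~R / n.+1%:R))] `*`
      [set b | Num.floor (n.+1%:R * b) = k])); last first.
    apply/seteqP; split=> [[w b] /= Aw|[w b] [k _ [/= Aw bk]]] /=.
      by exists (Num.floor (n.+1%:R * b)).
    by rewrite /r bk.
  apply: countable_bigcupT_measurable => // k; apply: measurableX.
    by have := mF (k%:~R / n.+1%:R) measurableT A mA; rewrite setTI.
  rewrite [X in measurable X](_ : _ =
    `[k%:~R / n.+1%:R, (k + 1)%:~R / n.+1%:R[%classic); first exact: measurable_itv.
  apply/seteqP; split=> b /=.
    move=> <-; rewrite in_itv/= ler_pdivrMr// ltr_pdivlMr// mulrC floor_le/=.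
    exact: floorD1_gt.
  rewrite in_itv/= ler_pdivrMr// ltr_pdivlMr// => h; apply/eqP.
  by rewrite floor_eq mulrC.
move=> [w b] _ /=; apply: continuous_cvg (rc b); exact: cF.
Unshelve. all: by end_near. Qed.
End caratheodory.

Section normal_density.
Context {R : realType}.
Notation leb := (@lebesgue_measure R).

(** The Radon-Nikodym derivative of the normal law agrees almost everywhere with [normal_pdf], both
    having the same integral over every measurable set. *)
Lemma ge0_integral_normal_prob (m s : R) (f : R -> \bar R) :
  measurable_fun setT f -> (forall x, 0 <= f x)%E ->
  (\int[normal_prob m s]_x f x = \int[leb]_x (f x * (normal_pdf m s x)%:E))%E.
Proof.
move=> mf f0.
pose nu : {finite_measure set _ -> \bar R} := normal_prob m s.
have dom : nu `<< leb by exact: normal_prob_dominates.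
rewrite -(Radon_Nikodym_SigmaFinite.change_of_variables dom)//.
have iRN := Radon_Nikodym_SigmaFinite.f_integrable dom.
apply: ae_eq_integral => //.
- by apply: emeasurable_funM => //; exact: measurable_int iRN.
- by apply: emeasurable_funM => //; apply/measurable_EFinP; exact: measurable_normal_pdf.
- apply: ae_eqe_mul2l; apply: integral_ae_eq => //.
  + by apply/measurable_EFinP; exact: measurable_normal_pdf.
  + by move=> E _ mE; rewrite -Radon_Nikodym_SigmaFinite.f_integral.
Qed.

Definition Rid : measurableTypeR R -> R := idfun.
HB.instance Definition _ := @isMeasurableFun.Build _ _ _ _ Rid (@measurable_id _ _ setT).

(* Transports the normal law from [measurableTypeR R] to the canonical
   measurable structure of [R]; the two differ only by their displays. *)
Definition stdN : probability R R := distribution (normal_prob (0 : R) 1) Rid.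

Lemma stdNE (A : set R) : stdN A = normal_prob (0 : R) 1 A.
Proof. by []. Qed.

Lemma ge0_integral_stdN (f : R -> \bar R) :
  measurable_fun setT f -> (forall x, 0 <= f x)%E ->
  (\int[stdN]_x f x = \int[leb]_x (f x * (phi x)%:E))%E.
Proof.
move=> mf f0; rewrite ge0_integral_distribution//.
by rewrite ge0_integral_normal_prob.
Qed.

Lemma measurable_phi : measurable_fun setT (@phi R).
Proof. exact: measurable_normal_pdf. Qed.

Lemma phi_ge0 x : 0 <= @phi R x.
Proof. exact: normal_pdf_ge0. Qed.

Lemma integrable_stdN (f : R -> R) : measurable_fun setT f ->
  stdN.-integrable setT (EFin \o f) <->
  leb.-integrable setT (EFin \o (fun x => f x * phi x)).
Proof.
move=> mf.
have mfp : measurable_fun setT (fun x => f x * phi x).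
  by apply: measurable_funM => //; exact: measurable_phi.
have -> : stdN.-integrable setT (EFin \o f) <->
    (\int[stdN]_x `|f x|%:E < +oo)%E.
  by split=> [/integrableP[]//|h]; apply/integrableP; split => //; exact/measurable_EFinP.
have -> : leb.-integrable setT (EFin \o (fun x => f x * phi x)) <->
    (\int[leb]_x `|f x * phi x|%:E < +oo)%E.
  by split=> [/integrableP[]//|h]; apply/integrableP; split => //; exact/measurable_EFinP.
rewrite ge0_integral_stdN//; last first.
  by apply/measurable_EFinP; exact: measurableT_comp.
under eq_integral do rewrite -EFinM -(ger0_norm (phi_ge0 _)) -normrM.
by [].
Qed.

Lemma Rintegral_stdN (f : R -> R) : measurable_fun setT f ->
  \int[stdN]_x f x = \int[leb]_x (f x * phi x).
Proof.
move=> mf; rewrite /Rintegral; congr fine.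
rewrite [LHS]integralE [RHS]integralE !ge0_integral_stdN//; last 2 first.
- by apply: measurable_funeneg; exact/measurable_EFinP.
- by apply: measurable_funepos; exact/measurable_EFinP.
congr (_ - _)%E; apply: eq_integral => x _.
  by rewrite !funeposE /= -!EFin_max -EFinM maxr_pMl ?phi_ge0// mul0r.
by rewrite !funenegE /= -!EFin_max -EFinM maxr_pMl ?phi_ge0// mul0r mulNr.
Qed.

Lemma normal_pdf_scale (m s x : R) : 0 < s ->
  normal_pdf m s (m + s * x) = s^-1 * normal_pdf 0 1 x.
Proof.
move=> s0; rewrite !normal_pdfE ?oner_eq0 ?gt_eqF// /normal_peak /normal_fun.
rewrite expr1n mul1r subr0 mulrA; congr (_ * expR _); last first.
  by field; rewrite gt_eqF.
rewrite -mulrnAr sqrtrM ?sqr_ge0// sqrtr_sqr gtr0_norm// invfM//.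
Qed.

Lemma ge0_integral_normal_scale (m s : R) (F : R -> R) : 0 < s ->
  continuous F -> (forall x, 0 <= F x) ->
  (\int[leb]_x (F x * normal_pdf m s x)%:E = \int[stdN]_x (F (m + s * x))%:E)%E.
Proof.
move=> s0 cF F0.
have cl : continuous (fun x : R => m + s * x).
  by move=> x; apply: cvgD; [exact: cvg_cst|apply: cvgM; [exact: cvg_cst|exact: cvg_id]].
have dl (x : R) : is_derive x 1 (fun x : R => m + s * x) s.
  by apply: is_derive_eq; rewrite /GRing.scale/=; ring.
have d1 : (fun x : R => m + s * x)^`()%classic = cst s.
  by apply/funext => x; rewrite derive1E; apply: derive_val.
rewrite ge0_integral_stdN; last 2 first.
- apply/measurable_EFinP; apply: continuous_measurable_fun => x.
  by apply: continuous_comp; [exact: cl|exact: cF].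
- by move=> x; rewrite lee_fin.
under [RHS]eq_integral do rewrite -EFinM.
rewrite (@increasing_ge0_integration_by_substitutionT _ (fun x => m + s * x)).
- apply: eq_integral => x _; congr EFin => /=.
  by rewrite !fctE/= d1 normal_pdf_scale// /cst /phi; field; rewrite gt_eqF.
- by move=> x y xy; rewrite ltrD2l ltr_pM2l.
- by rewrite d1 => x; exact: cvg_cst.
- by rewrite d1; exact: is_cvg_cst.
- by rewrite d1; exact: is_cvg_cst.
- by move=> x; exact: ex_derive.
- apply: (cvg_comp _ (fun y => m + y)); last exact: cvg_addrl_Ny.
  by apply: gt0_cvgMrNy => //; exact: cvg_id.
- apply: (cvg_comp _ (fun y => m + y)); last exact: cvg_addrl.
  by apply: gt0_cvgMry => //; exact: cvg_id.
- move=> x; apply: cvgM; first exact: cF.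
  by apply: continuous_normal_pdf; rewrite gt_eqF.
- by move=> x; rewrite mulr_ge0// normal_pdf_ge0.
Qed.

Lemma Rintegral_normal_scale (m s : R) (F : R -> R) M : 0 < s ->
  continuous F -> (forall x, `|F x| <= M) ->
  \int[leb]_x (F x * normal_pdf m s x) = \int[stdN]_x F (m + s * x).
Proof.
move=> s0 cF FM.
have mF : measurable_fun setT F by exact: continuous_measurable_fun.
have mF' : measurable_fun setT (fun x => F (m + s * x)).
  by apply: measurableT_comp => //; apply: measurable_funD => //; exact: measurable_funM.
have ip : leb.-integrable setT (EFin \o normal_pdf m s) by exact: integrable_normal_pdf.
have iF : leb.-integrable setT (EFin \o (fun x => F x * normal_pdf m s x)).
  apply: (@integrable_dom R _ (measurableTypeR R) leb _ (fun x => M * normal_pdf m s x)).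
  - by apply: measurable_funM => //; exact: measurable_normal_pdf.
  - by move=> x; rewrite normrM (ger0_norm (normal_pdf_ge0 _ _ _)) ler_wpM2r ?normal_pdf_ge0.
  - exact: integrableZ_fin.
have iF' : stdN.-integrable setT (EFin \o (fun x => F (m + s * x))).
  by apply: (@integrable_bounded _ _ _ stdN _ M) => // x; exact: FM.
(* Adding the constant [M] to [F] makes it nonnegative, so that the substitution rule for
   nonnegative functions applies. *)
apply: (@addIr _ (\int[leb]_x (M * normal_pdf m s x))).
rewrite -(RintegralD measurableT iF (integrableZ_fin M ip)).
have -> : \int[leb]_x (M * normal_pdf m s x) = \int[stdN]_x M.
  rewrite Rintegral_prob_cst (RintegralZl _ measurableT ip) /Rintegral.
  by rewrite integral_normal_pdf mulr1.
rewrite -(RintegralD measurableT iF'); last exact: finite_measure_integrable_cst.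
under eq_Rintegral do rewrite -mulrDl.
rewrite /Rintegral; congr fine.
apply: (ge0_integral_normal_scale _ _ (F := fun x => F x + M)) => //.
  by move=> x; apply: cvgD; [exact: cF|exact: cvg_cst].
by move=> x; rewrite -lerBlDr sub0r; have := FM x; rewrite ler_norml => /andP[].
Qed.

End normal_density.

(** * The standard normal law *)

Section growth.
Context {R : realType}.
Implicit Types f g : R -> R.

(** The base [1 + |x|] is at least 1, so bounds with different exponents can be merged by raising
    the smaller one. *)
Definition pgrowth f := exists C p, forall x, `|f x| <= C * (1 + `|x|) ^+ p.

Lemma ge1_1Dnormr (x : R) : 1 <= 1 + `|x|.
Proof. by rewrite lerDl. Qed.

Lemma pgrowth_cst c : pgrowth (fun=> c).
Proof. by exists `|c|, 0%N => x; rewrite expr0 mulr1. Qed.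

Lemma pgrowth_id : pgrowth id.
Proof. by exists 1, 1%N => x; rewrite expr1 mul1r lerDr. Qed.

Lemma pgrowth_ge0 f : pgrowth f ->
  exists C p, 0 <= C /\ forall x, `|f x| <= C * (1 + `|x|) ^+ p.
Proof.
move=> [C [p fC]]; exists `|C|, p; split => // x; apply: (le_trans (fC x)).
by rewrite ler_wpM2r ?exprn_ge0 ?addr_ge0// ler_norm.
Qed.

Lemma pgrowthM f g : pgrowth f -> pgrowth g -> pgrowth (fun x => f x * g x).
Proof.
move=> /pgrowth_ge0[C [p [C0 fC]]] /pgrowth_ge0[D [q [D0 gD]]].
exists (C * D), (p + q)%N => x; rewrite normrM exprD mulrACA.
by apply: ler_pM.
Qed.

Lemma pgrowthD f g : pgrowth f -> pgrowth g -> pgrowth (fun x => f x + g x).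
Proof.
move=> /pgrowth_ge0[C [p [C0 fC]]] /pgrowth_ge0[D [q [D0 gD]]].
exists (C + D), (p + q)%N => x; rewrite (le_trans (ler_normD _ _))// mulrDl lerD//.
  by rewrite (le_trans (fC x))// ler_wpM2l// ler_weXn2l ?leq_addr// ge1_1Dnormr.
by rewrite (le_trans (gD x))// ler_wpM2l// ler_weXn2l ?leq_addl// ge1_1Dnormr.
Qed.

Lemma pgrowthN f : pgrowth f -> pgrowth (fun x => - f x).
Proof. by move=> [C [p fC]]; exists C, p => x; rewrite normrN. Qed.

Lemma pgrowthB f g : pgrowth f -> pgrowth g -> pgrowth (fun x => f x - g x).
Proof. by move=> fp gp; apply: pgrowthD => //; exact: pgrowthN. Qed.

Lemma pgrowthX f n : pgrowth f -> pgrowth (fun x => f x ^+ n).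
Proof.
move=> fp; elim: n => [|n IH]; first exact: pgrowth_cst.
by under eq_fun do rewrite exprS; exact: pgrowthM.
Qed.

Lemma le_pgrowth f g : (forall x, `|f x| <= `|g x|) -> pgrowth g -> pgrowth f.
Proof. by move=> fg [C [p gC]]; exists C, p => x; rewrite (le_trans (fg x)). Qed.

Lemma bounded_pgrowth f M : (forall x, `|f x| <= M) -> pgrowth f.
Proof. by move=> fM; exists M, 0%N => x; rewrite expr0 mulr1. Qed.

Lemma pgrowth_comp f g : pgrowth f -> pgrowth g -> pgrowth (fun x => f (g x)).
Proof.
move=> /pgrowth_ge0[C [p [C0 fC]]] /pgrowth_ge0[D [q [D0 gD]]].
apply: (@le_pgrowth _ (fun x => C * (1 + (D * (1 + `|x|) ^+ q)) ^+ p)).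
  move=> x; apply: (le_trans (fC _)); apply: le_trans (ler_norm _).
  by rewrite ler_wpM2l// lerXn2r ?nnegrE ?addr_ge0 ?mulr_ge0 ?exprn_ge0 ?addr_ge0// lerD2l.
apply: pgrowthM; first exact: pgrowth_cst.
apply: pgrowthX; apply: pgrowthD; first exact: pgrowth_cst.
by exists `|D|, q => x; rewrite normrM ler_wpM2l// ger0_norm// exprn_ge0 ?addr_ge0.
Qed.

End growth.

Section gaussian.
Context {R : realType}.
Notation leb := (@lebesgue_measure R).
Notation phi := (@phi R).

Lemma phiE x : phi x = (Num.sqrt (pi *+ 2))^-1 * expR (- x ^+ 2 / 2).
Proof.
by rewrite /Defs.phi normal_pdfE ?oner_eq0// /normal_peak /normal_fun expr1n mul1r subr0.
Qed.

Lemma phi_gt0 x : 0 < phi x.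
Proof. by rewrite phiE mulr_gt0 ?expR_gt0// invr_gt0 sqrtr_gt0 mulrn_wgt0// pi_gt0. Qed.

Lemma is_derive_phi (x : R) : is_derive x 1 phi (- x * phi x).
Proof.
rewrite (_ : phi = fun x => (Num.sqrt (pi *+ 2))^-1 * expR (- x ^+ 2 / 2)).
  by apply: is_derive_eq; rewrite /GRing.scale/=; field; rewrite gt_eqF// sqrtr_gt0 mulrn_wgt0// pi_gt0.
by apply/funext => y; exact: phiE.
Qed.

Lemma continuous_phi : continuous phi.
Proof. by move=> x; apply: differentiable_continuous; apply/derivable1_diffP; apply: (@ex_derive _ _ _ _ _ _ _ (is_derive_phi x)). Qed.

(** The normal density of deviation 2 absorbs every polynomial factor; its integrability passes to
    all functions of polynomial growth. *)
Lemma phi_decay p : exists C, forall x, (1 + `|x|) ^+ p * phi x <= C * normal_pdf 0 2 x.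
Proof.
have p2 : 0 < @normal_peak R 2 by apply: normal_peak_gt0; rewrite pnatr_eq0.
exists ((Num.sqrt (pi *+ 2))^-1 * expR (p%:R ^+ 2) / normal_peak 2) => x.
rewrite normal_pdfE ?pnatr_eq0// mulrA divfK ?gt_eqF// phiE mulrCA -mulrA.
rewrite ler_wpM2l ?invr_ge0//.
have h : (1 + `|x|) ^+ p <= expR (p%:R * `|x|).
  by rewrite expRM_natl lerXn2r ?nnegrE ?addr_ge0 ?expR_ge0// expR_ge1Dx.
rewrite (le_trans (ler_wpM2r (expR_ge0 _) h))// /normal_fun -!expRD ler_expR subr0.
rewrite -(real_normK (num_real x)); set a := `|x|; set q := p%:R.
(* The exponents compare as [q a - a^2 / 2 <= q^2 - a^2 / 8]; the difference of the two sides is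
   [3/8 (a - 4/3 q)^2 + q^2 / 3]. *)
have := sqr_ge0 (a - 4 / 3 * q); have := sqr_ge0 q; rewrite -(mulr_natr (2 ^+ 2)); nra.
Qed.

Lemma integrable_pgrowth (f : R -> R) : measurable_fun setT f -> pgrowth f ->
  stdN.-integrable setT (EFin \o f).
Proof.
move=> mf /pgrowth_ge0[C [p [C0 fC]]]; apply/integrable_stdN => //.
have [D hD] := phi_decay p.
apply: (@integrable_dom R _ (measurableTypeR R) leb _ (fun x => C * D * normal_pdf 0 2 x)).
- by apply: measurable_funM => //; exact: measurable_phi.
- move=> x; rewrite normrM (ger0_norm (phi_ge0 _)).
  by rewrite (le_trans (ler_wpM2r (phi_ge0 _) (fC x)))// -!mulrA ler_wpM2l.
- by apply: integrableZ_fin; exact: integrable_normal_pdf.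
Qed.

Lemma phi_tail p : exists C, 0 <= C /\ forall x, (1 + `|x|) ^+ p * phi x <= C / (1 + `|x|).
Proof.
have [D hD] := phi_decay p.+1.
exists (`|D| * normal_peak 2); split=> [|x].
  by rewrite mulr_ge0// normal_peak_ge0.
rewrite ler_pdivlMr// mulrAC -exprSr (le_trans (hD x))//.
rewrite (@le_trans _ _ (`|D| * normal_pdf 0 2 x))//.
  by rewrite ler_wpM2r ?normal_pdf_ge0// ler_norm.
by rewrite ler_wpM2l// normal_pdf_ub// pnatr_eq0.
Qed.

(** [(G phi)' = (G' - x G) phi] is integrated over growing symmetric intervals: the boundary terms
    vanish by [phi_tail], and dominated convergence recovers the integral over the line. *)
Lemma stdN_ibp (G G' : R -> R) : (forall x : R, is_derive x 1 G (G' x)) ->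
  continuous G' -> pgrowth G -> pgrowth G' ->
  \int[stdN]_x (x * G x) = \int[stdN]_x G' x.
Proof.
move=> dG cG' pG pG'.
have cG : continuous G.
  move=> x; apply: differentiable_continuous; apply/derivable1_diffP.
  exact: (@ex_derive _ _ _ _ _ _ _ (dG x)).
have mG : measurable_fun setT G by exact: continuous_measurable_fun.
have mG' : measurable_fun setT G' by exact: continuous_measurable_fun.
have mxG : measurable_fun setT (fun x : R => x * G x) by exact: measurable_funM.
have i1 : stdN.-integrable setT (EFin \o (fun x : R => x * G x)).
  by apply: integrable_pgrowth => //; apply: pgrowthM => //; exact: pgrowth_id.
have i2 : stdN.-integrable setT (EFin \o G') by exact: integrable_pgrowth.
apply/eqP; rewrite eq_sym -subr_eq0; apply/eqP.
rewrite -RintegralB//.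
pose K (x : R) := G' x - x * G x.
pose H (x : R) := G x * phi x.
have mK : measurable_fun setT K by exact: measurable_funB.
rewrite Rintegral_stdN//.
have iK : leb.-integrable setT (EFin \o (fun x : R => K x * phi x)).
  by apply/integrable_stdN => //; exact: integrableB_fin.
have dH (x : R) : is_derive x 1 H (K x * phi x).
  have dp := is_derive_phi x; have dGx := dG x.
  by apply: is_derive_eq; rewrite /GRing.scale/= /K; ring.
have cH : continuous H by move=> x; apply: continuousM; [exact: cG|exact: continuous_phi].
have cK : continuous (fun x : R => K x * phi x).
  move=> x; apply: continuousM; last exact: continuous_phi.
  apply: continuousB; first exact: cG'.
  by apply: continuousM; [exact: cvg_id|exact: cG].
pose f_ (n : nat) := (fun x : R => K x * phi x) \_ `[- n.+1%:R, n.+1%:R]%classic.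
have ftcn n : \int[leb]_x f_ n x = H n.+1%:R - H (- n.+1%:R).
  rewrite -Rintegral_mkcond /Rintegral (@continuous_FTC2 _ _ H)//.
  - by rewrite -subr_gt0 opprK addr_gt0.
  - exact: continuous_subspaceT.
  - split=> [x _||]; first exact: (@ex_derive _ _ _ _ _ _ _ (dH x)).
      by apply: cvg_at_right_filter; exact: cH.
    by apply: cvg_at_left_filter; exact: cH.
  - by move=> x _; rewrite derive1E; exact: (@derive_val _ _ _ _ _ _ _ (dH x)).
have H0 : (H n.+1%:R - H (- n.+1%:R)) @[n --> \oo] --> (0 : R).
  have [C [p [C0 GC]]] := pgrowth_ge0 pG.
  have [D [D0 hD]] := phi_tail p.
  have HD x : `|H x| <= C * D / (1 + `|x|).
    rewrite normrM (ger0_norm (phi_ge0 _)).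
    by rewrite (le_trans (ler_wpM2r (phi_ge0 _) (GC x)))// -!mulrA ler_wpM2l.
  apply/norm_cvg0P.
  apply: (@squeeze_cvgr _ _ _ _ (fun=> 0) (fun n => C * D *+ 2 * n.+1%:R^-1)).
  - apply: nearW => n; rewrite normr_ge0/=.
    rewrite (le_trans (ler_normB _ _))// mulr2n mulrDl.
    have hh : C * D / (1 + n.+1%:R) <= C * D / n.+1%:R.
      by rewrite ler_wpM2l ?mulr_ge0// lef_pV2 ?posrE ?ltr_wpDl// lerDr.
    apply: lerD; apply: le_trans hh.
      by rewrite (le_trans (HD _))// ger0_norm.
    by rewrite (le_trans (HD _))// normrN ger0_norm.
  - exact: cvg_cst.
  - rewrite -(mulr0 (C * D *+ 2)); apply: cvgM; first exact: cvg_cst.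
    exact: cvg_harmonic.
have := @Rintegral_dominated R _ (measurableTypeR R) leb f_ (fun x : R => K x * phi x) (fun x => `|K x * phi x|).
have mf n : measurable_fun setT (f_ n).
  apply/(@measurable_restrict _ _ _ _ _ setT) => //.
  rewrite setTI; apply: measurable_funTS.
  by apply: measurable_funM => //; exact: measurable_phi.
move=> /(_ mf) h.
have : \int[leb]_x f_ n x @[n --> \oo] --> \int[leb]_x (K x * phi x).
  apply: h.
  - move=> x; apply: cvg_near_cst; near=> n.
    rewrite /f_ patchE ifT// inE/= in_itv/= -ler_norml.
    rewrite (@le_trans _ _ n%:R) ?ler_nat//; near: n; exact: nbhs_infty_ger.
  - apply: (@integrable_abse _ _ _ leb setT) iK.
  - by move=> n x; rewrite /f_ patchE; case: ifP => // _; rewrite normr0.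
under eq_fun do rewrite ftcn.
by move=> h2; apply: cvg_unique h2 H0.
Unshelve. all: by end_near. Qed.

End gaussian.

Lemma is_derive1_continuous {R : realType} (f f' : R -> R) :
  (forall x : R, is_derive x 1 f (f' x)) -> continuous f.
Proof.
move=> df x; apply: differentiable_continuous; apply/derivable1_diffP.
exact: (@ex_derive _ _ _ _ _ _ _ (df x)).
Qed.

(** * The Fourier transform of the standard normal law *)

Section charfun.
Context {R : realType}.

Lemma normr_cos_le1 (x : R) : `|cos x| <= 1.
Proof. by rewrite ler_norml cos_geN1 cos_le1. Qed.

Lemma normr_sin_le1 (x : R) : `|sin x| <= 1.
Proof. by rewrite ler_norml sin_geN1 sin_le1. Qed.

Lemma measurable_cos_affine (s th : R) : measurable_fun setT (fun x : R => cos (s * x + th)).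
Proof.
apply: continuous_measurable_fun; apply: (is_derive1_continuous (f' := fun x => - s * sin (s * x + th))) => x.
by apply: is_derive_eq; rewrite /GRing.scale/=; ring.
Qed.

(** Differentiation under the integral and integration by parts give [F' = - s F], so
    [F s * exp (s^2 / 2)] is constant. The phase [th] lets real cosines do the work of complex
    exponentials. *)
Lemma stdN_char (s th : R) :
  \int[stdN]_x cos (s * x + th) = expR (- s ^+ 2 / 2) * cos th.
Proof.
pose F (s : R) := \int[stdN]_x cos (s * x + th).
have dF (a : R) : is_derive a 1 F (- a * F a).
  have bnd := @bounded_pgrowth R.
  have -> : - a * F a = \int[stdN]_x (partial1of2 (fun s x => cos (s * x + th)) a x).
    rewrite /F -RintegralZl//; last first.
      apply: (@integrable_bounded _ _ _ _ _ 1) => [|x]; last exact: normr_cos_le1.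
      exact: measurable_cos_affine.
    transitivity (\int[stdN]_x (x * (fun x : R => - sin (a * x + th)) x)).
      apply/esym; apply: stdN_ibp.
    - by move=> x; apply: is_derive_eq; rewrite /GRing.scale/=; ring.
    - apply: (is_derive1_continuous (f' := fun x => a ^+ 2 * sin (a * x + th))) => x.
      by apply: is_derive_eq; rewrite /GRing.scale/=; ring.
    - by apply: (bnd _ 1) => x; rewrite normrN normr_sin_le1.
    - by apply: (bnd _ `|a|) => x; rewrite normrM normrN ler_piMr ?normr_cos_le1.
    apply: eq_Rintegral => x _; rewrite partial1of2E; apply/esym; apply: derive_val.
    by apply: is_derive_eq; rewrite /GRing.scale/=; ring.
  have i1 x : stdN.-integrable setT (EFin \o (fun y => cos (x * y + th))).
    apply: (@integrable_bounded _ _ _ _ _ 1) => [|y]; last exact: normr_cos_le1.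
    exact: measurable_cos_affine.
  have d1 (x y : R) : is_derive x 1 (fun s : R => cos (s * y + th)) (- y * sin (x * y + th)).
    by apply: is_derive_eq; rewrite /GRing.scale/=; ring.
  have Ia : `](a - 1), (a + 1)[%classic a by rewrite /= in_itv/= ltrBlDr ltrDl ltr01.
  have der := @derivable_under_integral R _ _ stdN (fun s x => cos (s * x + th)) _ measurableT a _ _ Ia (fun x _ => i1 x).
  have dif := @differentiation_under_integral R _ _ stdN (fun s x => cos (s * x + th)) _ measurableT a _ _ Ia (fun x _ => i1 x).
  have h1 : forall x y : R, `](a - 1), (a + 1)[%classic x -> [set: R] y ->
    derivable (fun s : R => cos (s * y + th)) x 1.
    by move=> x y _ _; exact: (@ex_derive _ _ _ _ _ _ _ (d1 x y)).
  have h2 : stdN.-integrable setT (EFin \o (fun x : R => `|x|)).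
    apply: integrable_pgrowth; first exact: measurableT_comp.
    by apply: le_pgrowth pgrowth_id => x; rewrite normr_id.
  have h3 : forall x y : R, `](a - 1), (a + 1)[%classic x -> [set: R] y ->
    `|partial1of2 (fun s x => cos (s * x + th)) x y| <= `|y|.
    move=> x y _ _; rewrite partial1of2E (@derive_val _ _ _ _ _ _ _ (d1 x y)).
    by rewrite normrM normrN ler_piMr// normr_sin_le1.
  apply: DeriveDef; first exact: der h1 _ _ h2 h3.
  by rewrite -derive1E (dif h1 _ _ h2 h3).
pose K (x : R) := F x * expR (x ^+ 2 / 2).
have dK (x : R) : is_derive x 1 K 0.
  have := dF x => ?.
  by apply: is_derive_eq; rewrite /GRing.scale/=; field.
have : K s = K 0 by exact: is_derive_0_is_cst.
rewrite {2}/K expr0n/= mul0r expR0 mulr1 /F.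
under eq_Rintegral do rewrite mul0r add0r.
rewrite Rintegral_prob_cst => <-; rewrite /K mulrC -mulrA -expRD.
by rewrite mulNr subrr expR0 mulr1.
Qed.

Lemma stdN_cos (s : R) : \int[stdN]_x cos (s * x) = expR (- s ^+ 2 / 2).
Proof.
have := stdN_char s 0; rewrite cos0 mulr1 => <-.
by apply: eq_Rintegral => x _; rewrite addr0.
Qed.

Lemma stdN_var : \int[stdN]_x (x : R) ^+ 2 = 1.
Proof.
under eq_Rintegral do rewrite expr2.
rewrite (stdN_ibp (fun x : R => is_derive_id x 1)) ?Rintegral_prob_cst//.
- by move=> x; exact: cst_continuous.
- exact: pgrowth_id.
- exact: pgrowth_cst.
Qed.

End charfun.

(** * Fourier transforms and joint laws *)

Section bounded_fubini.
Context {R : realType} d1 d2 (T1 : measurableType d1) (T2 : measurableType d2).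
Variables (P1 : probability T1 R) (P2 : probability T2 R).
Variables (f : T1 -> T2 -> R) (M : R).
Hypothesis mf : measurable_fun setT (fun p : T1 * T2 => f p.1 p.2).
Hypothesis fM : forall x y, `|f x y| <= M.

Lemma measurable_section1 x : measurable_fun setT (f x).
Proof.
by apply: (@measurableT_comp _ _ _ _ _ _ _ _ (fun y => (x, y)) mf); exact: measurable_fun_pair.
Qed.

Lemma measurable_section2 y : measurable_fun setT (f ^~ y).
Proof.
by apply: (@measurableT_comp _ _ _ _ _ _ _ _ (fun x => (x, y)) mf); exact: measurable_fun_pair.
Qed.

Let i12 : (P1 \x P2)%E.-integrable setT (fun p => (f p.1 p.2)%:E).
Proof. by apply: (@integrable_bounded _ _ _ (P1 \x P2)%E _ M). Qed.

Lemma measurable_Rintegral2 : measurable_fun setT (fun y => \int[P1]_x f x y).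
Proof. by apply: measurableT_comp => //; exact: measurable_fubini_G i12. Qed.

Lemma Rfubini1_bounded :
  \int[P1]_x \int[P2]_y f x y = \int[(P1 \x P2)%E]_p f p.1 p.2.
Proof.
apply: Rfubini1 => // x; apply: integrable_bounded => //; exact: measurable_section1.
Qed.

Lemma Rfubini2_bounded :
  \int[P2]_y \int[P1]_x f x y = \int[(P1 \x P2)%E]_p f p.1 p.2.
Proof.
apply: Rfubini2 => // x; apply: integrable_bounded => //; exact: measurable_section2.
Qed.

Lemma Rfubini_bounded :
  \int[P1]_x \int[P2]_y f x y = \int[P2]_y \int[P1]_x f x y.
Proof. by rewrite Rfubini1_bounded Rfubini2_bounded. Qed.

End bounded_fubini.

Section mollification.
Context {R : realType} d (T : measurableType d) (P : probability T R).
Notation leb := (@lebesgue_measure R).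
Variables (X : T -> R) (Psi : T -> R -> R) (M : R).
Hypothesis mX : measurable_fun setT X.
Hypothesis mPsi : forall b, measurable_fun setT (Psi ^~ b).
Hypothesis cPsi : forall w, continuous (Psi w).
Hypothesis PsiM : forall w b, `|Psi w b| <= M.

Lemma mollified_cvg :
  \int[P]_w \int[stdN]_y Psi w (X w + n.+1%:R^-1 * y) @[n --> \oo] -->
  \int[P]_w Psi w (X w).
Proof.
have cl (a c : R) : continuous (fun y : R => a + c * y).
  by move=> x; apply: cvgD; [exact: cvg_cst|apply: cvgM; [exact: cvg_cst|exact: cvg_id]].
have m1 : measurable_fun setT (fun p : T * R => Psi p.1 p.2).
  exact: (measurable_fun_caratheodory (F := Psi)).
have mXn n : measurable_fun setT (fun p : T * R => Psi p.1 (X p.1 + n.+1%:R^-1 * p.2)).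
  apply: (@measurableT_comp _ _ _ _ _ _ _ _ (fun p : T * R => (p.1, X p.1 + n.+1%:R^-1 * p.2)) m1).
  apply: measurable_fun_pair => //; apply: measurable_funD.
    exact: measurableT_comp.
  exact: measurable_funM.
have mX0 : measurable_fun setT (fun p : T * R => Psi p.1 (X p.1)).
  apply: (@measurableT_comp _ _ _ _ _ _ _ _ (fun p : T * R => (p.1, X p.1)) m1).
  by apply: measurable_fun_pair => //; exact: measurableT_comp.
under eq_fun do rewrite (Rfubini1_bounded _ _ (mXn _) (fun x y => PsiM x _)).
have -> : \int[P]_w Psi w (X w) = \int[(P \x stdN)%E]_p Psi p.1 (X p.1).
  rewrite -(@Rfubini1_bounded _ _ _ _ _ P stdN (fun w _ => Psi w (X w)) M)//.
  by apply: eq_Rintegral => w _; rewrite Rintegral_prob_cst.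
apply: (@Rintegral_dominated _ _ _ (P \x stdN)%E _ _ (fun=> M)) => //.
- move=> p; apply: (@continuous_cvg _ _ _ _ _ (fun n => X p.1 + n.+1%:R^-1 * p.2) (Psi p.1)); first exact: cPsi.
  rewrite -[X in _ --> X]addr0 -(mul0r p.2); apply: cvgD; first exact: cvg_cst.
  apply: cvgM; last exact: cvg_cst.
  exact: cvg_harmonic.
- exact: (@integrable_bounded _ _ _ (P \x stdN)%E _ `|M|).
Qed.

Variable e : R.
Hypothesis e0 : 0 < e.

Let normal_pdfE' x b : normal_pdf x e b = normal_peak e * normal_fun x e b.
Proof. by rewrite normal_pdfE// gt_eqF. Qed.

Let mpdf b : measurable_fun setT (fun w => normal_pdf (X w) e b).
Proof.
under eq_fun do rewrite normal_pdfE'.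
apply: measurable_funM => //; rewrite /normal_fun; apply: measurableT_comp => //.
apply: measurable_funM => //; apply: measurableT_comp => //; apply: measurable_funX.
exact: measurable_funB.
Qed.

Let mf : measurable_fun setT (fun p : T * R => Psi p.1 p.2 * normal_pdf (X p.1) e p.2).
Proof.
apply: (@measurable_fun_caratheodory _ _ _ (fun w b => Psi w b * normal_pdf (X w) e b)).
  by move=> b; exact: measurable_funM.
move=> w b; apply: continuousM; first exact: cPsi.
by apply: continuous_normal_pdf; rewrite gt_eqF.
Qed.

Let M0 : 0 <= M. Proof. exact: le_trans (PsiM point 0). Qed.

Let f_bd w b : `|Psi w b * normal_pdf (X w) e b| <= M * normal_pdf (X w) e b.
Proof. by rewrite normrM (ger0_norm (normal_pdf_ge0 _ _ _)) ler_wpM2r ?normal_pdf_ge0. Qed.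

(** For fixed [w], [X w + e y] has the normal density with centre [X w] and deviation [e].
    Integrating against it makes the argument [b] of [Psi] a variable separate from [X]. *)
Lemma mollified_density :
  \int[P]_w \int[stdN]_y Psi w (X w + e * y) =
  \int[leb]_b \int[P]_w (Psi w b * normal_pdf (X w) e b).
Proof.
under eq_Rintegral do rewrite -(@Rintegral_normal_scale _ _ _ _ M)//.
have i1 w : leb.-integrable setT (EFin \o (fun b => M * normal_pdf (X w) e b)).
  by apply: integrableZ_fin; exact: integrable_normal_pdf.
have mf1 w : measurable_fun setT (fun b => Psi w b * normal_pdf (X w) e b).
  exact: (measurable_section1 (f := fun w b => Psi w b * normal_pdf (X w) e b)).
have h : (P \x leb)%E.-integrable setT
  (fun p => (Psi p.1 p.2 * normal_pdf (X p.1) e p.2)%:E).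
  apply/integrable12ltyP; first exact/measurable_EFinP.
  apply: (@le_lt_trans _ _ (\int[P]_w M%:E)%E); last first.
    by rewrite integral_cst//= probability_setT mule1 ltry.
  apply: ge0_le_integral => //.
  - by move=> w _; exact: integral_ge0.
  - apply: (@measurable_fun_fubini_tonelli_F _ _ _ _ _ leb (fun p => `|Psi p.1 p.2 * normal_pdf (X p.1) e p.2|%:E)) => //.
    by apply/measurable_EFinP; exact: measurableT_comp.
  - move=> w _; apply: (@le_trans _ _ (\int[leb]_b (M * normal_pdf (X w) e b)%:E)%E).
      apply: ge0_le_integral => //.
      + by apply/measurable_EFinP; apply: measurableT_comp => //; exact: mf1.
      + by have /integrableP[] := i1 w.
      + by move=> b _; rewrite lee_fin f_bd.
    under eq_integral do rewrite EFinM.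
    by rewrite integralZl ?integral_normal_pdf ?mule1//; exact: integrable_normal_pdf.
rewrite Rfubini1//; last first.
  by move=> w; apply: (@integrable_dom R _ (measurableTypeR R) leb _ (fun b => M * normal_pdf (X w) e b)); [exact: mf1|exact: f_bd|exact: i1].
rewrite Rfubini2// => b.
apply: (@integrable_bounded _ _ _ _ _ (M * normal_peak e)); first exact: measurable_funM.
move=> w; rewrite (le_trans (f_bd _ _))// ler_wpM2l// normal_pdf_ub//.
by rewrite gt_eqF.
Qed.

(** The normal density is itself a Gaussian average of cosines, [normal_pdf x e b = normal_peak e *
    E cos ((x - b) N / e)], so [X] is seen only through the transforms compared in
    [transform_eq]. *)
Lemma mollified_transform b :
  \int[P]_w (Psi w b * normal_pdf (X w) e b) =
  normal_peak e * \int[stdN]_x \int[P]_w (Psi w b * cos (x / e * X w + - (x / e * b))).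
Proof.
have me x y : x / e * X y + - (x / e * b) = (X y - b) / e * x.
  by field; rewrite gt_eqF.
pose f x w := Psi w b * cos (x / e * X w + - (x / e * b)).
have fM x w : `|f x w| <= M.
  by rewrite -[leRHS]mulr1 normrM ler_pM// normr_cos_le1.
have mfx : measurable_fun setT (fun p : R * T => f p.1 p.2).
  apply: measurable_funM; first exact: (measurableT_comp (mPsi b)).
  apply: measurableT_comp; first exact: continuous_measurable_fun (@continuous_cos R).
  apply: measurable_funD; first apply: measurable_funM.
  - exact: measurable_funM.
  - exact: measurableT_comp.
  - by apply: measurableT_comp => //; apply: measurable_funM => //; exact: measurable_funM.
rewrite (Rfubini_bounded _ _ mfx fM) -RintegralZl//; last first.
  apply: (@integrable_bounded _ _ _ _ _ M) => [|w].
    exact: measurable_Rintegral2 mfx fM.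
  exact: normr_Rintegral_le (measurable_section2 mfx w) (fM ^~ w).
apply: eq_Rintegral => w _; rewrite /f.
under [in RHS]eq_Rintegral do rewrite me.
rewrite RintegralZl//; last first.
  apply: (@integrable_bounded _ _ _ _ _ 1) => [|x]; last exact: normr_cos_le1.
  apply: measurableT_comp; first exact: continuous_measurable_fun (@continuous_cos R).
  exact: measurable_funM.
rewrite stdN_cos normal_pdfE' /normal_fun mulrCA; congr (_ * (_ * expR _)).
by field; rewrite gt_eqF.
Qed.

End mollification.

(* Uniqueness of Fourier transforms in mollified form: convolving with a small
   normal law expresses both sides through the same family of transforms. *)
Lemma transform_eq {R : realType} d1 d2 (T1 : measurableType d1) (T2 : measurableType d2)
  (P1 : probability T1 R) (P2 : probability T2 R)
  (X1 : T1 -> R) (X2 : T2 -> R) (F1 : T1 -> R -> R) (F2 : T2 -> R -> R) (M : R) :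
  measurable_fun setT X1 -> measurable_fun setT X2 ->
  (forall b, measurable_fun setT (F1 ^~ b)) -> (forall b, measurable_fun setT (F2 ^~ b)) ->
  (forall w, continuous (F1 w)) -> (forall w, continuous (F2 w)) ->
  (forall w b, `|F1 w b| <= M) -> (forall w b, `|F2 w b| <= M) ->
  (forall b u th, \int[P1]_w (F1 w b * cos (u * X1 w + th)) =
                  \int[P2]_w (F2 w b * cos (u * X2 w + th))) ->
  \int[P1]_w F1 w (X1 w) = \int[P2]_w F2 w (X2 w).
Proof.
move=> mX1 mX2 mF1 mF2 cF1 cF2 FM1 FM2 h.
have := @mollified_cvg _ _ _ P2 _ _ _ mX2 mF2 cF2 FM2.
have := @mollified_cvg _ _ _ P1 _ _ _ mX1 mF1 cF1 FM1.
under eq_fun do rewrite (mollified_density P1 mX1 mF1 cF1 FM1)//.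
under [X in _ -> X @ _ --> _ -> _]eq_fun do rewrite (mollified_density P2 mX2 mF2 cF2 FM2)//.
rewrite (_ : (fun n => _) = (fun n : nat => \int[lebesgue_measure]_b \int[P2]_w (F2 w b * normal_pdf (X2 w) n.+1%:R^-1 b))).
  by move=> h1 h2; apply: cvg_unique h1 h2.
apply/funext => n; apply: eq_Rintegral => b _.
rewrite (mollified_transform P1 mX1 mF1 FM1)// (mollified_transform P2 mX2 mF2 FM2)//.
by congr (_ * _); apply: eq_Rintegral => x _; exact: h.
Qed.

(** * Orthonormal Gaussian families *)

Section moments.
Context {R : realType} d (T : measurableType d) (P : probability T R).

Definition all_moments (X : T -> R) := measurable_fun setT X /\
  forall p, P.-integrable setT (EFin \o (fun w => (1 + `|X w|) ^+ p)).

Lemma all_moments_integrable (X : T -> R) f : all_moments X ->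
  measurable_fun setT f -> pgrowth f -> P.-integrable setT (EFin \o (fun w => f (X w))).
Proof.
move=> [mX iX] mf [C [p fC]].
apply: (@integrable_dom _ _ _ _ _ (fun w => C * (1 + `|X w|) ^+ p)) => //.
  exact: measurableT_comp.
exact: integrableZ_fin.
Qed.

Lemma all_moments_comp (X : T -> R) f : all_moments X ->
  measurable_fun setT f -> pgrowth f -> all_moments (fun w => f (X w)).
Proof.
move=> aX mf pf; split=> [|p]; first by apply: measurableT_comp => //; exact: aX.1.
apply: (all_moments_integrable (f := fun x => (1 + `|f x|) ^+ p) aX).
  apply: measurable_funX; apply: measurable_funD => //; exact: measurableT_comp.
apply: pgrowthX; apply: pgrowthD; first exact: pgrowth_cst.
by apply: le_pgrowth pf => x; rewrite normr_id.
Qed.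

Let all_moments_le2 (X Y Z : T -> R) : all_moments X -> all_moments Y -> measurable_fun setT Z ->
  (forall w, 1 + `|Z w| <= (1 + `|X w|) * (1 + `|Y w|)) -> all_moments Z.
Proof.
move=> [mX iX] [mY iY] mZ h; split => // p.
(* The product of two [p]-th powers is bounded by [u v <= u^2 + v^2], hence the doubled
   exponents. *)
apply: (@integrable_dom _ _ _ _ _ (fun w => (1 + `|X w|) ^+ (p + p) + (1 + `|Y w|) ^+ (p + p))).
- by apply: measurable_funX; apply: measurable_funD => //; exact: measurableT_comp.
- move=> w; rewrite ger0_norm ?exprn_ge0 ?addr_ge0//.
  apply: (@le_trans _ _ (((1 + `|X w|) * (1 + `|Y w|)) ^+ p)).
    by rewrite lerXn2r ?nnegrE ?mulr_ge0 ?addr_ge0.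
  rewrite exprMn !exprD; set a := _ ^+ p; set b := _ ^+ p.
  nra.
- exact: integrableD_fin.
Qed.

Lemma all_momentsD (X Y : T -> R) : all_moments X -> all_moments Y ->
  all_moments (fun w => X w + Y w).
Proof.
move=> aX aY; apply: (all_moments_le2 aX aY).
  by apply: measurable_funD; [exact: aX.1|exact: aY.1].
move=> w; have := ler_normD (X w) (Y w).
have := normr_ge0 (X w); have := normr_ge0 (Y w); nra.
Qed.

Lemma all_momentsM (X Y : T -> R) : all_moments X -> all_moments Y ->
  all_moments (fun w => X w * Y w).
Proof.
move=> aX aY; apply: (all_moments_le2 aX aY).
  by apply: measurable_funM; [exact: aX.1|exact: aY.1].
move=> w; rewrite normrM.
have := normr_ge0 (X w); have := normr_ge0 (Y w); nra.
Qed.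

Lemma all_moments_cst c : all_moments (fun=> c).
Proof.
split => // p; apply: (@integrable_bounded _ _ _ _ _ ((1 + `|c|) ^+ p)) => // w.
by rewrite ger0_norm// exprn_ge0 ?addr_ge0.
Qed.

Lemma all_moments_Lfun (X : T -> R) : all_moments X -> P.-integrable setT (EFin \o X).
Proof.
move=> aX; apply: (all_moments_integrable (f := id) aX) => //; exact: pgrowth_id.
Qed.

Lemma law_integral (Q : probability R R) (X : T -> R) (f : R -> \bar R) :
  measurable_fun setT X -> (forall A, measurable A -> P (X @^-1` A) = Q A) ->
  measurable_fun setT f -> (forall x, 0 <= f x)%E ->
  (\int[P]_w f (X w) = \int[Q]_x f x)%E.
Proof.
move=> mX law mf f0.
pose X' : {mfun T >-> R} := mfun_Sub (mem_set mX).
rewrite -(ge0_integral_distribution (P := P) X' mf f0).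
by apply: eq_measure_integral => A mA _; exact: law.
Qed.

Lemma law_Rintegral (Q : probability R R) (X : T -> R) (f : R -> R) :
  measurable_fun setT X -> (forall A, measurable A -> P (X @^-1` A) = Q A) ->
  measurable_fun setT f -> \int[P]_w f (X w) = \int[Q]_x f x.
Proof.
move=> mX law mf.
have mfE : measurable_fun setT (EFin \o f) by exact/measurable_EFinP.
rewrite /Rintegral; congr fine; rewrite [RHS]integralE -!(law_integral mX law).
- rewrite integralE; congr (_ - _)%E; apply: eq_integral => w _.
    by rewrite !funeposE.
  by rewrite !funenegE.
- exact: measurable_funeneg.
- by move=> x; exact: funeneg_ge0.
- exact: measurable_funepos.
- by move=> x; exact: funepos_ge0.
Qed.

Lemma law_all_moments (X : T -> R) : measurable_fun setT X ->
  (forall A, measurable A -> P (X @^-1` A) = stdN A) -> all_moments X.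
Proof.
move=> mX law; split => // p; apply/integrableP; split.
  apply/measurable_EFinP; apply: measurable_funX; apply: measurable_funD => //.
  exact: measurableT_comp.
have mg : measurable_fun setT (fun x : R => (1 + `|x|) ^+ p).
  apply: measurable_funX; apply: measurable_funD => //; exact: measurableT_comp.
rewrite (law_integral mX law (f := fun x => `|((1 + `|x|) ^+ p)%:E|%E))//.
  have /integrableP[] // : stdN.-integrable setT (EFin \o (fun x : R => (1 + `|x|) ^+ p)).
  apply: integrable_pgrowth => //; exists 1, p => x.
  by rewrite mul1r ger0_norm// exprn_ge0 ?addr_ge0.
by apply: measurableT_comp => //; exact/measurable_EFinP.
Qed.

End moments.

Section product_integrable.
Context {R : realType} d1 d2 (T1 : measurableType d1) (T2 : measurableType d2).
Variables (P1 : probability T1 R) (P2 : probability T2 R).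

Lemma integrable_prod (f : T1 -> R) (g : T2 -> R) :
  P1.-integrable setT (EFin \o f) -> P2.-integrable setT (EFin \o g) ->
  (P1 \x P2)%E.-integrable setT (EFin \o (fun p => f p.1 * g p.2)).
Proof.
move=> i1 i2.
have m1 := integrable_measurable i1; have m2 := integrable_measurable i2.
apply/integrable12ltyP => /=.
  by apply/measurable_EFinP; apply: measurable_funM; exact: measurableT_comp.
have fin2 : (\int[P2]_y `|(g y)%:E| < +oo)%E by have /integrableP[] := i2.
have E x : (\int[P2]_y `|(f x * g y)%:E| = `|(f x)%:E| * \int[P2]_y `|(g y)%:E|)%E.
  rewrite -ge0_integralZl//; last first.
    by apply/measurable_EFinP; exact: measurableT_comp.
  by apply: eq_integral => y _; rewrite EFinM abseM.
under eq_integral do rewrite E.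
rewrite ge0_integralZr//; last 2 first.
- by apply/measurable_EFinP; exact: measurableT_comp.
- exact: integral_ge0.
apply: lte_mul_pinfty => //; first exact: integral_ge0.
by rewrite ge0_fin_numE; [have /integrableP[] := i1|exact: integral_ge0].
Qed.

End product_integrable.

(** * Abstract Gaussian families with covariance form [B] *)

Section gaussian_family.
Context {R : realType} d (T : measurableType d) (P : probability T R).
Variables (U : lmodType R) (L : U -> T -> R) (B : U -> U -> R).
Hypothesis L_lin : forall a u v w, L (a *: u + v) w = a * L u w + L v w.
Hypothesis B_sym : forall u v, B u v = B v u.
Hypothesis B_lin : forall a u v c, B (a *: u + v) c = a * B u c + B v c.
Hypothesis mL : forall u, measurable_fun setT (L u).
Hypothesis L_char : forall c th,
  \int[P]_w cos (L c w + th) = expR (- B c c / 2) * cos th.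

Definition sumsq (s : seq U) (w : T) := \sum_(e <- s) (L e w) ^+ 2.

Definition orthonormal_seq (s : seq U) :=
  uniq s /\ forall e e', e \in s -> e' \in s -> B e e' = (e == e')%:R.

Lemma measurable_sumsq s : measurable_fun setT (sumsq s).
Proof. by apply: measurable_sum => e; apply: measurable_funX. Qed.

Lemma orthonormal_perm s s' : perm_eq s s' -> orthonormal_seq s -> orthonormal_seq s'.
Proof.
move=> ss' [us os]; split; first by rewrite -(perm_uniq ss').
by move=> e e'; rewrite -!(perm_mem ss'); exact: os.
Qed.

Lemma sumsq_perm s s' : perm_eq s s' -> sumsq s = sumsq s'.
Proof. by move=> ss'; apply/funext => w; exact: perm_big. Qed.

Lemma orthonormal_cons e s : orthonormal_seq (e :: s) ->
  [/\ orthonormal_seq s, B e e = 1 & forall e', e' \in s -> B e' e = 0].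
Proof.
move=> [/= /andP[es us] os]; split.
- by split => // x y xs ys; apply: os; rewrite inE ?xs ?ys orbT.
- by rewrite os ?inE ?eqxx.
- move=> e' e's; rewrite os ?inE ?eqxx ?e's ?orbT//.
  by case: eqP => // e'e; rewrite -e'e e's in es.
Qed.

Lemma cos_mul_sum (a b : R) : cos a * cos b = (cos (a + b) + cos (a - b)) / 2.
Proof. by rewrite cosB cosD; field. Qed.

(** Induction on [s]. Applied with [X = L e], [transform_eq] freezes the new square at a constant
    [b^2], at the price of a factor [cos (u L e + et)]. The product of the two cosines is a sum of
    cosines of [L (c + u e)] and [L (c - u e)]; both vectors are orthogonal to the rest of [s], so
    the induction hypothesis applies with [h (b^2 + .)] in place of [h]. *)
Lemma cos_indep_sumsq s : orthonormal_seq s ->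
  forall c, (forall e, e \in s -> B e c = 0) ->
  forall h M th, continuous h -> (forall x, `|h x| <= M) ->
  \int[P]_w (cos (L c w + th) * h (sumsq s w)) =
  expR (- B c c / 2) * cos th * \int[P]_w h (sumsq s w).
Proof.
elim: s => [|e s IH] os c oc h M th ch hM.
  under eq_Rintegral do rewrite /sumsq big_nil mulrC.
  rewrite RintegralZl//; last first.
    apply: (@integrable_bounded _ _ _ _ _ 1) => [|x]; last exact: normr_cos_le1.
    apply: measurableT_comp; first exact: continuous_measurable_fun (@continuous_cos R).
    exact: measurable_funD.
  rewrite L_char mulrC; congr (_ * _); under eq_Rintegral do rewrite /sumsq big_nil.
  by rewrite Rintegral_prob_cst.
have [os' ee oe] := orthonormal_cons os.
have mcos v : measurable_fun setT (fun w => cos (L v w + th)).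
  apply: measurableT_comp; first exact: continuous_measurable_fun (@continuous_cos R).
  exact: measurable_funD.
have cb y : continuous (fun b : R => h (b ^+ 2 + y)).
  move=> b; apply: (@continuous_comp _ _ _ (fun b : R => b ^+ 2 + y) h); last exact: ch.
  by apply: cvgD; [exact: exprn_continuous|exact: cvg_cst].
have chb b : continuous (fun x : R => h (b ^+ 2 + x)).
  move=> x; apply: (@continuous_comp _ _ _ (fun x : R => b ^+ 2 + x) h); last exact: ch.
  by apply: cvgD; [exact: cvg_cst|exact: cvg_id].
have mhb b : measurable_fun setT (fun w => h (b ^+ 2 + sumsq s w)).
  apply: (measurableT_comp (f := fun x => h (b ^+ 2 + x))); last exact: measurable_sumsq.
  exact: continuous_measurable_fun.
have ih0 b : P.-integrable setT (EFin \o (fun w => h (b ^+ 2 + sumsq s w))).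
  exact: integrable_bounded (mhb b) (fun w => hM _).
set k := expR (- B c c / 2) * cos th.
have -> : k * \int[P]_w h (sumsq (e :: s) w) = \int[P]_w (k * h (sumsq (e :: s) w)).
  rewrite RintegralZl//; apply: (@integrable_bounded _ _ _ _ _ M) => //.
  by apply: measurableT_comp; [exact: continuous_measurable_fun|exact: measurable_sumsq].
under eq_Rintegral do rewrite /sumsq big_cons -/(sumsq s _).
under [in RHS]eq_Rintegral do rewrite /sumsq big_cons -/(sumsq s _).
apply: (@transform_eq R _ _ T T P P (L e) (L e)
   (fun w b => cos (L c w + th) * h (b ^+ 2 + sumsq s w))
   (fun w b => k * h (b ^+ 2 + sumsq s w)) (Num.max 1 `|k| * M)) => //.
- by move=> b; exact: measurable_funM.
- by move=> b; exact: measurable_funM.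
- by move=> w b /=; apply: cvgM; [exact: cvg_cst|exact: cb].
- by move=> w b /=; apply: cvgM; [exact: cvg_cst|exact: cb].
- by move=> w b; rewrite normrM ler_pM// le_max normr_cos_le1.
- by move=> w b; rewrite normrM ler_pM// le_max lexx orbT.
move=> b u et.
have hM' x : `|h (b ^+ 2 + x)| <= M by exact: hM.
have icos v et' : P.-integrable setT (EFin \o (fun w => cos (L v w + et') * h (b ^+ 2 + sumsq s w))).
  apply: (@integrable_bounded _ _ _ _ _ M) => [|w].
    apply: measurable_funM => //.
    apply: measurableT_comp; first exact: continuous_measurable_fun (@continuous_cos R).
    exact: measurable_funD.
  by rewrite normrM -[leRHS]mul1r ler_pM// normr_cos_le1.
have Bue v a : B (a *: e + v) (a *: e + v) = a ^+ 2 + a * B e v + a * B v e + B v v.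
  by rewrite B_lin (B_sym e) (B_sym v) !B_lin ee (B_sym v); ring.
have oue a v : (forall e', e' \in s -> B e' v = 0) -> forall e', e' \in s -> B e' (a *: e + v) = 0.
  by move=> ov e' e's; rewrite B_sym B_lin B_sym (oe _ e's) B_sym (ov _ e's) mulr0 addr0.
have os0 e' : e' \in s -> B e' c = 0 by move=> e's; apply: oc; rewrite inE e's orbT.
have ec : B e c = 0 by apply: oc; rewrite inE eqxx.
have ce : B c e = 0 by rewrite B_sym.
have ih a et' := IH os' (a *: e + c) (oue a c os0) _ _ et' (chb b) hM'.
have L0 w : L 0 w = 0.
  have := L_lin 1 0 0 w; rewrite scaler0 addr0 mul1r => /eqP.
  by rewrite eq_sym -subr_eq0 addrK => /eqP.
have B0 v : B 0 v = 0.
  have := B_lin 1 0 0 v; rewrite scaler0 addr0 mul1r => /eqP.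
  by rewrite eq_sym -subr_eq0 addrK => /eqP.
(* The transform of the right-hand side is the same computation with [c = 0]. *)
have o0 e' : e' \in s -> B e' 0 = 0 by move=> _; rewrite B_sym B0.
have ih' a et' := IH os' (a *: e + 0) (oue a 0 o0) _ _ et' (chb b) hM'.
transitivity (2^-1 * (\int[P]_w (cos (L (u *: e + c) w + (th + et)) * h (b ^+ 2 + sumsq s w)) +
   \int[P]_w (cos (L ((- u) *: e + c) w + (th - et)) * h (b ^+ 2 + sumsq s w)))).
  rewrite -RintegralD// -RintegralZl//; last exact: integrableD_fin.
  apply: eq_Rintegral => w _; rewrite mulrAC cos_mul_sum !L_lin.
  rewrite (_ : u * L e w + L c w + (th + et) = L c w + th + (u * L e w + et)); last by ring.
  rewrite (_ : - u * L e w + L c w + (th - et) = L c w + th - (u * L e w + et)); last by ring.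
  by field.
transitivity (k * \int[P]_w (cos (L (u *: e + 0) w + et) * h (b ^+ 2 + sumsq s w))); last first.
  rewrite -RintegralZl//; apply: eq_Rintegral => w _.
  by rewrite L_lin L0 addr0 -mulrA [_ * cos _]mulrC.
(* As [e] and [c] are orthogonal, both variances equal [u^2 + B c c] and the exponential factors;
   the sine terms of [cos (th + et)] and [cos (th - et)] cancel. *)
rewrite !ih ih' !Bue ec ce (B_sym e 0) !B0 !mulr0 !addr0 sqrrN /k cosD cosB.
rewrite (_ : - (u ^+ 2 + B c c) / 2 = - B c c / 2 + - u ^+ 2 / 2); last by field.
by rewrite expRD; field.
Qed.


Hypothesis L_law : forall e, B e e = 1 ->
  forall A : set R, measurable A -> P (L e @^-1` A) = stdN A.

Lemma sumsq_all_moments s : orthonormal_seq s -> all_moments P (sumsq s).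
Proof.
elim: s => [|e s IH] os.
  by rewrite /sumsq; under eq_fun do rewrite big_nil; exact: all_moments_cst.
have [os' ee _] := orthonormal_cons os.
rewrite /sumsq; under eq_fun do rewrite big_cons expr2.
have aL := law_all_moments (mL e) (L_law ee).
by apply: all_momentsD (IH os'); exact: all_momentsM.
Qed.

Section joint.
Variables (e : U) (s : seq U).
Hypothesis es : orthonormal_seq (e :: s).
Variable F : R -> R -> R.
Hypothesis cF1 : forall x, continuous (F ^~ x).
Hypothesis cF2 : forall b, continuous (F b).

Let mF2 b : measurable_fun setT (fun w => F b (sumsq s w)).
Proof.
apply: (measurableT_comp (f := F b)); last exact: measurable_sumsq.
exact: continuous_measurable_fun.
Qed.

Let mFP : measurable_fun setT (fun p : T * R => F p.2 (sumsq s p.1)).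
Proof. exact: (measurable_fun_caratheodory (F := fun w b => F b (sumsq s w))). Qed.

(** Independence of [L e] and [sumsq s], expressed as a replacement: [L e] may be exchanged for a
    fresh standard normal variable on a product space. By [cos_indep_sumsq] the two sides have the
    same cosine transforms once the first argument of [F] is frozen. *)
Lemma joint_bounded M : (forall b x, `|F b x| <= M) ->
  \int[P]_w F (L e w) (sumsq s w) = \int[(P \x stdN)%E]_p F p.2 (sumsq s p.1).
Proof.
move=> FM; have [os ee oe] := orthonormal_cons es.
have oe' e' : e' \in s -> B e' e = 0 by exact: oe.
apply: (@transform_eq R _ _ T _ P (P \x stdN)%E (L e) snd
  (fun w b => F b (sumsq s w)) (fun p b => F b (sumsq s p.1)) M) => //.
  by move=> b; apply: (measurableT_comp (mF2 b)).
move=> b u th.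
have mc : measurable_fun setT (fun y : R => cos (u * y + th)) by exact: measurable_cos_affine.
rewrite -(@Rfubini1_bounded R _ _ T _ P stdN
   (fun w y => F b (sumsq s w) * cos (u * y + th)) M).
- under [in RHS]eq_Rintegral.
    move=> w _; rewrite RintegralZl//; last first.
      by apply: (@integrable_bounded _ _ _ _ _ 1) => // x; exact: normr_cos_le1.
    rewrite stdN_char.
    over.
  have iFs : P.-integrable setT (EFin \o (fun w => F b (sumsq s w))).
    exact: integrable_bounded (mF2 b) (fun w => FM b _).
  rewrite RintegralZr//.
  have := @cos_indep_sumsq s os (u *: e + 0) _ (F b) M th (@cF2 b) (FM b).
  have L0 w : L 0 w = 0.
    have := L_lin 1 0 0 w; rewrite scaler0 addr0 mul1r => /eqP.
    by rewrite eq_sym -subr_eq0 addrK => /eqP.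
  have B0 v : B 0 v = 0.
    have := B_lin 1 0 0 v; rewrite scaler0 addr0 mul1r => /eqP.
    by rewrite eq_sym -subr_eq0 addrK => /eqP.
  have -> : B (u *: e + 0) (u *: e + 0) = u ^+ 2.
    by rewrite B_lin B0 (B_sym e) B_lin B0 ee; ring.
  rewrite [in RHS]mulrC => <-.
    by apply: eq_Rintegral => w _; rewrite L_lin L0 addr0 mulrC.
  by move=> e' e's; rewrite B_sym B_lin B0 addr0 B_sym oe' ?mulr0.
- by apply: measurable_funM; [exact: (measurableT_comp (mF2 b))|exact: (measurableT_comp mc)].
- by move=> w y; rewrite normrM -[leRHS]mulr1 ler_pM// normr_cos_le1.
Qed.

End joint.

Section joint_unbounded.
Variables (e : U) (s : seq U).
Hypothesis es : orthonormal_seq (e :: s).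
Variable F : R -> R -> R.
Hypothesis cF1 : forall x, continuous (F ^~ x).
Hypothesis cF2 : forall b, continuous (F b).

(** The truncation [F / (1 + |F| / N)] is continuous, bounded by [N], dominated by [|F|] and tends
    to [F], so [joint_bounded] passes to the limit on both sides. *)
Lemma joint_growth C p : 0 <= C ->
  (forall b x, `|F b x| <= C * ((1 + `|b|) * (1 + `|x|)) ^+ p) ->
  P.-integrable setT (EFin \o (fun w => F (L e w) (sumsq s w))) /\
  \int[P]_w F (L e w) (sumsq s w) = \int[P]_w \int[stdN]_b F b (sumsq s w).
Proof.
move=> C0 FC; have [os ee _] := orthonormal_cons es.
have aL := law_all_moments (mL e) (L_law ee).
have aS := sumsq_all_moments os.
have mS := measurable_sumsq s.
have mFP : measurable_fun setT (fun p : T * R => F p.2 (sumsq s p.1)).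
  apply: (measurable_fun_caratheodory (F := fun w b => F b (sumsq s w))) => // b.
  by apply: (measurableT_comp (f := F b)) => //; exact: continuous_measurable_fun.
pose N (n : nat) : R := n.+1%:R.
pose Fn n b x := F b x * (1 + `|F b x| / N n)^-1.
have D0 n (y : R) : 0 < 1 + `|y| / N n by rewrite ltr_pwDl// divr_ge0// ltW.
have Fn_le n b x : `|Fn n b x| <= `|F b x|.
  rewrite normrM normfV (gtr0_norm (D0 _ _)) ler_piMr// invf_le1//.
  by rewrite lerDl divr_ge0// ltW.
have Fn_N n b x : `|Fn n b x| <= N n.
  rewrite normrM normfV (gtr0_norm (D0 _ _)) ler_pdivrMr// mulrDr mulr1 mulrCA.
  by rewrite divff ?gt_eqF// mulr1 lerDr ltW.
have cn n : continuous (fun z : R => z * (1 + `|z| / N n)^-1).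
  move=> z; apply: cvgM; first exact: cvg_id.
  apply: cvgV; first by rewrite gt_eqF.
  apply: cvgD; first exact: cvg_cst.
  apply: cvgM; last exact: cvg_cst.
  exact: norm_continuous.
have cFn1 n x : continuous (fun b => Fn n b x).
  by move=> b; apply: (@continuous_comp _ _ _ (F ^~ x) (fun z => z * (1 + `|z| / N n)^-1)); [exact: cF1|exact: cn].
have cFn2 n b : continuous (Fn n b).
  by move=> x; apply: (@continuous_comp _ _ _ (F b) (fun z => z * (1 + `|z| / N n)^-1)); [exact: cF2|exact: cn].
have Fn_cvg b x : Fn n b x @[n --> \oo] --> F b x.
  suff : Fn n b x @[n --> \oo] --> F b x * (1 + `|F b x| * 0)^-1.
    by rewrite mulr0 addr0 invr1 mulr1.
  apply: cvgM; first exact: cvg_cst.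
  apply: cvgV; first by rewrite mulr0 addr0 oner_neq0.
  apply: cvgD; first exact: cvg_cst.
  by apply: cvgM; [exact: cvg_cst|exact: cvg_harmonic].
have mFn n : measurable_fun setT (fun p : T * R => Fn n p.2 (sumsq s p.1)).
  apply: (measurable_fun_caratheodory (F := fun w b => Fn n b (sumsq s w))) => // b.
  by apply: (measurableT_comp (f := Fn n b)) => //; exact: continuous_measurable_fun.
have mFL n : measurable_fun setT (fun w => Fn n (L e w) (sumsq s w)).
  apply: (@measurableT_comp _ _ _ _ _ _ _ _ (fun w => (w, L e w)) (mFn n)).
  exact: measurable_fun_pair.
have mFL' : measurable_fun setT (fun w => F (L e w) (sumsq s w)).
  apply: (@measurableT_comp _ _ _ _ _ _ _ _ (fun w => (w, L e w)) mFP).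
  exact: measurable_fun_pair.
have iP : P.-integrable setT (EFin \o (fun w => C * ((1 + `|L e w|) * (1 + `|sumsq s w|)) ^+ p)).
  apply: integrableZ_fin.
  have aLS := all_momentsM (all_moments_comp aL (f := fun x => (1 + `|x|) ^+ p) _ _)
     (all_moments_comp aS (f := fun x => (1 + `|x|) ^+ p) _ _).
  under [X in EFin \o X]eq_fun do rewrite exprMn.
  have mg : measurable_fun setT (fun x : R => (1 + `|x|) ^+ p).
    apply: measurable_funX; apply: measurable_funD => //; exact: measurableT_comp.
  have pg : pgrowth (fun x : R => (1 + `|x|) ^+ p).
    by exists 1, p => x; rewrite mul1r ger0_norm// exprn_ge0 ?addr_ge0.
  by apply: all_moments_Lfun; exact: aLS.
have iF : P.-integrable setT (EFin \o (fun w => F (L e w) (sumsq s w))).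
  by apply: integrable_dom iP.
split => //.
have iPN : (P \x stdN)%E.-integrable setT
   (EFin \o (fun q => C * (1 + `|sumsq s q.1|) ^+ p * (1 + `|q.2|) ^+ p)).
  apply: (@integrable_prod R _ _ T _ P stdN (fun w => C * (1 + `|sumsq s w|) ^+ p) (fun y : R => (1 + `|y|) ^+ p)).
    by apply: integrableZ_fin; exact: aS.2.
  apply: integrable_pgrowth.
    apply: measurable_funX; apply: measurable_funD => //; exact: measurableT_comp.
  by exists 1, p => x; rewrite mul1r ger0_norm// exprn_ge0 ?addr_ge0.
have FC' b x : `|F b x| <= C * (1 + `|x|) ^+ p * (1 + `|b|) ^+ p.
  by rewrite (le_trans (FC b x))// exprMn [_ ^+ p * _]mulrC mulrA.
have iFp : (P \x stdN)%E.-integrable setT (EFin \o (fun q => F q.2 (sumsq s q.1))).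
  exact: integrable_dom iPN.
rewrite (@Rfubini1 R _ _ T _ P stdN (fun w b => F b (sumsq s w))) //; last first.
  move=> w; apply: integrable_pgrowth; first exact: continuous_measurable_fun.
  by exists (C * (1 + `|sumsq s w|) ^+ p), p => b.
have h1 : \int[P]_w Fn n (L e w) (sumsq s w) @[n --> \oo] --> \int[P]_w F (L e w) (sumsq s w).
  apply: (Rintegral_dominated mFL _ iP) => // n w.
  exact: le_trans (Fn_le _ _ _) (FC _ _).
have h2 : \int[(P \x stdN)%E]_q Fn n q.2 (sumsq s q.1) @[n --> \oo] -->
    \int[(P \x stdN)%E]_q F q.2 (sumsq s q.1).
  apply: (Rintegral_dominated mFn _ iPN) => [q|n q]; first exact: Fn_cvg.
  exact: le_trans (Fn_le _ _ _) (FC' _ _).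
have E n : \int[P]_w Fn n (L e w) (sumsq s w) = \int[(P \x stdN)%E]_q Fn n q.2 (sumsq s q.1).
  exact: (joint_bounded es (cFn1 n) (cFn2 n) (Fn_N n)).
rewrite (funext E) in h1.
exact: cvg_unique h1 h2.
Qed.

End joint_unbounded.

(** With the other squares frozen at [S], this is [stdN_ibp] for [b |-> b * g (b^2 + S)], whose
    derivative is the integrand on the right. *)
Lemma stein_coordinate e s (g g' : R -> R) : orthonormal_seq (e :: s) ->
  (forall x : R, is_derive x 1 g (g' x)) -> continuous g' ->
  pgrowth g -> pgrowth g' ->
  \int[P]_w ((L e w) ^+ 2 * g (sumsq (e :: s) w)) =
  \int[P]_w (g (sumsq (e :: s) w) + 2 * (L e w) ^+ 2 * g' (sumsq (e :: s) w)).
Proof.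
move=> es dg cg' pg pg'.
have cg := is_derive1_continuous dg.
have [C [p [C0 gC]]] := pgrowth_ge0 pg.
have [C' [p' [C'0 gC']]] := pgrowth_ge0 pg'.
have cq1 y : continuous (fun b : R => b ^+ 2 + y).
  by move=> b; apply: cvgD; [exact: exprn_continuous|exact: cvg_cst].
have cq2 b : continuous (fun x : R => b ^+ 2 + x).
  by move=> x; apply: cvgD; [exact: cvg_cst|exact: cvg_id].
have cgq1 (f : R -> R) y : continuous f -> continuous (fun b : R => f (b ^+ 2 + y)).
  by move=> cf b; apply: (@continuous_comp _ _ _ (fun b : R => b ^+ 2 + y) f); [exact: cq1|exact: cf].
have cgq2 (f : R -> R) b : continuous f -> continuous (fun x : R => f (b ^+ 2 + x)).
  by move=> cf x; apply: (@continuous_comp _ _ _ (fun x : R => b ^+ 2 + x) f); [exact: cq2|exact: cf].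
(* The square of this product dominates both [b^2] and [1 + |b^2 + x|], which brings every growth
   bound into the form required by [joint_growth]. *)
pose z (b x : R) := (1 + `|b|) * (1 + `|x|).
have z1 b x : 1 <= z b x by rewrite /z mulr_ege1// ge1_1Dnormr.
have z0 b x : 0 <= z b x by exact: le_trans (z1 b x).
have zb b x : b ^+ 2 <= z b x ^+ 2.
  rewrite -(real_normK (num_real b)) lerXn2r ?nnegrE//.
  rewrite /z; have := normr_ge0 b; have := normr_ge0 x; nra.
have zbx b x : 1 + `|b ^+ 2 + x| <= z b x ^+ 2.
  have := ler_normD (b ^+ 2) x; rewrite normrX /z.
  have := normr_ge0 b; have := normr_ge0 x; nra.
have gz b x : `|g (b ^+ 2 + x)| <= C * z b x ^+ (2 * p).
  rewrite (le_trans (gC _))// ler_wpM2l// exprM lerXn2r ?nnegrE ?addr_ge0 ?exprn_ge0//.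
have gz' b x : `|g' (b ^+ 2 + x)| <= C' * z b x ^+ (2 * p').
  rewrite (le_trans (gC' _))// ler_wpM2l// exprM lerXn2r ?nnegrE ?addr_ge0 ?exprn_ge0//.
pose F1 (b x : R) := b ^+ 2 * g (b ^+ 2 + x).
pose F2 (b x : R) := g (b ^+ 2 + x) + 2 * b ^+ 2 * g' (b ^+ 2 + x).
have cF11 x : continuous (F1 ^~ x).
  by move=> b; apply: cvgM; [exact: exprn_continuous|exact: cgq1].
have cF12 b : continuous (F1 b).
  by move=> x; apply: cvgM; [exact: cvg_cst|exact: cgq2].
have cF21 x : continuous (F2 ^~ x).
  move=> b; apply: cvgD; first exact: cgq1.
  apply: cvgM; last exact: cgq1.
  by apply: cvgM; [exact: cvg_cst|exact: exprn_continuous].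
have cF22 b : continuous (F2 b).
  move=> x; apply: cvgD; first exact: cgq2.
  by apply: cvgM; [exact: cvg_cst|exact: cgq2].
have F1C b x : `|F1 b x| <= C * z b x ^+ (2 + 2 * p).
  rewrite normrM exprD mulrCA; apply: ler_pM => //.
  by rewrite ger0_norm ?sqr_ge0.
have F2C b x : `|F2 b x| <= (C + 2 * C') * z b x ^+ (2 + (2 * p + 2 * p')).
  apply: le_trans (ler_normD _ _) _; rewrite [leRHS]mulrDl; apply: lerD.
    by rewrite (le_trans (gz _ _))// ler_wpM2l// ler_weXn2l// addnC -addnA leq_addr.
  rewrite normrM exprD mulrACA; apply: ler_pM => //.
    by rewrite normrM !ger0_norm ?sqr_ge0 ?ler_wpM2l.
  by rewrite (le_trans (gz' _ _))// ler_wpM2l// ler_weXn2l// leq_addl.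
have C20 : 0 <= C + 2 * C' by rewrite addr_ge0// mulr_ge0.
have SE w : sumsq (e :: s) w = L e w ^+ 2 + sumsq s w by rewrite /sumsq big_cons.
under eq_Rintegral do rewrite SE.
under [RHS]eq_Rintegral do rewrite SE.
have [_ E1] := joint_growth es cF11 cF12 C0 F1C.
have [_ E2] := joint_growth es cF21 cF22 C20 F2C.
rewrite [LHS]E1 [RHS]E2; apply: eq_Rintegral => w _.
set S := sumsq s w.
transitivity (\int[stdN]_b (b * (fun b : R => b * g (b ^+ 2 + S)) b)).
  by apply: eq_Rintegral => b _; rewrite mulrA -expr2.
have pq : pgrowth (fun b : R => b ^+ 2 + S).
  by apply: pgrowthD (pgrowth_cst _); exact: (pgrowthX 2 pgrowth_id).
apply: stdN_ibp.
- move=> b; have dgb := dg (b ^+ 2 + S).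
  by apply: is_derive_eq; rewrite /GRing.scale/= /F2; ring.
- exact: cF21.
- by apply: pgrowthM; [exact: pgrowth_id|exact: (pgrowth_comp pg)].
- apply: pgrowthD; first exact: (pgrowth_comp pg).
  apply: pgrowthM; last exact: (pgrowth_comp pg').
  by apply: pgrowthM (pgrowth_cst _) _; exact: (pgrowthX 2 pgrowth_id).
Qed.

(** Each vector of [s] can be moved to the front, where [stein_coordinate] contributes one copy of
    [E g] and the share of its own square in [2 E (W g' W)]. *)
Lemma stein_sumsq s (g g' : R -> R) : orthonormal_seq s ->
  (forall x : R, is_derive x 1 g (g' x)) -> continuous g' ->
  pgrowth g -> pgrowth g' ->
  \int[P]_w (sumsq s w * g (sumsq s w)) =
  (size s)%:R * \int[P]_w g (sumsq s w) + 2 * \int[P]_w (sumsq s w * g' (sumsq s w)).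
Proof.
move=> os dg cg' pg pg'.
have mg : measurable_fun setT g.
  exact: continuous_measurable_fun (is_derive1_continuous dg).
have mg' : measurable_fun setT g' by exact: continuous_measurable_fun.
have aS := sumsq_all_moments os.
have ag := all_moments_comp aS mg pg.
have ag' := all_moments_comp aS mg' pg'.
have aL e : e \in s -> all_moments P (L e).
  move=> es; apply: law_all_moments => //; apply: L_law.
  by rewrite os.2// eqxx.
(* Cut off outside [s], because the law of [L e], and with it integrability, is known for members of
   [s] while [Rintegral_sum] asks for it at every index. *)
pose Z (h : R -> R) e w := if e \in s then (L e w) ^+ 2 * h (sumsq s w) else 0.
have iZ h e : all_moments P (fun w => h (sumsq s w)) -> P.-integrable setT (EFin \o Z h e).
  move=> ah; rewrite /Z; have [es|es] := boolP (e \in s); last exact: integrable0.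
  apply: all_moments_Lfun; apply: all_momentsM => //.
  by under eq_fun do rewrite expr2; apply: all_momentsM; exact: aL.
have SZ h w : sumsq s w * h (sumsq s w) = \sum_(e <- s) Z h e w.
  rewrite {1}/sumsq mulr_suml big_seq [RHS]big_seq.
  by apply: eq_bigr => e es; rewrite /Z es.
under eq_Rintegral do rewrite SZ.
under [in X in _ + X]eq_Rintegral do rewrite SZ.
rewrite !Rintegral_sum; [|by move=> e _; exact: iZ..].
rewrite mulr_sumr -sum1_size natr_sum mulr_suml -big_split/=.
rewrite big_seq [RHS]big_seq; apply: eq_bigr => e es.
have pe : perm_eq s (e :: rem e s) by exact: perm_to_rem.
have := stein_coordinate (orthonormal_perm pe os) dg cg' pg pg'.
rewrite -(sumsq_perm pe) /Z es => ->.
have iz' := iZ _ e ag'; rewrite /Z es in iz'.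
rewrite mul1r -RintegralZl// -RintegralD//; last 2 first.
- exact: all_moments_Lfun.
- exact: integrableZ_fin.
by apply: eq_Rintegral => w _; rewrite mulrA.
Qed.

End gaussian_family.

(** * Stein identities for non-smooth functions *)

Section ramp.
Context {R : realType}.

Definition pos_part (x : R) : R := Num.max x 0.

Lemma pos_part_ge0 x : 0 <= pos_part x.
Proof. by rewrite /pos_part le_max lexx orbT. Qed.

Lemma continuous_pos_part : continuous pos_part.
Proof.
rewrite (_ : pos_part = fun x => (x + `|x|) / 2); last first.
  by apply/funext => x; rewrite /pos_part; case: (ltrgt0P x) => h; lra.
move=> x; apply: cvgM; last exact: cvg_cst.
by apply: cvgD; [exact: cvg_id|exact: norm_continuous].
Qed.

Lemma is_derive_pos_part_sq (x : R) :
  is_derive x 1 (fun y => pos_part y ^+ 2) (2 * pos_part x).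
Proof.
have [x0|x0|->] := ltrgt0P x.
- have e : {near x, (fun y : R => y ^+ 2) =1 (fun y => pos_part y ^+ 2)}.
    near=> y; rewrite /pos_part max_l// ltW//; near: y; exact: lt_nbhsr.
  rewrite /pos_part max_l ?ltW//.
  apply: (near_eq_is_derive e).
  by apply: is_derive_eq; rewrite /GRing.scale/=; ring.
- have e : {near x, (fun y : R => 0 : R) =1 (fun y => pos_part y ^+ 2)}.
    near=> y; rewrite /pos_part max_r ?expr0n// ltW//; near: y; exact: lt_nbhsl.
  rewrite /pos_part max_r ?ltW// mulr0.
  exact: (near_eq_is_derive e).
(* At 0 the difference quotient of the squared positive part is the positive part itself, which is
   continuous and vanishes there. *)
- rewrite /pos_part maxxx mulr0; apply/is_derive1_caratheodory.
  exists pos_part; split; last by rewrite /pos_part maxxx.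
  + move=> z; rewrite maxxx expr0n/= !subr0 /pos_part.
    by case: (ltrgt0P z) => h; rewrite ?mul0r ?expr0n.
  + exact: continuous_pos_part.
Unshelve. all: by end_near. Qed.

Variable z : R.

(* C^1 approximations of the ramp [x |-> max (x - z) 0] and of its derivative. *)
Definition ramp (n : nat) (x : R) : R :=
  (pos_part (x - z) ^+ 2 - pos_part (x - z - n.+1%:R^-1) ^+ 2) / 2 * n.+1%:R.
Definition dramp (n : nat) (x : R) : R :=
  (pos_part (x - z) - pos_part (x - z - n.+1%:R^-1)) * n.+1%:R.

Lemma is_derive_ramp n (x : R) : is_derive x 1 (ramp n) (dramp n x).
Proof.
have d1 := is_derive_pos_part_sq (x - z).
have d2 := is_derive_pos_part_sq (x - z - n.+1%:R^-1).
rewrite /ramp /dramp.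
have da a : is_derive x 1 (fun x : R => x - a) 1.
  by apply: is_derive_eq; rewrite ?oppr0 ?addr0.
have d2' : is_derive (x - (z + n.+1%:R^-1)) 1 (fun y => pos_part y ^+ 2) (2 * pos_part (x - z - n.+1%:R^-1)).
  by rewrite opprD addrA.
rewrite (_ : (fun x => _) = (fun x =>
   (((fun y => pos_part y ^+ 2) \o (fun x => x - z)) x -
    ((fun y => pos_part y ^+ 2) \o (fun x => x - (z + n.+1%:R^-1))) x) / 2 * n.+1%:R)).
  by apply: is_derive_eq; rewrite /GRing.scale/=; field.
by apply/funext => y /=; rewrite opprD addrA.
Qed.

Lemma continuous_dramp n : continuous (dramp n).
Proof.
move=> x; apply: cvgM; last exact: cvg_cst.
have c a : continuous (fun x : R => pos_part (x - a)).
  move=> y; apply: (@continuous_comp _ _ _ (fun x : R => x - a) pos_part); last exact: continuous_pos_part.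
  by apply: cvgB; [exact: cvg_id|exact: cvg_cst].
apply: cvgB; first exact: c.
have := c (z + n.+1%:R^-1) x; rewrite opprD.
by under eq_fun do rewrite addrA.
Qed.

Let N0 (n : nat) : 0 < n.+1%:R :> R. Proof. by []. Qed.
Lemma ramp_le n x : x <= z -> ramp n x = 0 /\ dramp n x = 0.
Proof.
move=> xz; have i0 : 0 < n.+1%:R^-1 :> R by rewrite invr_gt0.
have p1 : pos_part (x - z) = 0 by rewrite /pos_part max_r// subr_le0.
have p2 : pos_part (x - z - n.+1%:R^-1) = 0.
  by rewrite /pos_part max_r//; move: i0; move: (n.+1%:R^-1) => e i0; lra.
by rewrite /ramp /dramp p1 p2 !subrr !mul0r.
Qed.

Lemma ramp_ge n x : z + n.+1%:R^-1 <= x ->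
  ramp n x = x - z - n.+1%:R^-1 / 2 /\ dramp n x = 1.
Proof.
move=> xz; have i0 : 0 < n.+1%:R^-1 :> R by rewrite invr_gt0.
have p1 : pos_part (x - z) = x - z.
  by rewrite /pos_part max_l//; move: i0 xz; move: (n.+1%:R^-1) => e *; lra.
have p2 : pos_part (x - z - n.+1%:R^-1) = x - z - n.+1%:R^-1.
  by rewrite /pos_part max_l//; move: i0 xz; move: (n.+1%:R^-1) => e *; lra.
by rewrite /ramp /dramp p1 p2; split; field.
Qed.

(** The third bound keeps [x - ramp z n x] below [z + 1]. This is why the gluing below controls the
    growth of a left branch up to [z + 1], slightly beyond the point where it is used. *)
Lemma ramp_bounds n x :
  [/\ 0 <= ramp n x, ramp n x <= pos_part (x - z), x - ramp n x <= z + 1 & 0 <= dramp n x <= 1].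
Proof.
have i0 : 0 < n.+1%:R^-1 :> R by rewrite invr_gt0.
have i1 : n.+1%:R^-1 <= 1 :> R by rewrite invf_le1// ler1n.
have [xz|xz] := lerP x z.
  have [-> ->] := ramp_le n xz; split => //; [exact: pos_part_ge0|lra|lra].
have [xe|xe] := lerP (z + n.+1%:R^-1) x.
  have [-> ->] := ramp_ge xe; move: i0 i1 xe; move: (n.+1%:R^-1) => e i0 i1 xe.
  by rewrite /pos_part max_l; [split; lra|lra].
have p1 : pos_part (x - z) = x - z by rewrite /pos_part max_l//; lra.
have p2 : pos_part (x - z - n.+1%:R^-1) = 0.
  by rewrite /pos_part max_r//; move: xz xe; move: (n.+1%:R^-1) => e *; lra.
rewrite /ramp /dramp p1 p2 expr0n !subr0.
have u1 : (x - z) * n.+1%:R < 1 by rewrite -ltr_pdivlMr// div1r ltrBlDl.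
have u0 : 0 < (x - z) * n.+1%:R by rewrite mulr_gt0// subr_gt0.
rewrite (_ : _ / 2 * _ = (x - z) * ((x - z) * n.+1%:R) / 2); last by field.
have h0 : 0 < x - z by rewrite subr_gt0.
have h1 : x - z <= 1 by rewrite (le_trans _ i1)// lerBlDl ltW.
clear p1 p2; move: h0 h1 u0 u1; move: ((x - z) * n.+1%:R) => u h0 h1 u0 u1.
by split; [nra|nra|nra|apply/andP; split; apply: ltW].
Qed.

Lemma ramp_cvg x : ramp n x @[n --> \oo] --> pos_part (x - z).
Proof.
have [xz|xz] := lerP x z.
  apply: cvg_near_cst; near=> n.
  by rewrite (ramp_le n xz).1 /pos_part max_r//; lra.
have h : x - z - n.+1%:R^-1 / 2 @[n --> \oo] --> x - z.
  rewrite -[X in _ --> X]subr0 -(mul0r (2^-1)); apply: cvgB; first exact: cvg_cst.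
  by apply: cvgM; [exact: cvg_harmonic|exact: cvg_cst].
rewrite /pos_part max_l; last lra.
apply: cvg_trans h; apply: near_eq_cvg; near=> n.
rewrite (ramp_ge _).1//.
have : n.+1%:R^-1 <= x - z.
  near: n; apply: (cvgr_le 0); [exact: cvg_harmonic|lra].
by rewrite lerBrDl.
Unshelve. all: by end_near. Qed.

(** The limit at [x = z] is 0, so the point [z] goes with the left branch, in agreement with the
    closed half-line in [prob_le]. *)
Lemma dramp_cvg x : dramp n x @[n --> \oo] --> (if x <= z then 0 else 1 : R).
Proof.
case: (lerP x z) => xz.
  by apply: cvg_near_cst; near=> n; rewrite (ramp_le n xz).2.
apply: cvg_near_cst; near=> n; rewrite (ramp_ge _).2//.
have : n.+1%:R^-1 <= x - z.
  near: n; apply: (cvgr_le 0); [exact: cvg_harmonic|lra].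
by rewrite lerBrDl.
Unshelve. all: by end_near. Qed.

End ramp.

Lemma growth_bound_ge0 {R : realType} (D : set R) (f : R -> R) :
  (exists C p, forall x, D x -> `|f x| <= C * (1 + `|x|) ^+ p) ->
  exists C p, 0 <= C /\ forall x, D x -> `|f x| <= C * (1 + `|x|) ^+ p.
Proof.
move=> [C [p h]]; exists `|C|, p; split => // x Dx; rewrite (le_trans (h x Dx))//.
by rewrite ler_wpM2r ?exprn_ge0 ?addr_ge0// ler_norm.
Qed.

(** * Stein pairs: limits and gluing *)

Section stein_pairs.
Context {R : realType} d (T : measurableType d) (P : probability T R).
Variables (W : T -> R) (a b : R).
Hypothesis aW : all_moments P W.

(** [g'] is not asked to be the derivative of [g]: in the limits taken below [g] acquires a kink and
    [g'] a jump, and only the integral identity persists. *)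
Definition stein_pair (g g' : R -> R) :=
  [/\ measurable_fun setT g, measurable_fun setT g', pgrowth g, pgrowth g' &
   \int[P]_w (W w * g (W w)) = \int[P]_w ((a + b * W w) * g' (W w))].

Hypothesis stein_C1 : forall g g' : R -> R, (forall x : R, is_derive x 1 g (g' x)) ->
  continuous g' -> pgrowth g -> pgrowth g' -> stein_pair g g'.

Lemma integrable_W g : measurable_fun setT g -> pgrowth g ->
  P.-integrable setT (EFin \o (fun w => g (W w))).
Proof. exact: all_moments_integrable. Qed.

Lemma integrable_WM g : measurable_fun setT g -> pgrowth g ->
  P.-integrable setT (EFin \o (fun w => W w * g (W w))).
Proof.
move=> mg pg; apply: (integrable_W (g := fun x => x * g x)); first exact: measurable_funM.
by apply: pgrowthM => //; exact: pgrowth_id.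
Qed.

Lemma integrable_abWM g : measurable_fun setT g -> pgrowth g ->
  P.-integrable setT (EFin \o (fun w => (a + b * W w) * g (W w))).
Proof.
move=> mg pg; apply: (integrable_W (g := fun x => (a + b * x) * g x)).
  by apply: measurable_funM => //; apply: measurable_funD => //; exact: measurable_funM.
apply: pgrowthM => //; apply: pgrowthD; first exact: pgrowth_cst.
by apply: pgrowthM; [exact: pgrowth_cst|exact: pgrowth_id].
Qed.

Lemma stein_pairD g1 g1' g2 g2' : stein_pair g1 g1' -> stein_pair g2 g2' ->
  stein_pair (fun x => g1 x + g2 x) (fun x => g1' x + g2' x).
Proof.
move=> [m1 m1' p1 p1' e1] [m2 m2' p2 p2' e2].
split; [exact: measurable_funD|exact: measurable_funD|exact: pgrowthD|exact: pgrowthD|].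
under eq_Rintegral do rewrite mulrDr.
under [RHS]eq_Rintegral do rewrite mulrDr.
by rewrite !RintegralD// ?e1 ?e2//; (exact: integrable_WM || exact: integrable_abWM).
Qed.

Lemma stein_pairZ c g g' : stein_pair g g' ->
  stein_pair (fun x => c * g x) (fun x => c * g' x).
Proof.
move=> [m1 m1' p1 p1' e1].
have pc := pgrowth_cst c.
split; [exact: measurable_funM|exact: measurable_funM|exact: pgrowthM|exact: pgrowthM|].
under eq_Rintegral do rewrite mulrCA.
under [RHS]eq_Rintegral do rewrite mulrCA.
by rewrite !RintegralZl// ?e1//; (exact: integrable_WM || exact: integrable_abWM).
Qed.

Lemma stein_pair_limit (gn gn' : nat -> R -> R) (g g' : R -> R) (C : R) (p : nat) :
  (forall n, stein_pair (gn n) (gn' n)) ->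
  (forall n x, `|gn n x| <= C * (1 + `|x|) ^+ p) ->
  (forall n x, `|gn' n x| <= C * (1 + `|x|) ^+ p) ->
  (forall x, gn n x @[n --> \oo] --> g x) ->
  (forall x, gn' n x @[n --> \oo] --> g' x) ->
  stein_pair g g'.
Proof.
move=> sp bg bg' cg cg'.
have mgn n : measurable_fun setT (gn n) by have [] := sp n.
have mgn' n : measurable_fun setT (gn' n) by have [] := sp n.
have mg : measurable_fun setT g.
  by apply: (@measurable_fun_cvg _ _ _ _ gn) => // x _; exact: cg.
have mg' : measurable_fun setT g'.
  by apply: (@measurable_fun_cvg _ _ _ _ gn') => // x _; exact: cg'.
have lim_le (f : nat -> R -> R) (f0 : R -> R) : (forall n x, `|f n x| <= C * (1 + `|x|) ^+ p) ->
    (forall x, f n x @[n --> \oo] --> f0 x) -> pgrowth f0.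
  move=> fb fc; exists C, p => x.
  have c : `|f n x| @[n --> \oo] --> `|f0 x| by apply: cvg_norm; exact: fc.
  by rewrite -(cvg_lim _ c)//; apply: limr_le; [exact: cvgP c|exact: nearW].
have pg := lim_le _ _ bg cg; have pg' := lim_le _ _ bg' cg'.
split => //.
pose D (x : R) := C * (1 + `|x|) ^+ p.
have mD : measurable_fun setT D.
  apply: measurable_funM => //; apply: measurable_funX; apply: measurable_funD => //.
have pD : pgrowth D.
  exists `|C|, p => x; rewrite normrM ler_wpM2l// ger0_norm// exprn_ge0 ?addr_ge0//.
(* Serves both sides of the identity, with coefficients [(0, 1)] for [W] and [(a, b)] for
   [a + b W]. *)
have lim_W (c e : R) (f : nat -> R -> R) (f0 : R -> R) : (forall n, measurable_fun setT (f n)) ->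
    (forall n x, `|f n x| <= D x) -> (forall x, f n x @[n --> \oo] --> f0 x) ->
    \int[P]_w ((c + e * W w) * f n (W w)) @[n --> \oo] --> \int[P]_w ((c + e * W w) * f0 (W w)).
  move=> mf fb fc.
  have mc : measurable_fun setT (fun x : R => c + e * x).
    by apply: measurable_funD => //; exact: measurable_funM.
  apply: (@Rintegral_dominated _ _ _ P (fun n w => (c + e * W w) * f n (W w)) _ (fun w => `|c + e * W w| * D (W w))) => //.
  - move=> n; apply: measurable_funM.
      exact: (measurableT_comp mc aW.1).
    exact: (measurableT_comp (mf n) aW.1).
  - by move=> w; apply: cvgM; [exact: cvg_cst|exact: fc].
  - apply: (integrable_W (g := fun x => `|c + e * x| * D x)).
      by apply: measurable_funM => //; exact: measurableT_comp.
    apply: pgrowthM => //; apply: (@le_pgrowth _ _ (fun x => c + e * x)).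
      by move=> x; rewrite normr_id.
    apply: pgrowthD; first exact: pgrowth_cst.
    by apply: pgrowthM; [exact: pgrowth_cst|exact: pgrowth_id].
  - by move=> n w; rewrite normrM ler_wpM2l//; exact: fb.
have l2 := lim_W 0 1 _ _ mgn bg cg.
have l4 := lim_W a b _ _ mgn' bg' cg'.
have E (f : R -> R) : \int[P]_w ((0 + 1 * W w) * f (W w)) = \int[P]_w (W w * f (W w)).
  by apply: eq_Rintegral => w _; rewrite add0r mul1r.
rewrite E in l2; rewrite (_ : (fun n => _) = (fun n => \int[P]_w ((0 + 1 * W w) * gn n (W w)))) in l4.
  exact: cvg_unique l2 l4.
by apply/funext => n; rewrite E; have [] := sp n.
Qed.

Section glue.
Variable z : R.
Variables (A A' B B' : R -> R).
Hypothesis dA : forall x : R, is_derive x 1 A (A' x).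
Hypothesis cA' : continuous A'.
Hypothesis gA : exists C p, forall x, x <= z + 1 -> `|A x| <= C * (1 + `|x|) ^+ p.
Hypothesis gA' : exists C p, forall x, x <= z + 1 -> `|A' x| <= C * (1 + `|x|) ^+ p.
Hypothesis dB : forall x : R, is_derive x 1 B (B' x).
Hypothesis cB' : continuous B'.
Hypothesis gB : exists C p, forall x, z <= x -> `|B x| <= C * (1 + `|x|) ^+ p.
Hypothesis gB' : exists C p, forall x, z <= x -> `|B' x| <= C * (1 + `|x|) ^+ p.

Let u n x := x - ramp z n x.
Let v n x := z + ramp z n x.

Let K := 3 * (1 + `|z|).

Let uK n x : 1 + `|u n x| <= K * (1 + `|x|).
Proof.
have [r0 rp _ _] := ramp_bounds z n x; rewrite /u /K.
have : pos_part (x - z) <= `|x| + `|z|.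
  by rewrite /pos_part ge_max addr_ge0// andbT (le_trans (ler_norm _))// ler_normB.
have := ler_normB x (ramp z n x); rewrite (ger0_norm r0).
have := normr_ge0 x; have := normr_ge0 z; nra.
Qed.

Let vK n x : 1 + `|v n x| <= K * (1 + `|x|).
Proof.
have [r0 rp _ _] := ramp_bounds z n x; rewrite /v /K.
have : pos_part (x - z) <= `|x| + `|z|.
  by rewrite /pos_part ge_max addr_ge0// andbT (le_trans (ler_norm _))// ler_normB.
have := ler_normD z (ramp z n x); rewrite (ger0_norm r0).
have := normr_ge0 x; have := normr_ge0 z; nra.
Qed.

Let K0 : 0 <= K. Proof. by rewrite /K mulr_ge0// addr_ge0. Qed.

Let ub (f : R -> R) : (exists C p, forall x, x <= z + 1 -> `|f x| <= C * (1 + `|x|) ^+ p) ->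
  exists C p, 0 <= C /\ forall n x, `|f (u n x)| <= C * (1 + `|x|) ^+ p.
Proof.
move=> /(@growth_bound_ge0 R [set x | x <= z + 1])[C [p [C0 fC]]].
exists (C * K ^+ p), p; split=> [|n x]; first by rewrite mulr_ge0 ?exprn_ge0.
have [_ _ uz _] := ramp_bounds z n x; rewrite (le_trans (fC _ uz))//.
by rewrite -mulrA -exprMn ler_wpM2l// lerXn2r ?nnegrE ?mulr_ge0 ?addr_ge0//; exact: uK.
Qed.

Let vb (f : R -> R) : (exists C p, forall x, z <= x -> `|f x| <= C * (1 + `|x|) ^+ p) ->
  exists C p, 0 <= C /\ forall n x, `|f (v n x)| <= C * (1 + `|x|) ^+ p.
Proof.
move=> /(@growth_bound_ge0 R [set x | z <= x])[C [p [C0 fC]]].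
exists (C * K ^+ p), p; split=> [|n x]; first by rewrite mulr_ge0 ?exprn_ge0.
have [r0 _ _ _] := ramp_bounds z n x; rewrite (le_trans (fC _ _))//=; first by rewrite lerDl.
by rewrite -mulrA -exprMn ler_wpM2l// lerXn2r ?nnegrE ?mulr_ge0 ?addr_ge0//; exact: vK.
Qed.

Let du n (x : R) : is_derive x 1 (fun x => A (u n x)) (A' (u n x) * (1 - dramp z n x)).
Proof.
have dr := is_derive_ramp z n x; have dAx := dA (u n x).
by apply: is_derive_eq; rewrite /GRing.scale/=; ring.
Qed.

Let dv n (x : R) : is_derive x 1 (fun x => B (v n x)) (B' (v n x) * dramp z n x).
Proof.
have dr := is_derive_ramp z n x; have dBx := dB (v n x).
have dux : is_derive x 1 (v n) (dramp z n x).
  by have := is_deriveD (is_derive_cst z x 1) dr; rewrite add0r.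
by apply: is_derive_eq; rewrite /GRing.scale/=; ring.
Qed.

Let cu n : continuous (u n).
Proof. by move=> x; apply: cvgB; [exact: cvg_id|exact: (is_derive1_continuous (is_derive_ramp z n))]. Qed.

Let cv n : continuous (v n).
Proof. by move=> x; apply: cvgD; [exact: cvg_cst|exact: (is_derive1_continuous (is_derive_ramp z n))]. Qed.

Let u_cvg x : u n x @[n --> \oo] --> (if x <= z then x else z).
Proof.
rewrite (_ : (if x <= z then x else z) = x - pos_part (x - z)).
  by apply: cvgB; [exact: cvg_cst|exact: ramp_cvg].
by rewrite /pos_part; case: lerP => h; [rewrite max_r ?subr0 ?subr_le0|rewrite max_l ?subr_ge0 ?ltW// subKr].
Qed.

Let v_cvg x : v n x @[n --> \oo] --> (if x <= z then z else x).
Proof.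
rewrite (_ : (if x <= z then z else x) = z + pos_part (x - z)).
  by apply: cvgD; [exact: cvg_cst|exact: ramp_cvg].
rewrite /pos_part; case: lerP => h; [rewrite max_r ?addr0 ?subr_le0//|rewrite max_l ?subr_ge0 ?ltW//].
by rewrite addrC subrK.
Qed.

(** [A] is composed with [x - ramp z n x], of class C^1 and tending to [min x z]: in the limit the
    function follows [A] up to [z] and stays at [A z] afterwards. The right branch uses
    [z + ramp z n x], which tends to [max x z]. *)
Lemma stein_pair_left : stein_pair (fun x => A (if x <= z then x else z))
  (fun x => if x <= z then A' x else 0).
Proof.
have [C [p [C0 bC]]] := ub gA; have [C' [p' [C'0 bC']]] := ub gA'.
have dr01 n x : `|1 - dramp z n x| <= 1.
  by have [_ _ _ /andP[]] := ramp_bounds z n x; rewrite ler_norml => *; lra.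
have h1 n x : `|A (u n x)| <= (C + C') * (1 + `|x|) ^+ (p + p').
  rewrite (le_trans (bC _ _))// ler_pM ?exprn_ge0 ?addr_ge0 ?lerDl//.
  by rewrite ler_weXn2l ?leq_addr// ge1_1Dnormr.
have h2 n x : `|A' (u n x) * (1 - dramp z n x)| <= (C + C') * (1 + `|x|) ^+ (p + p').
  rewrite normrM (@le_trans _ _ `|A' (u n x)|) ?ler_piMr//.
  rewrite (le_trans (bC' _ _))// ler_pM ?exprn_ge0 ?addr_ge0 ?lerDr//.
  by rewrite ler_weXn2l ?leq_addl// ge1_1Dnormr.
apply: (@stein_pair_limit (fun n x => A (u n x)) (fun n x => A' (u n x) * (1 - dramp z n x))
   _ _ _ _ _ h1 h2).
- move=> n; apply: stein_C1.
  + exact: du.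
  + move=> x; apply: cvgM.
      by apply: (@continuous_comp _ _ _ (u n) A'); [exact: cu|exact: cA'].
    by apply: cvgB; [exact: cvg_cst|exact: continuous_dramp].
  + by exists (C + C'), (p + p')%N.
  + by exists (C + C'), (p + p')%N.
- move=> x; apply: (@continuous_cvg _ _ _ _ _ (fun n => u n x) A); last exact: u_cvg.
  exact: (is_derive1_continuous dA).
- move=> x; rewrite (_ : (if x <= z then A' x else 0) =
     A' (if x <= z then x else z) * (1 - (if x <= z then 0 else 1))).
    apply: cvgM; last by apply: cvgB; [exact: cvg_cst|exact: dramp_cvg].
    apply: (@continuous_cvg _ _ _ _ _ (fun n => u n x) A'); last exact: u_cvg.
    exact: cA'.
  by case: ifP => _; rewrite ?subr0 ?mulr1// subrr mulr0.
Qed.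

Lemma stein_pair_right : stein_pair (fun x => B (if x <= z then z else x))
  (fun x => if x <= z then 0 else B' x).
Proof.
have [C [p [C0 bC]]] := vb gB; have [C' [p' [C'0 bC']]] := vb gB'.
have dr01 n x : `|dramp z n x| <= 1.
  by have [_ _ _ /andP[]] := ramp_bounds z n x; rewrite ler_norml => *; lra.
have h1 n x : `|B (v n x)| <= (C + C') * (1 + `|x|) ^+ (p + p').
  rewrite (le_trans (bC _ _))// ler_pM ?exprn_ge0 ?addr_ge0 ?lerDl//.
  by rewrite ler_weXn2l ?leq_addr// ge1_1Dnormr.
have h2 n x : `|B' (v n x) * dramp z n x| <= (C + C') * (1 + `|x|) ^+ (p + p').
  rewrite normrM (@le_trans _ _ `|B' (v n x)|) ?ler_piMr//.
  rewrite (le_trans (bC' _ _))// ler_pM ?exprn_ge0 ?addr_ge0 ?lerDr//.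
  by rewrite ler_weXn2l ?leq_addl// ge1_1Dnormr.
apply: (@stein_pair_limit (fun n x => B (v n x)) (fun n x => B' (v n x) * dramp z n x)
   _ _ _ _ _ h1 h2).
- move=> n; apply: stein_C1.
  + exact: dv.
  + move=> x; apply: cvgM; last exact: continuous_dramp.
    by apply: (@continuous_comp _ _ _ (v n) B'); [exact: cv|exact: cB'].
  + by exists (C + C'), (p + p')%N.
  + by exists (C + C'), (p + p')%N.
- move=> x; apply: (@continuous_cvg _ _ _ _ _ (fun n => v n x) B); last exact: v_cvg.
  exact: (is_derive1_continuous dB).
- move=> x; rewrite (_ : (if x <= z then 0 else B' x) =
     B' (if x <= z then z else x) * (if x <= z then 0 else 1)).
    apply: cvgM; last exact: dramp_cvg.
    apply: (@continuous_cvg _ _ _ _ _ (fun n => v n x) B'); last exact: v_cvg.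
    exact: cB'.
  by case: ifP => _; rewrite ?mulr0 ?mulr1.
Qed.

(** The glued function is [A (min x z) + B (max x z) - A z], and a constant forms a pair with 0. *)
Lemma stein_pair_glue : A z = B z ->
  stein_pair (fun x => if x <= z then A x else B x) (fun x => if x <= z then A' x else B' x).
Proof.
move=> AB.
have sc : stein_pair (cst 1) (cst 0).
  exact: stein_C1 (fun x : R => is_derive_cst (1 : R) x 1) (@cst_continuous _ _ (0 : R))
    (pgrowth_cst 1) (pgrowth_cst 0).
have := stein_pairD (stein_pairD stein_pair_left stein_pair_right) (stein_pairZ (- A z) sc).
congr stein_pair; apply/funext => x; rewrite /cst.
  by case: ifP => _; rewrite -?AB; ring.
by case: ifP => _; ring.
Qed.

End glue.
End stein_pairs.

(** * Stein's equation *)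

Section normal_cdf.
Context {R : realType}.
Notation leb := (@lebesgue_measure R).
Notation phi := (@phi R).
Notation Phi := (@Phi R).

Lemma phiN x : phi (- x) = phi x.
Proof. by rewrite !phiE sqrrN. Qed.

Lemma integrable_mul_phi (h : R -> R) (D : set R) (M : R) : measurable D ->
  measurable_fun setT h -> (forall x, `|h x| <= M) ->
  leb.-integrable D (EFin \o (fun x => h x * phi x)).
Proof.
move=> mD mh hM; apply: (@integrableS _ _ _ _ setT) => //.
by apply/integrable_stdN => //; exact: (@integrable_bounded _ _ _ stdN _ M).
Qed.

Lemma integrable_phi (D : set R) : measurable D -> leb.-integrable D (EFin \o phi).
Proof.
by move=> mD; apply: (@integrableS _ _ _ _ setT) => //; exact: integrable_normal_pdf.
Qed.

Lemma is_derive_lower_integral (h : R -> R) (M : R) (x : R) :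
  continuous h -> (forall x, `|h x| <= M) ->
  is_derive x 1 (fun x => \int[leb]_(t in `]-oo, x]) (h t * phi t)) (h x * phi x).
Proof.
move=> ch hM.
have mh : measurable_fun setT h by exact: continuous_measurable_fun.
have xu : x < x + 1 by rewrite ltrDl.
have cf : {for x, continuous (fun t => h t * phi t)}.
  by apply: cvgM; [exact: ch|exact: continuous_phi].
have i : leb.-integrable [set` Interval -oo%O (BRight (x + 1))] (EFin \o (fun t => h t * phi t)).
  by apply: integrable_mul_phi hM => //; exact: measurable_itv.
pose F x := \int[leb]_(t in `]-oo, x]) (h t * phi t).
have [d1 d2] : derivable F x 1 /\ F^`()%classic x = h x * phi x.
  by apply: (@continuous_FTC1 R (fun t => h t * phi t) -oo%O x (x + 1)); [exact: xu|exact: i|by rewrite ltNyr|exact: cf].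
by apply: DeriveDef => //; rewrite -derive1E.
Qed.

Lemma PhiE z : Phi z = \int[leb]_(t in `]-oo, z]) phi t.
Proof. by []. Qed.

Lemma is_derive_Phi (x : R) : is_derive x 1 Phi (phi x).
Proof.
have := @is_derive_lower_integral (cst 1) 1 x (@cst_continuous _ _ (1 : R)).
rewrite /= mul1r (_ : (fun x => _) = Phi); first by apply => y; rewrite normr1.
by apply/funext => y; rewrite PhiE; apply: eq_Rintegral => t _; rewrite mul1r.
Qed.

Lemma Phi_ge0 x : 0 <= Phi x.
Proof. by rewrite /Defs.Phi fine_ge0. Qed.

Lemma Phi_le1 x : Phi x <= 1.
Proof.
rewrite /Defs.Phi -lee_fin fineK ?probability_le1//.
by apply: fin_num_measure; exact: measurable_itv.
Qed.

Lemma Phi_le x y : x <= y -> Phi x <= Phi y.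
Proof.
move=> xy; rewrite /Defs.Phi fine_le//; try by apply: fin_num_measure; exact: measurable_itv.
apply: le_measure; rewrite ?inE; try exact: measurable_itv.
by apply: subset_itvl; rewrite bnd_simp.
Qed.

Lemma Rintegral_split (h : R -> R) (M x : R) : measurable_fun setT h ->
  (forall x, `|h x| <= M) ->
  \int[leb]_t (h t * phi t) =
  \int[leb]_(t in `]-oo, x]) (h t * phi t) + \int[leb]_(t in `]x, +oo[) (h t * phi t).
Proof.
move=> mh hM; rewrite -Rintegral_setU//=.
- by rewrite itv_setU_setT.
- by apply: integrable_mul_phi hM => //; apply: measurableU; exact: measurable_itv.
- apply/disj_setPS => t [/=]; rewrite !in_itv/= andbT => tx xt.
  by rewrite leNgt xt in tx.
Qed.

Lemma Rintegral_split_ge (h : R -> R) (M x : R) : measurable_fun setT h ->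
  (forall x, `|h x| <= M) ->
  \int[leb]_t (h t * phi t) =
  \int[leb]_(t in `]-oo, x]) (h t * phi t) + \int[leb]_(t in `[x, +oo[) (h t * phi t).
Proof.
move=> mh hM; rewrite (Rintegral_split x mh hM); congr (_ + _).
by apply: Rintegral_itv_obnd_cbnd; apply: integrable_mul_phi hM => //; exact: measurable_itv.
Qed.

Lemma Phic_integral x : 1 - Phi x = \int[leb]_(t in `[x, +oo[) phi t.
Proof.
have n1 (y : R) : `|cst (1 : R) y| <= 1 by rewrite normr1.
have := Rintegral_split_ge x (measurable_cst (1 : R)) n1.
have e D : \int[leb]_(t in D) (cst 1 t * phi t) = \int[leb]_(t in D) phi t.
  by apply: eq_Rintegral => t _; rewrite mul1r.
rewrite !e -PhiE (_ : \int[leb]_t phi t = 1); first by move=> ->; rewrite addrAC subrr add0r.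
by rewrite /Rintegral integral_normal_pdf.
Qed.

Lemma PhiN x : Phi (- x) = 1 - Phi x.
Proof.
rewrite Phic_integral PhiE /Rintegral; congr fine.
rewrite ge0_integration_by_substitutionNy; first last.
- by move=> y _; exact: phi_ge0.
- by apply: continuous_subspaceT; exact: continuous_phi.
by apply: eq_integral => y _ /=; rewrite phiN.
Qed.

Lemma cvg_phi_pinfty : phi x @[x --> +oo] --> (0 : R).
Proof.
have [C [C0 hC]] := @phi_tail R 0.
apply: (@squeeze_cvgr _ _ _ _ (fun=> 0) (fun x => C * x^-1)).
- near=> x; rewrite phi_ge0/=.
  have x0 : 0 < x by near: x; exact: nbhs_pinfty_gt.
  have := hC x; rewrite expr0 mul1r => h; apply: (le_trans h).
  rewrite ler_wpM2l// lef_pV2 ?posrE// ?ltr_wpDr//.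
  by rewrite (gtr0_norm x0) lerDr.
- exact: cvg_cst.
- rewrite -(mulr0 C); apply: cvgM; first exact: cvg_cst.
  by apply/gtr0_cvgV0; [near=> y; near: y; exact: nbhs_pinfty_gt|exact: cvg_id].
Unshelve. all: by end_near. Qed.

(** For [x > 0] the left side is the integral of [x phi t] over [t >= x], at most that of [t phi t],
    which equals [phi x]. *)
Lemma mills x : x * (1 - Phi x) <= phi x.
Proof.
have [x0|x0] := lerP x 0.
  by rewrite (@le_trans _ _ 0) ?phi_ge0// mulr_le0_ge0// subr_ge0 Phi_le1.
rewrite Phic_integral -RintegralZl//; last first.
  by apply: integrable_phi; exact: measurable_itv.
have cyp : continuous (fun y : R => y * phi y).
  by move=> y; apply: cvgM; [exact: cvg_id|exact: continuous_phi].
have E : (\int[leb]_(t in `[x, +oo[) (t * phi t)%:E = (phi x)%:E)%E.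
  rewrite (@ge0_continuous_FTC2y _ _ (fun y => - phi y) _ 0).
  - by rewrite EFinN oppeK add0e.
  - by move=> y xy; rewrite mulr_ge0 ?phi_ge0// (le_trans (ltW x0)).
  - exact: continuous_subspaceT.
  - by rewrite -oppr0; apply: cvgN; exact: cvg_phi_pinfty.
  - by move=> y _; exact: (@ex_derive _ _ _ _ _ _ _ (is_deriveN (is_derive_phi y))).
  - by apply: cvgN; apply: cvg_at_right_filter; exact: continuous_phi.
  - move=> y _; rewrite derive1E.
    rewrite (@derive_val _ _ _ _ _ _ _ (is_deriveN (is_derive_phi y))).
  by rewrite mulNr opprK.
have i2 : leb.-integrable `[x, +oo[ (EFin \o (fun t => t * phi t)).
  apply: (@integrableS _ _ _ _ setT) => //.
  by apply/integrable_stdN => //; apply: integrable_pgrowth => //; exact: pgrowth_id.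
apply: (@le_trans _ _ (\int[leb]_(t in `[x, +oo[) (t * phi t))); last first.
  by rewrite /Rintegral E.
apply: le_Rintegral => //.
  exact: (integrable_mul_phi (M := `|x|)).
by move=> y /=; rewrite in_itv/= andbT => xy; rewrite ler_wpM2r ?phi_ge0.
Qed.

Lemma millsN x : - x * Phi x <= phi x.
Proof. by have := mills (- x); rewrite PhiN phiN subKr. Qed.

End normal_cdf.

Section growth_on.
Context {R : realType} (D : pred R).
Implicit Types f g : R -> R.

(** Extension by zero off [D] makes the closure properties of [pgrowth] available on a half-line. *)
Definition growth_on f := pgrowth (fun x => if D x then f x else 0).

Lemma growth_onE f : growth_on f ->
  exists C p, forall x, D x -> `|f x| <= C * (1 + `|x|) ^+ p.
Proof. by move=> [C [p h]]; exists C, p => x Dx; have := h x; rewrite Dx. Qed.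

Lemma growth_onD f g : growth_on f -> growth_on g -> growth_on (fun x => f x + g x).
Proof.
move=> pf pg; have := pgrowthD pf pg; congr pgrowth.
by apply/funext => x; case: ifP => _; rewrite ?addr0.
Qed.

Lemma growth_onM f g : growth_on f -> growth_on g -> growth_on (fun x => f x * g x).
Proof.
move=> pf pg; have := pgrowthM pf pg; congr pgrowth.
by apply/funext => x; case: ifP => _; rewrite ?mulr0.
Qed.

Lemma pgrowth_on f : pgrowth f -> growth_on f.
Proof. by apply: le_pgrowth => x; case: ifP => _ //; rewrite normr0. Qed.

Lemma growth_on_bounded f (K : R) : (forall x, D x -> `|f x| <= K) -> growth_on f.
Proof.
by move=> fK; apply: (bounded_pgrowth (M := `|K|)) => x; case: ifP => [/fK h|_];
  [exact: le_trans h (ler_norm _)|rewrite normr0].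
Qed.

End growth_on.

(** * Mills ratios and solutions of Stein's equation *)

Section mills_ratio.
Context {R : realType}.
Notation leb := (@lebesgue_measure R).
Notation phi := (@phi R).
Notation Phi := (@Phi R).

Definition iphi (x : R) := Num.sqrt (pi *+ 2) * expR (x ^+ 2 / 2).

Lemma iphi_phi x : phi x * iphi x = 1.
Proof.
have c0 : 0 < Num.sqrt (pi *+ 2) :> R by rewrite sqrtr_gt0 mulrn_wgt0// pi_gt0.
rewrite phiE /iphi mulrACA -expRD mulVf ?gt_eqF//.
by rewrite mulNr addNr expR0 mulr1.
Qed.

Lemma iphi_gt0 x : 0 < iphi x.
Proof. by rewrite /iphi mulr_gt0 ?expR_gt0// sqrtr_gt0 mulrn_wgt0// pi_gt0. Qed.

Lemma is_derive_iphi (x : R) : is_derive x 1 iphi (x * iphi x).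
Proof. by rewrite /iphi; apply: is_derive_eq; rewrite /GRing.scale/=; field. Qed.

(** [iphi] being [1 / phi], these are the Mills ratios of the left and right tails. They satisfy
    [f' = x f + 1] and [f' = x f - 1], so suitable multiples of them are the two branches of
    [fz]. *)
Definition lmills x := Phi x * iphi x.
Definition rmills x := (1 - Phi x) * iphi x.

Lemma is_derive_lmills (x : R) : is_derive x 1 lmills (1 + x * lmills x).
Proof.
have d1 := is_derive_Phi x; have d2 := is_derive_iphi x.
by apply: is_derive_eq; rewrite /GRing.scale/= /lmills -(iphi_phi x); ring.
Qed.

Lemma is_derive_rmills (x : R) : is_derive x 1 rmills (x * rmills x - 1).
Proof.
have d1 := is_derive_Phi x; have d2 := is_derive_iphi x.
have d3 : is_derive x 1 (fun x => 1 - Phi x) (- phi x).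
  by have := is_deriveB (is_derive_cst (1 : R) x 1) d1; rewrite sub0r.
by apply: is_derive_eq; rewrite /GRing.scale/= /rmills -(iphi_phi x); ring.
Qed.

Lemma lmills_ge0 x : 0 <= lmills x.
Proof. by rewrite mulr_ge0 ?Phi_ge0// ltW// iphi_gt0. Qed.

Lemma rmills_ge0 x : 0 <= rmills x.
Proof. by rewrite mulr_ge0 ?subr_ge0 ?Phi_le1// ltW// iphi_gt0. Qed.

Lemma mulx_rmills x : x * rmills x <= 1.
Proof. by rewrite /rmills mulrA -[leRHS](iphi_phi x) ler_wpM2r ?mills// ltW// iphi_gt0. Qed.

Lemma mulNx_lmills x : - x * lmills x <= 1.
Proof. by rewrite /lmills mulrA -[leRHS](iphi_phi x) ler_wpM2r ?millsN// ltW// iphi_gt0. Qed.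

Lemma iphiN x : iphi (- x) = iphi x.
Proof. by rewrite /iphi sqrrN. Qed.

Lemma lmillsN x : lmills x = rmills (- x).
Proof. by rewrite /rmills PhiN iphiN subKr. Qed.

(** From 1 on, the Mills inequality bounds the ratio by 1; between [a] and 1 it is at most [iphi x],
    and there [|x| <= |a| + 1]. *)
Lemma rmills_bound (a x : R) : a <= x -> `|rmills x| <= 1 + iphi (`|a| + 1).
Proof.
move=> ax; rewrite ger0_norm ?rmills_ge0//.
have i0 := iphi_gt0 (`|a| + 1).
have [x1|x1] := lerP 1 x.
  apply: (@le_trans _ _ 1); last by rewrite lerDl ltW.
  by rewrite (le_trans _ (mulx_rmills x))// ler_peMl// rmills_ge0.
have xa : `|x| <= `|a| + 1.
  rewrite ler_norml; have := ler_norm (- a); rewrite normrN => h.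
  by have h2 := normr_ge0 a; apply/andP; split; lra.
apply: (@le_trans _ _ (iphi (`|a| + 1))); last by rewrite lerDr.
rewrite /rmills -[leRHS]mul1r ler_pM ?subr_ge0 ?Phi_le1//.
- by rewrite ltW// iphi_gt0.
- by have := Phi_ge0 x; lra.
rewrite /iphi ler_wpM2l// ler_expR ler_wpM2r// -(real_normK (num_real x)) lerXn2r ?nnegrE//.
Qed.

Lemma lmills_bound (a x : R) : x <= a -> `|lmills x| <= 1 + iphi (`|a| + 1).
Proof. by rewrite lmillsN => xa; rewrite -(normrN a) rmills_bound// lerN2. Qed.

(** The solution is the integral of [h phi] up to [x], divided by [phi x]. For [x <= 0] the left
    Mills ratio bounds it; for [x > 0] the vanishing mean of [h] turns the lower integral into minus
    the upper one, and the right Mills ratio takes over. *)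
Lemma stein_solution (h : R -> R) (M : R) : continuous h -> (forall x, `|h x| <= M) ->
  \int[stdN]_x h x = 0 ->
  exists f K, [/\ forall x : R, is_derive x 1 f (x * f x + h x) & forall x, `|f x| <= K].
Proof.
move=> ch hM h0.
have mh : measurable_fun setT h by exact: continuous_measurable_fun.
pose I x := \int[leb]_(t in `]-oo, x]) (h t * phi t).
exists (fun x => I x * iphi x), (`|M| * (1 + iphi (`|0 : R| + 1))); split=> x.
  have d1 : is_derive x 1 I (h x * phi x) by exact: is_derive_lower_integral hM.
  have d2 := is_derive_iphi x.
  apply: is_derive_eq; rewrite /GRing.scale/= -[in RHS](mulr1 (h x)) -(iphi_phi x); ring.
have bound D : measurable D -> `|\int[leb]_(t in D) (h t * phi t)| <= `|M| * \int[leb]_(t in D) phi t.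
  move=> mD; have i1 := integrable_mul_phi mD mh hM.
  rewrite (le_trans (le_normr_Rintegral mD i1))//.
  rewrite -RintegralZl//; last exact: integrable_phi.
  apply: le_Rintegral => //.
  - exact: integrable_abse i1.
  - apply: (integrable_mul_phi (h := cst `|M|) (M := `|M|)) => // y.
    by rewrite normr_id.
  - move=> y _; rewrite normrM (ger0_norm (phi_ge0 _)) ler_wpM2r ?phi_ge0//.
    exact: le_trans (hM y) (ler_norm _).
have [x0|x0] := lerP x 0.
  rewrite normrM (gtr0_norm (iphi_gt0 _)).
  apply: (@le_trans _ _ (`|M| * lmills x)).
    rewrite /lmills [leRHS]mulrA ler_wpM2r ?(ltW (iphi_gt0 _))//.
    by rewrite PhiE; apply: bound; exact: measurable_itv.
  by rewrite ler_wpM2l// (le_trans _ (lmills_bound x0))// ler_norm.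
have -> : I x = - \int[leb]_(t in `[x, +oo[) (h t * phi t).
  have := Rintegral_split_ge x mh hM.
  by rewrite -Rintegral_stdN// h0 => /esym/eqP; rewrite addr_eq0 => /eqP.
rewrite mulNr normrN normrM (gtr0_norm (iphi_gt0 _)).
apply: (@le_trans _ _ (`|M| * rmills x)).
  rewrite /rmills [leRHS]mulrA ler_wpM2r ?(ltW (iphi_gt0 _))//.
  by rewrite Phic_integral; apply: bound; exact: measurable_itv.
by rewrite ler_wpM2l// (le_trans _ (rmills_bound (ltW x0)))// ler_norm.
Qed.

Variable z : R.

(* [fz] solves the Stein equation of the indicator of ]-oo, z]; [dfz] is its derivative
   off [z]. *)
Definition fz x := if x <= z then (1 - Phi z) * lmills x else Phi z * rmills x.
Definition dfz x := if x <= z then (1 - Phi z) * (1 + x * lmills x)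
  else Phi z * (x * rmills x - 1).

Lemma dfzE x : dfz x - x * fz x = (x <= z)%R%:R - Phi z.
Proof. by rewrite /dfz /fz; case: ifP => _ /=; ring. Qed.

(** The delicate case is [x] between 0 and [z], where the Mills inequality says nothing about the
    ratio in use. The exchange [(1 - Phi x) * lmills x = Phi x * rmills x] brings in the ratio of
    the other tail, and monotonicity of [Phi] replaces [Phi z] by [Phi x]. *)
Lemma normr_dfz x : `|dfz x| <= 1.
Proof.
have pz0 := Phi_ge0 z; have pz1 := Phi_le1 z.
have px0 := Phi_ge0 x; have px1 := Phi_le1 x.
have l0 := lmills_ge0 x; have r0 := rmills_ge0 x.
have xr := mulx_rmills x; have xl := mulNx_lmills x.
rewrite /dfz; case: (lerP x z) => xz.
  have pp := Phi_le xz.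
  have [x0|x0] := lerP x 0.
    rewrite ger0_norm ?mulr_ge0; try nra.
  have k : (1 - Phi x) * (x * lmills x) <= Phi x.
    rewrite (_ : (1 - Phi x) * (x * lmills x) = (x * rmills x) * Phi x); last by rewrite /lmills /rmills; ring.
    nra.
  have xl0 : 0 <= x * lmills x by rewrite mulr_ge0// ltW.
  rewrite ger0_norm; last by nra.
  have : (1 - Phi z) * (x * lmills x) <= (1 - Phi x) * (x * lmills x) by rewrite ler_wpM2r//; lra.
  lra.
have pp := Phi_le (ltW xz).
have [x0|x0] := lerP 0 x.
  rewrite ler0_norm; nra.
have k : Phi x * (- x * rmills x) <= 1 - Phi x.
  rewrite (_ : Phi x * (- x * rmills x) = (- x * lmills x) * (1 - Phi x)); last by rewrite /lmills /rmills; ring.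
  nra.
have xl0 : 0 <= - x * rmills x by rewrite mulr_ge0// oppr_ge0 ltW.
have : Phi z * (- x * rmills x) <= Phi x * (- x * rmills x) by rewrite ler_wpM2r.
rewrite ler0_norm; last by nra.
lra.
Qed.

End mills_ratio.

(** * Chi-square laws *)

Section chi2.
Context {R : realType} d (T : measurableType d) (P : probability T R).
Variables (W : T -> R) (k : nat).

(* Stein's characterization of the chi-square law with [k] degrees of freedom. *)
Definition chi2_stein := all_moments P W /\
  forall g g' : R -> R, (forall x : R, is_derive x 1 g (g' x)) -> continuous g' ->
  pgrowth g -> pgrowth g' ->
  \int[P]_w (W w * g (W w)) =
  k%:R * \int[P]_w g (W w) + 2 * \int[P]_w (W w * g' (W w)).

Hypothesis W_chi2 : chi2_stein.

Let n : R := k.+1%:R.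
Let s := Num.sqrt (2 * n).
Let a := k%:R / n.
Let b := 2 / s.

(** Centred at the mean [k] but scaled with [n = k + 1] in place of [k]: this is the normalization
    of [Qbar_n], and it gives variance [k / n]. *)
Definition chi2_std (w : T) := (W w - k%:R) / Num.sqrt (2 * k.+1%:R).
Let X := chi2_std.

Let n0 : 0 < n. Proof. by []. Qed.
Let s0 : 0 < s. Proof. by rewrite sqrtr_gt0 mulr_gt0. Qed.
Let s2 : s ^+ 2 = 2 * n. Proof. by rewrite sqr_sqrtr// mulr_ge0// ltW. Qed.
Let b0 : 0 < b. Proof. by rewrite divr_gt0. Qed.
Let b2 : b ^+ 2 = 2 / n.
Proof. by rewrite /b exprMn exprVn s2; field; rewrite gt_eqF. Qed.
Let n1 : 1 <= n. Proof. by rewrite /n ler1n. Qed.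
Let onea : 1 - a = n^-1.
Proof. by rewrite /a /n -natr1; field; rewrite natr1 gt_eqF. Qed.
Let a01 : 0 <= a <= 1.
Proof.
apply/andP; split; first by rewrite divr_ge0// ltW.
by rewrite -subr_ge0 onea invr_ge0 ltW.
Qed.

Let X_W w : W w = k%:R + s * X w.
Proof. by rewrite /X /chi2_std -/n -/s mulrC divfK ?gt_eqF// addrC subrK. Qed.

Let X_aff (x : R) : R := (x - k%:R) / s.

Let d_aff (x : R) : is_derive x 1 X_aff s^-1.
Proof. by apply: is_derive_eq; rewrite /GRing.scale/=; ring. Qed.

Let pg_aff : pgrowth X_aff.
Proof.
apply: pgrowthM; last exact: pgrowth_cst.
by apply: pgrowthB; [exact: pgrowth_id|exact: pgrowth_cst].
Qed.

Lemma chi2_std_all_moments : all_moments P X.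
Proof.
have [aW _] := W_chi2; apply: (all_moments_comp (f := X_aff) aW _ pg_aff).
by apply: continuous_measurable_fun; exact: is_derive1_continuous d_aff.
Qed.
Let aX := chi2_std_all_moments.

(** Since [n b = s], [W = n (a + b X)]: the factor [W] in front of [g'] in the chi-square identity
    becomes the affine coefficient. *)
Lemma chi2_std_stein (g g' : R -> R) : (forall x : R, is_derive x 1 g (g' x)) ->
  continuous g' -> pgrowth g -> pgrowth g' -> stein_pair P X a b g g'.
Proof.
move=> dg cg' pg pg'; have [aW st] := W_chi2.
have cg := is_derive1_continuous dg.
have mg : measurable_fun setT g by exact: continuous_measurable_fun.
have mg' : measurable_fun setT g' by exact: continuous_measurable_fun.
split => //.
have h1 (x : R) : is_derive x 1 (fun x => g (X_aff x)) (g' (X_aff x) * s^-1).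
  by have d1 := dg (X_aff x); have d2 := d_aff x; exact: is_derive1_comp.
have h2 : continuous (fun x => g' (X_aff x) * s^-1).
  move=> x; apply: cvgM; last exact: cvg_cst.
  apply: (@continuous_comp _ _ _ X_aff g'); last exact: cg'.
  exact: is_derive1_continuous d_aff x.
have p1 : pgrowth (fun x => g (X_aff x)) by exact: pgrowth_comp pg pg_aff.
have p2 : pgrowth (fun x => g' (X_aff x) * s^-1).
  by apply: pgrowthM (pgrowth_cst _); exact: pgrowth_comp pg' pg_aff.
have := st _ _ h1 h2 p1 p2.
have ig := integrable_W aX mg pg.
have iXg := integrable_WM aX mg pg.
have i3 := integrable_abWM a b aX mg' pg'.
have XE w : X_aff (W w) = X w by [].
under eq_Rintegral do rewrite XE X_W mulrDl -mulrA.
rewrite RintegralD//; last 2 first.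
- exact: integrableZ_fin.
- exact: integrableZ_fin.
rewrite !RintegralZl// => /addrI.
under [in X in _ = X]eq_Rintegral do rewrite XE.
have E w : W w * (g' (X w) / s) = (n / s) * ((a + b * X w) * g' (X w)).
  rewrite X_W (_ : k%:R + s * X w = n * (a + b * X w)); first by ring.
  rewrite /a /b; apply: (mulfI (lt0r_neq0 s0)).
  have -> : s * (k%:R + s * X w) = s * k%:R + s ^+ 2 * X w by ring.
  by rewrite s2; field; rewrite !gt_eqF.
under [in X in _ = X]eq_Rintegral do rewrite E.
rewrite RintegralZl// => h.
apply: (mulfI (lt0r_neq0 s0)); rewrite h mulrA; congr (_ * _).
apply: (mulfI (lt0r_neq0 s0)); rewrite -expr2 s2; field.
by rewrite gt_eqF.
Qed.

Let pw (i : nat) (x : R) := x ^+ i.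
Let ipw i : P.-integrable setT (EFin \o (fun w => X w ^+ i)).
Proof.
apply: (integrable_W aX (g := fun x => x ^+ i)) => //.
exact: (pgrowthX i pgrowth_id).
Qed.

(** Moment recursion from the test function [x^i]. For [i = 0] the truncated [i.-1] is multiplied by
    0, and the recursion gives the mean. *)
Let st_pow i : \int[P]_w X w ^+ i.+1 = \int[P]_w ((a + b * X w) * (i%:R * X w ^+ i.-1)).
Proof.
have c : continuous (fun x : R => i%:R * x ^+ i.-1).
  by move=> x; apply: cvgM; [exact: cvg_cst|exact: exprn_continuous].
have pg : pgrowth (fun x : R => i%:R * x ^+ i.-1).
  by apply: pgrowthM; [exact: pgrowth_cst|exact: (pgrowthX _ pgrowth_id)].
have dd (x : R) : is_derive x 1 (fun x => x ^+ i) (i%:R * x ^+ i.-1).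
  by have := is_deriveX i (is_derive_id x 1); rewrite /GRing.scale/= mulr1 exprfctE.
have [_ _ _ _ <-] := chi2_std_stein dd c (pgrowthX i pgrowth_id) pg.
by apply: eq_Rintegral => w _; rewrite exprS.
Qed.

Lemma chi2_std_mean : \int[P]_w X w = 0.
Proof.
have := st_pow 0; under eq_Rintegral do rewrite expr1.
by under [in X in _ = X -> _]eq_Rintegral do rewrite mul0r mulr0; rewrite Rintegral_prob_cst.
Qed.

Lemma chi2_std_var : \int[P]_w X w ^+ 2 = a.
Proof.
rewrite (st_pow 1); under eq_Rintegral do rewrite expr0 !mulr1.
have i1 : P.-integrable setT (EFin \o X) by exact: all_moments_Lfun.
rewrite RintegralD//; last 2 first.
- exact: all_moments_Lfun (all_moments_cst _ _).
- exact: integrableZ_fin.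
by rewrite Rintegral_prob_cst RintegralZl// chi2_std_mean mulr0 addr0.
Qed.

Lemma chi2_std_m4 : \int[P]_w X w ^+ 4 = 3 * a ^+ 2 + 6 * a * b ^+ 2.
Proof.
have i1 : P.-integrable setT (EFin \o X) by exact: all_moments_Lfun.
have m3 : \int[P]_w X w ^+ 3 = 2 * a * b.
  rewrite (st_pow 2) (_ : (fun w => _) = (fun w => (2 * a) * X w + (2 * b) * X w ^+ 2)); last first.
    by apply/funext => w; rewrite /= expr1; ring.
  rewrite RintegralD//; [|exact: integrableZ_fin|exact: integrableZ_fin].
  by rewrite !RintegralZl// chi2_std_mean chi2_std_var; ring.
rewrite (st_pow 3) (_ : (fun w => _) = (fun w => (3 * a) * X w ^+ 2 + (3 * b) * X w ^+ 3)); last first.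
  by apply/funext => w /=; ring.
rewrite RintegralD//; [|exact: integrableZ_fin|exact: integrableZ_fin].
by rewrite !RintegralZl// m3 chi2_std_var; ring.
Qed.

Lemma chi2_std_m4_le : \int[P]_w X w ^+ 4 <= 15.
Proof.
have /andP[a0 a1] := a01.
(* With [a <= 1] and [b^2 <= 2] the fourth moment is at most [3 + 6 * 2 = 15]. *)
have bb : b ^+ 2 <= 2 by rewrite b2 ler_pdivrMr// ler_peMr.
have bb0 := sqr_ge0 b.
have aa : a ^+ 2 <= 1 by rewrite expr_le1.
have : a * b ^+ 2 <= 1 * 2 by rewrite ler_pM.
by rewrite chi2_std_m4; lra.
Qed.

End chi2.

(** * The Stein equation behind the Edgeworth term *)

Section edgeworth_functions.
Context {R : realType} (z : R).
Notation phi := (@phi R).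
Notation Phi := (@Phi R).

(** With [f = fz z], the equation [g' - x g = 3 x f' - c] is solved on each side of [z] by
    [x^3 f + q (x^2 - 1)] plus a Mills term, where [q] is [1 - Phi z] on the left and [- Phi z] on
    the right. The Mills term is [- c lmills] on the left and [c rmills] on the right, each of
    moderate growth on its own side. Continuity at [z] then forces this value of [c], which is
    [Phi3 z]. *)
Let c := (z ^+ 2 - 1) * phi z.
Let fl x := (1 - Phi z) * lmills x.
Let fr x := Phi z * rmills x.
Let dfl x := (1 - Phi z) * (1 + x * lmills x).
Let dfr x := Phi z * (x * rmills x - 1).
Let gl x := x ^+ 3 * fl x + (1 - Phi z) * (x ^+ 2 - 1) - c * lmills x.
Let gr x := x ^+ 3 * fr x + c * rmills x - Phi z * (x ^+ 2 - 1).
Let dgl x := 3 * x ^+ 2 * fl x + x ^+ 3 * dfl x + (1 - Phi z) * (2 * x) - c * (1 + x * lmills x).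
Let dgr x := 3 * x ^+ 2 * fr x + x ^+ 3 * dfr x + c * (x * rmills x - 1) - Phi z * (2 * x).

(* Inserting [edge_fun] into an approximate Stein identity identifies the limit of
   [E (X f' X)], [f = fz z], which is the first-order term of the Edgeworth expansion. *)
Definition edge_fun x := if x <= z then gl x else gr x.
Definition edge_dfun x := if x <= z then dgl x else dgr x.

Lemma edge_funE x : edge_dfun x - x * edge_fun x = 3 * (x * dfz z x) - c.
Proof.
rewrite /edge_dfun /edge_fun /dfz /dgl /gl /dgr /gr /fl /fr /dfl /dfr.
by case: ifP => _; ring.
Qed.

Let K := 1 + iphi (`|z| + 1).

Let fz_le x : `|fz z x| <= K.
Proof.
have p0 := Phi_ge0 z; have p1 := Phi_le1 z.
rewrite /fz; case: ifPn => [xz|]; last rewrite -ltNge => /ltW xz.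
  rewrite normrM -[leRHS]mul1r ler_pM ?lmills_bound// ger0_norm; lra.
by rewrite normrM -[leRHS]mul1r ler_pM ?rmills_bound// ger0_norm; lra.
Qed.

(** The exponent 3 fits [stein_error]: multiplied by an affine function of [X] it leads to fourth
    moments, which are bounded uniformly in [k]. *)
Lemma edge_dfun_growth : exists C, 0 <= C /\ forall x, `|edge_dfun x| <= C * (1 + `|x|) ^+ 3.
Proof.
have p0 := Phi_ge0 z; have p1 := Phi_le1 z.
have K0 : 0 <= K by exact: le_trans (fz_le 0).
exists (3 * K + 1 + 2 + `|c| * (1 + K)); split=> [|x].
  by rewrite !addr_ge0// mulr_ge0// addr_ge0.
(* [e] and [q] absorb the difference between the two branches, so that one formula for [edge_dfun]
   can be bounded term by term. *)
pose e := if x <= z then 1 + x * lmills x else - (x * rmills x - 1).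
pose q := (x <= z)%R%:R - Phi z.
have -> : edge_dfun x = 3 * x ^+ 2 * fz z x + x ^+ 3 * dfz z x + q * (2 * x) - c * e.
  by rewrite /edge_dfun /fz /dfz /e /q; case: ifP => _ /=; rewrite /dgl /dgr /fl /fr /dfl /dfr; ring.
have t0 := normr_ge0 x; set t := `|x| in t0 *.
have eK : `|e| <= 1 + t * K.
  rewrite /e; case: ifPn => [xz|]; last rewrite -ltNge => /ltW xz.
    by rewrite (le_trans (ler_normD _ _))// normr1 lerD2l normrM ler_wpM2l// lmills_bound.
  by rewrite normrN (le_trans (ler_normB _ _))// normr1 addrC lerD2l normrM ler_wpM2l// rmills_bound.
have q1 : `|q| <= 1 by rewrite ler_norml /q; case: (x <= z) => /=; apply/andP; split; lra.
have h1 : `|3 * x ^+ 2 * fz z x| <= 3 * t ^+ 2 * K.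
  by rewrite !normrM -expr2 (ger0_norm (ler0n _ 3)) ler_wpM2l ?mulr_ge0 ?exprn_ge0.
have h2 : `|x ^+ 3 * dfz z x| <= t ^+ 3.
  by rewrite normrM normrX ler_piMr ?exprn_ge0// normr_dfz.
have h3 : `|q * (2 * x)| <= 2 * t.
  by rewrite !normrM (ger0_norm (ler0n _ 2)) -[leRHS]mul1r ler_wpM2r// mulr_ge0.
have h4 : `|c * e| <= `|c| * (1 + t * K) by rewrite normrM ler_wpM2l.
apply: le_trans (ler_normB _ _) _.
apply: le_trans (lerD (le_trans (ler_normD _ _) (lerD (le_trans (ler_normD _ _) (lerD h1 h2)) h3)) h4) _.
have u2 : t ^+ 2 <= (1 + t) ^+ 3 by nra.
have u3 : t ^+ 3 <= (1 + t) ^+ 3 by rewrite lerXn2r ?nnegrE//; lra.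
have u1 : t <= (1 + t) ^+ 3 by nra.
have u0 : 1 + t * K <= (1 + K) * (1 + t) ^+ 3.
  have : 1 <= (1 + t) ^+ 3 by nra.
  by nra.
set T3 := (1 + t) ^+ 3 in u0 u1 u2 u3 *.
have v1 : 3 * t ^+ 2 * K <= 3 * K * T3 by nra.
have v2 : `|c| * (1 + t * K) <= `|c| * ((1 + K) * T3) by rewrite ler_wpM2l.
lra.
Qed.

Let D1 (x : R) : is_derive x 1 gl (dgl x).
Proof.
have d1 := is_derive_lmills x; apply: is_derive_eq.
by rewrite /GRing.scale/= /dgl /fl /dfl; ring.
Qed.

Let D2 (x : R) : is_derive x 1 gr (dgr x).
Proof.
have d1 := is_derive_rmills x; apply: is_derive_eq.
by rewrite /GRing.scale/= /dgr /fr /dfr; ring.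
Qed.

Let cl : continuous (@lmills R). Proof. exact: is_derive1_continuous is_derive_lmills. Qed.
Let cr : continuous (@rmills R). Proof. exact: is_derive1_continuous is_derive_rmills. Qed.

Let cxl : continuous (fun x : R => 1 + x * lmills x).
Proof.
move=> x; apply: cvgD; first exact: cvg_cst.
by apply: cvgM; [exact: cvg_id|exact: cl].
Qed.
Let cxr : continuous (fun x : R => x * rmills x - 1).
Proof.
move=> x; apply: cvgB; last exact: cvg_cst.
by apply: cvgM; [exact: cvg_id|exact: cr].
Qed.

Let cM (f g : R -> R) : continuous f -> continuous g -> continuous (fun x => f x * g x).
Proof. by move=> cf cg x; apply: cvgM; [exact: cf|exact: cg]. Qed.
Let cD (f g : R -> R) : continuous f -> continuous g -> continuous (fun x => f x + g x).
Proof. by move=> cf cg x; apply: cvgD; [exact: cf|exact: cg]. Qed.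
Let cB (f g : R -> R) : continuous f -> continuous g -> continuous (fun x => f x - g x).
Proof. by move=> cf cg x; apply: cvgB; [exact: cf|exact: cg]. Qed.
Let cC (e : R) : continuous (fun x : R => e). Proof. by move=> x; exact: cvg_cst. Qed.
Let cX i : continuous (fun x : R => x ^+ i). Proof. exact: exprn_continuous. Qed.
Let cI : continuous (fun x : R => x). Proof. by move=> x; exact: cvg_id. Qed.

Let L := fun x : R => x <= z + 1.
Let Rr := fun x : R => z <= x.

Let gL : growth_on L (@lmills R).
Proof. by apply: growth_on_bounded => x /lmills_bound; exact. Qed.
Let gR : growth_on Rr (@rmills R).
Proof. by apply: growth_on_bounded => x /rmills_bound; exact. Qed.
Let gC (D : pred R) e : growth_on D (fun=> e). Proof. exact/pgrowth_on/pgrowth_cst. Qed.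
Let gX (D : pred R) i : growth_on D (fun x => x ^+ i).
Proof. exact/pgrowth_on/(pgrowthX _ pgrowth_id). Qed.
Let gI (D : pred R) : growth_on D (fun x => x). Proof. exact/pgrowth_on/pgrowth_id. Qed.
Let gN (D : pred R) f : growth_on D f -> growth_on D (fun x => - f x).
Proof.
move=> gf; have := growth_onM (gC D (- 1)) gf.
by congr growth_on; apply/funext => x; rewrite mulN1r.
Qed.

Lemma stein_pair_edge d (T : measurableType d) (P : probability T R) (X : T -> R) (a b : R) :
  all_moments P X ->
  (forall g g' : R -> R, (forall x : R, is_derive x 1 g (g' x)) ->
    continuous g' -> pgrowth g -> pgrowth g' -> stein_pair P X a b g g') ->
  stein_pair P X a b edge_fun edge_dfun.
Proof.
move=> aX st; apply: (stein_pair_glue aX st).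
- exact: D1.
- rewrite /dgl /fl /dfl; repeat first [exact: cxl | exact: cl | exact: cI | exact: cX | exact: cC
    | apply: cB | apply: cD | apply: cM].
- apply: (@growth_onE _ L); rewrite /gl /fl.
  repeat first [exact: gL | exact: gI | exact: gX | exact: gC | apply: gN | apply: growth_onD | apply: growth_onM].
- apply: (@growth_onE _ L); rewrite /dgl /dfl /fl.
  repeat first [exact: gL | exact: gI | exact: gX | exact: gC | apply: gN | apply: growth_onD | apply: growth_onM].
- exact: D2.
- rewrite /dgr /fr /dfr; repeat first [exact: cxr | exact: cr | exact: cI | exact: cX | exact: cC
    | apply: cB | apply: cD | apply: cM].
- apply: (@growth_onE _ Rr); rewrite /gr /fr.
  repeat first [exact: gR | exact: gI | exact: gX | exact: gC | apply: gN | apply: growth_onD | apply: growth_onM].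
- apply: (@growth_onE _ Rr); rewrite /dgr /dfr /fr.
  repeat first [exact: gR | exact: gI | exact: gX | exact: gC | apply: gN | apply: growth_onD | apply: growth_onM].
(* Matching at [z]: [c iphi z = z^2 - 1] while [lmills z + rmills z = iphi z], which balances the
   unit jump of [q]. *)
rewrite /gl /gr /fl /fr /c /lmills /rmills.
have e u : (z ^+ 2 - 1) * phi z * (u * iphi z) = (z ^+ 2 - 1) * u.
  by rewrite mulrACA iphi_phi mulr1.
by rewrite !e; ring.
Qed.

Lemma stein_pair_fz d (T : measurableType d) (P : probability T R) (X : T -> R) (a b : R) :
  all_moments P X ->
  (forall g g' : R -> R, (forall x : R, is_derive x 1 g (g' x)) ->
    continuous g' -> pgrowth g -> pgrowth g' -> stein_pair P X a b g g') ->
  stein_pair P X a b (fz z) (dfz z).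
Proof.
move=> aX st; apply: (stein_pair_glue aX st).
- by move=> x; have d1 := is_derive_lmills x; apply: is_derive_eq; rewrite /GRing.scale/=; ring.
- by apply: cM; [exact: cC|exact: cxl].
- apply: (@growth_onE _ L).
  repeat first [exact: gL | exact: gI | exact: gX | exact: gC | apply: gN | apply: growth_onD | apply: growth_onM].
- apply: (@growth_onE _ L).
  repeat first [exact: gL | exact: gI | exact: gX | exact: gC | apply: gN | apply: growth_onD | apply: growth_onM].
- by move=> x; have d1 := is_derive_rmills x; apply: is_derive_eq; rewrite /GRing.scale/=; ring.
- by apply: cM; [exact: cC|exact: cxr].
- apply: (@growth_onE _ Rr).
  repeat first [exact: gR | exact: gI | exact: gX | exact: gC | apply: gN | apply: growth_onD | apply: growth_onM].
- apply: (@growth_onE _ Rr).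
  repeat first [exact: gR | exact: gI | exact: gX | exact: gC | apply: gN | apply: growth_onD | apply: growth_onM].
by rewrite /lmills /rmills; ring.
Qed.

End edgeworth_functions.

(** * Error bounds from the approximate Stein identity *)

Section stein_estimates.
Context {R : realType} d (T : measurableType d) (P : probability T R).
Variables (W : T -> R) (k : nat).
Hypothesis W_chi2 : chi2_stein P W k.

Let n : R := k.+1%:R.
Let s := Num.sqrt (2 * n).
Let a := k%:R / n.
Let b := 2 / s.
Let X := chi2_std W k.

Let n0 : 0 < n. Proof. by []. Qed.
Let s0 : 0 < s. Proof. by rewrite sqrtr_gt0 mulr_gt0. Qed.
Let s2 : s ^+ 2 = 2 * n. Proof. by rewrite sqr_sqrtr// mulr_ge0// ltW. Qed.
Let b0 : 0 < b. Proof. by rewrite divr_gt0. Qed.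
Let b2 : b ^+ 2 = 2 / n.
Proof. by rewrite /b exprMn exprVn s2; field; rewrite gt_eqF. Qed.
Let n1 : 1 <= n. Proof. by rewrite /n ler1n. Qed.
Let onea : 1 - a = n^-1.
Proof. by rewrite /a /n -natr1; field; rewrite natr1 gt_eqF. Qed.
Let nb : n^-1 <= b.
Proof.
rewrite -(@ler_pXn2r _ 2) ?nnegrE ?invr_ge0 ?(ltW n0) ?(ltW b0)// b2 exprVn.
have i1 : n^-1 <= 1 by rewrite invf_le1.
by rewrite ler_pdivlMr// -exprVn expr2 -mulrA mulVf ?gt_eqF// mulr1 (le_trans i1)// ler1n.
Qed.

Let aX : all_moments P X := chi2_std_all_moments W_chi2.
Let mX : measurable_fun setT X := aX.1.

Lemma stein_residual g g' : stein_pair P X a b g g' ->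
  \int[P]_w (g' (X w) - X w * g (X w)) = \int[P]_w ((1 - (a + b * X w)) * g' (X w)).
Proof.
move=> [mg mg' pg pg' st].
have ig := integrable_WM aX mg pg.
have ig' := integrable_W aX mg' pg'.
have iab := integrable_abWM a b aX mg' pg'.
rewrite RintegralB// st -RintegralB//.
by apply: eq_Rintegral => w _; rewrite mulrBl mul1r.
Qed.

(** As [1 - a = 1 / n <= b], the coefficient [1 - a - b X] is at most [b (1 + |X|)] in absolute
    value. Then [(1 + t)^4 <= 8 (1 + t^4)] and [1 + E X^4 <= 16] give the constant
    [8 * 16 = 128]. *)
Lemma stein_error g g' C : 0 <= C -> stein_pair P X a b g g' ->
  (forall x, `|g' x| <= C * (1 + `|x|) ^+ 3) ->
  `|\int[P]_w (g' (X w) - X w * g (X w))| <= 128 * C * b.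
Proof.
move=> C0 sp gC; rewrite (stein_residual sp).
have [mg mg' pg pg' _] := sp.
have i1 : P.-integrable setT (EFin \o (fun w => (1 - (a + b * X w)) * g' (X w))).
  have := integrableB_fin (integrable_W aX mg' pg') (integrable_abWM a b aX mg' pg').
  by congr (_.-integrable _ _); apply/funext => w /=; rewrite mulrBl mul1r.
have i4 : P.-integrable setT (EFin \o (fun w => X w ^+ 4)).
  by apply: (integrable_W aX (g := fun x => x ^+ 4)) => //; exact: (pgrowthX 4 pgrowth_id).
have ic : P.-integrable setT (EFin \o (fun w => 1 : R)) by exact: finite_measure_integrable_cst.
rewrite (le_trans (le_normr_Rintegral measurableT i1))//.
apply: (@le_trans _ _ (\int[P]_w (8 * C * b * (1 + X w ^+ 4)))).
  apply: le_Rintegral => //; first exact: integrable_abse i1.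
    by apply: integrableZ_fin; exact: (integrableD_fin ic i4).
  move=> w _; rewrite normrM.
  have t0 := normr_ge0 (X w); set t := `|X w| in t0 *.
  have h1 : `|1 - (a + b * X w)| <= b * (1 + t).
    rewrite opprD addrA onea (le_trans (ler_normB _ _))// mulrDr mulr1 lerD//.
      by rewrite gtr0_norm// invr_gt0.
    by rewrite normrM gtr0_norm.
  apply: (@le_trans _ _ (b * (1 + t) * (C * (1 + t) ^+ 3))).
    by apply: ler_pM => //; exact: gC.
  rewrite (_ : b * (1 + t) * (C * (1 + t) ^+ 3) = C * b * (1 + t) ^+ 4); last by ring.
  rewrite (_ : X w ^+ 4 = t ^+ 4); last first.
    by rewrite -[4%N]/(2 * 2)%N !exprM real_normK ?num_real.
  rewrite (_ : 8 * C * b * (1 + t ^+ 4) = C * b * (8 * (1 + t ^+ 4))); last by ring.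
  apply: ler_wpM2l; first by apply: mulr_ge0 => //; exact: ltW b0.
  have q1 : (1 + t) ^+ 2 <= 2 * (1 + t ^+ 2) by have := sqr_ge0 (1 - t); nra.
  have q2 : (1 + t ^+ 2) ^+ 2 <= 2 * (1 + t ^+ 4).
    by have := sqr_ge0 (1 - t ^+ 2); rewrite (_ : t ^+ 4 = t ^+ 2 ^+ 2) -?exprM//; nra.
  have q3 : (1 + t) ^+ 4 = (1 + t) ^+ 2 ^+ 2 by rewrite -exprM.
  have q4 : (1 + t) ^+ 2 ^+ 2 <= (2 * (1 + t ^+ 2)) ^+ 2.
    by rewrite lerXn2r ?nnegrE ?sqr_ge0// mulr_ge0// addr_ge0// sqr_ge0.
  rewrite q3 (le_trans q4)// exprMn; lra.
rewrite RintegralZl//; last exact: (integrableD_fin ic i4).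
rewrite RintegralD// Rintegral_prob_cst.
have m4 := chi2_std_m4_le W_chi2.
rewrite (_ : 128 * C * b = 8 * C * b * 16); last by ring.
apply: ler_wpM2l; first by apply: mulr_ge0; [exact: mulr_ge0|exact: ltW b0].
by rewrite -/X in m4 *; lra.
Qed.

Let mA z : measurable [set w | X w <= z].
Proof.
have := mX measurableT (measurable_itv `]-oo, z]); rewrite setTI.
by congr measurable; apply/seteqP; split => w /=; rewrite in_itv.
Qed.

Let indE z w : (X w <= z)%R%:R = \1_[set w | X w <= z] w :> R.
Proof.
rewrite indicE; have -> // : (w \in [set w | X w <= z]) = (X w <= z).
by apply/idP/idP; rewrite inE.
Qed.

Lemma prob_leE z : prob_le P X z = \int[P]_w ((X w <= z)%R%:R : R).
Proof.
rewrite /prob_le /Rintegral; congr fine.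
by under eq_integral do rewrite indE; rewrite integral_indic// setIT.
Qed.

Let iind z : P.-integrable setT (EFin \o (fun w => (X w <= z)%R%:R : R)).
Proof.
apply: (@integrable_bounded _ _ _ _ _ 1) => [|w]; last by case: (X w <= z); rewrite ?normr1 ?normr0.
by under eq_fun do rewrite indE; exact: measurable_indic.
Qed.

Lemma prob_le_residual z :
  prob_le P X z - Phi z = \int[P]_w ((1 - (a + b * X w)) * dfz z (X w)).
Proof.
have sp : stein_pair P X a b (fz z) (dfz z) by apply: stein_pair_fz => //; exact: chi2_std_stein.
rewrite -(stein_residual sp).
rewrite prob_leE -[X in _ - X = _](Rintegral_prob_cst P) -RintegralB//.
  by apply: eq_Rintegral => w _; rewrite dfzE.
exact: finite_measure_integrable_cst.
Qed.

Lemma chi2_kolmogorov z :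
  `|prob_le P X z - Phi z| <= Num.sqrt (2 * n - 1) / n.
Proof.
rewrite prob_le_residual.
pose Y w := 1 - (a + b * X w).
have iX : P.-integrable setT (EFin \o X) by exact: all_moments_Lfun.
have i1 : P.-integrable setT (EFin \o cst (1 : R)) by exact: finite_measure_integrable_cst.
have iX2 : P.-integrable setT (EFin \o (fun w => X w ^+ 2)).
  by apply: (integrable_W aX (g := fun x => x ^+ 2)) => //; exact: (pgrowthX 2 pgrowth_id).
have YE w : Y w = n^-1 - b * X w by rewrite /Y opprD addrA onea.
have aY : all_moments P Y.
  apply: (all_moments_comp aX (f := fun x => 1 - (a + b * x))).
    by apply: measurable_funB => //; apply: measurable_funD => //; exact: measurable_funM.
  apply: pgrowthB; first exact: pgrowth_cst.
  apply: pgrowthD; first exact: pgrowth_cst.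
  by apply: pgrowthM; [exact: pgrowth_cst|exact: pgrowth_id].
have iY : P.-integrable setT (EFin \o Y) by exact: all_moments_Lfun.
have iY2 : P.-integrable setT (EFin \o (fun w => Y w ^+ 2)).
  by apply: (integrable_W aY (g := fun x => x ^+ 2)) => //; exact: (pgrowthX 2 pgrowth_id).
have mdfz : measurable_fun setT (dfz (z : R)).
  by have [] := stein_pair_fz z aX (chi2_std_stein W_chi2).
have iYd : P.-integrable setT (EFin \o (fun w => Y w * dfz z (X w))).
  apply: (@integrable_dom _ _ _ _ _ (fun w => `|Y w|)).
  - by apply: measurable_funM; [exact: aY.1|exact: measurableT_comp mX].
  - by move=> w; rewrite normrM ler_piMr// normr_dfz.
  - exact: integrable_abse iY.
(* Mean 0 and variance [a] of [X] leave [1 / n^2 + b^2 a = 1 / n^2 + 2 (n - 1) / n^2]. *)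
have EY2 : \int[P]_w Y w ^+ 2 = (2 * n - 1) / n ^+ 2.
  rewrite (_ : (fun w => _) = (fun w => n^-1 ^+ 2 * cst 1 w + ((- 2 * n^-1 * b) * X w + b ^+ 2 * X w ^+ 2))); last first.
    by apply/funext => w; rewrite YE /cst; ring.
  rewrite !RintegralD//; try exact: integrableZ_fin.
    rewrite !RintegralZl// Rintegral_prob_cst (chi2_std_mean W_chi2) (chi2_std_var W_chi2).
    rewrite b2 -/n (_ : k%:R = n - 1); last by rewrite /n -natr1 addrK.
    by field; rewrite gt_eqF.
  by apply: integrableD_fin; exact: integrableZ_fin.
have d0' (m : R) : 1 <= m -> 0 < 2 * m - 1 by move=> ?; lra.
have d0 := d0' n n1.
set c := Num.sqrt (2 * n - 1) / n.
have c0 : 0 < c by rewrite divr_gt0// sqrtr_gt0.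
have c2 : c ^+ 2 = \int[P]_w Y w ^+ 2.
  by rewrite EY2 exprMn exprVn sqr_sqrtr// ltW.
rewrite (le_trans (le_normr_Rintegral measurableT iYd))//.
(* Cauchy-Schwarz in the form [|Y| <= (Y^2 + c^2) / (2 c)], integrated with [c^2 = E Y^2]. *)
apply: (@le_trans _ _ (\int[P]_w ((2 * c)^-1 * (Y w ^+ 2 + cst (c ^+ 2) w)))).
  apply: le_Rintegral => //; first exact: integrable_abse iYd.
    apply: integrableZ_fin; apply: integrableD_fin => //.
    exact: finite_measure_integrable_cst.
  move=> w _; rewrite normrM (@le_trans _ _ `|Y w|) ?ler_piMr ?normr_dfz// /cst.
  have c20 : 0 < 2 * c by apply: mulr_gt0.
  rewrite -[leRHS]mulrC ler_pdivlMr//.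
  by have := sqr_ge0 (`|Y w| - c); rewrite -(real_normK (num_real (Y w))); nra.
rewrite RintegralZl//; last first.
  by apply: integrableD_fin => //; exact: finite_measure_integrable_cst.
rewrite RintegralD//; last exact: finite_measure_integrable_cst.
rewrite Rintegral_prob_cst -c2 le_eqVlt; apply/orP; left; apply/eqP.
by field; rewrite gt_eqF.
Qed.

End stein_estimates.

(** * Asymptotics for growing degrees of freedom *)

Section limits.
Context {R : realType} d (T : measurableType d) (P : probability T R).

Let b (k : nat) : R := 2 / Num.sqrt (2 * k.+1%:R).

Let kS k : k.+1%:R = k%:R + 1 :> R. Proof. by rewrite natr1. Qed.

Let b0 k : 0 < b k. Proof. by rewrite divr_gt0// sqrtr_gt0 mulr_gt0. Qed.

(** By [edge_funE], [stein_error] for the pair of [edge_fun] bounds [3 E (X f' X) - Phi3 z]. The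
    constant depends on [z] alone, since the growth bound of [edge_dfun] does not involve [W] or
    [k]. *)
Lemma chi2_edgeworth z : exists C : R, forall (W : T -> R) k, chi2_stein P W k ->
  `|\int[P]_w (chi2_std W k w * dfz z (chi2_std W k w)) - Phi3 z / 3| <= C * b k.
Proof.
have [C [C0 gC]] := edge_dfun_growth z.
exists (128 * C / 3) => W k WC.
have aX := chi2_std_all_moments WC.
have sp := stein_pair_edge z aX (chi2_std_stein WC).
have spf := stein_pair_fz z aX (chi2_std_stein WC).
have := stein_error WC C0 sp gC.
have [_ mdf _ pdf _] := spf.
have i1 := integrable_WM aX mdf pdf.
under eq_Rintegral do rewrite edge_funE.
rewrite RintegralB//; last 2 first.
- exact: integrableZ_fin.
- exact: finite_measure_integrable_cst.
rewrite Rintegral_prob_cst RintegralZl// -/(Phi3 z).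
set A := \int[P]_w _ => h.
rewrite (_ : A - Phi3 z / 3 = (3 * A - Phi3 z) / 3); last by field.
rewrite normrM [X in _ * X]gtr0_norm ?invr_gt0// ler_pdivrMr//.
by apply: (le_trans h); rewrite le_eqVlt; apply/orP; left; apply/eqP; rewrite /b; field; rewrite gt_eqF// sqrtr_gt0 mulr_gt0.
Qed.

(** The shifted variable is [Q_n], whose mean is [- 1 / sqrt (2 n)]. Translating the Stein solution
    by the same amount moves the shift into one extra term, [s^-1 * E g]. *)
Lemma chi2_clt (h : R -> R) M : continuous h -> (forall x, `|h x| <= M) ->
  exists C : R, forall (W : T -> R) k, chi2_stein P W k ->
  `|\int[P]_w h (chi2_std W k w - (Num.sqrt (2 * k.+1%:R))^-1) - \int[stdN]_x h x| <= C * b k.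
Proof.
move=> ch hM.
have mh : measurable_fun setT h by exact: continuous_measurable_fun.
have ih : stdN.-integrable setT (EFin \o h) by exact: (@integrable_bounded _ _ _ stdN _ M).
set c := \int[stdN]_x h x.
pose h0 x := h x - c.
have ch0 : continuous h0 by move=> x; apply: cvgB; [exact: ch|exact: cvg_cst].
have hM0 x : `|h0 x| <= M + `|c| by rewrite (le_trans (ler_normB _ _))// lerD2r.
have c0 : \int[stdN]_x h0 x = 0.
  rewrite RintegralB//; first by rewrite Rintegral_prob_cst subrr.
  exact: finite_measure_integrable_cst.
have [f [K [df fK]]] := stein_solution ch0 hM0 c0.
have K0 : 0 <= K by exact: le_trans (fK 0).
have M0 : 0 <= M + `|c| by exact: le_trans (hM0 0).
pose D := 2 * K + (M + `|c|).
have D0 : 0 <= D by rewrite addr_ge0// mulr_ge0.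
(* [128 * D] comes from [stein_error]; [K] bounds the term due to the shift, as [s^-1 <= b k]. *)
exists (128 * D + K) => W k WC.
set s := Num.sqrt _.
have s0 : 0 < s by rewrite sqrtr_gt0 mulr_gt0.
have s1 : 1 <= s.
  rewrite -sqrtr1 ler_wsqrtr// (@le_trans _ _ 2)// ?ler1n//.
  by rewrite ler_peMr// ler1n.
have si : s^-1 <= 1 by rewrite invf_le1.
have si0 : 0 < s^-1 by rewrite invr_gt0.
set X := chi2_std W k.
have aX : all_moments P X by exact: chi2_std_all_moments.
pose g x := f (x - s^-1).
pose g' x := (x - s^-1) * f (x - s^-1) + h0 (x - s^-1).
have csub : continuous (fun x : R => x - s^-1).
  by move=> x; apply: cvgB; [exact: cvg_id|exact: cvg_cst].
have cf : continuous f by exact: is_derive1_continuous df.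
have ccomp (q : R -> R) : continuous q -> continuous (fun x : R => q (x - s^-1)).
  by move=> cq x; apply: (@continuous_comp _ _ _ (fun x : R => x - s^-1) q); [exact: csub|exact: cq].
have dg (x : R) : is_derive x 1 g (g' x).
  have d1 := df (x - s^-1).
  have d2 : is_derive x 1 (fun x : R => x - s^-1) 1.
    by apply: is_derive_eq; rewrite ?oppr0 ?addr0.
  by have := @is_derive1_comp _ f (fun x : R => x - s^-1) x _ _ d1 d2; rewrite mulr1.
have cg' : continuous g'.
  move=> x; apply: cvgD; last exact: ccomp.
  by apply: cvgM; [exact: csub|exact: ccomp].
have gK x : `|g x| <= K by exact: fK.
have g'D x : `|g' x| <= D * (1 + `|x|) ^+ 3.
  rewrite /g' (le_trans (ler_normD _ _))// normrM.
  have t0 := normr_ge0 x; set t := `|x| in t0 *.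
  have h1 : `|x - s^-1| <= t + 1 by rewrite (le_trans (ler_normB _ _))// lerD2l gtr0_norm.
  have h2 : `|x - s^-1| * `|f (x - s^-1)| <= (t + 1) * K by rewrite ler_pM.
  have h3 := hM0 (x - s^-1).
  have t1 : 1 + t <= (1 + t) ^+ 3 by nra.
  have t2 : 1 <= (1 + t) ^+ 3 by nra.
  rewrite /D; set t3 := (1 + t) ^+ 3 in t1 t2 *.
  have : (t + 1) * K <= K * t3 by rewrite mulrC ler_wpM2l// addrC.
  have : (M + `|c|) <= (M + `|c|) * t3 by rewrite ler_peMr.
  have : 0 <= K * t3 by rewrite mulr_ge0// (le_trans _ t2).
  by nra.
have pg : pgrowth g by apply: bounded_pgrowth gK.
have pg' : pgrowth g' by exists D, 3%N.
have sp := chi2_std_stein WC dg cg' pg pg'.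
have [mg mg' _ _ _] := sp.
have ig := integrable_W aX mg pg.
have ig' := integrable_W aX mg' pg'.
have iXg := integrable_WM aX mg pg.
have err := stein_error WC D0 sp g'D.
have mhs : measurable_fun setT (fun x : R => h (x - s^-1)) by apply: continuous_measurable_fun; exact: ccomp.
have ihX : P.-integrable setT (EFin \o (fun w => h (X w - s^-1))).
  exact: (integrable_W aX mhs (bounded_pgrowth (fun x => hM _))).
have E : \int[P]_w h (X w - s^-1) - c =
   \int[P]_w (g' (X w) - X w * g (X w)) + s^-1 * \int[P]_w g (X w).
  rewrite -[X in _ - X](Rintegral_prob_cst P) -RintegralB//; last exact: finite_measure_integrable_cst.
  rewrite -RintegralZl// -RintegralD//; last 2 first.
  - exact: integrableB_fin.
  - exact: integrableZ_fin.
  by apply: eq_Rintegral => w _; rewrite /g' /g /h0; ring.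
rewrite E (le_trans (ler_normD _ _))// mulrDl lerD//.
rewrite normrM gtr0_norm// /b -/s mulrC.
apply: ler_pM => //; [exact: ltW| |].
  apply: (@normr_Rintegral_le _ _ _ P (fun w => g (X w))) => [|w]; last exact: gK.
  exact: measurableT_comp mg aX.1.
by rewrite -[leLHS]mul1r ler_wpM2r ?(ltW si0)// ler1n.
Qed.

Lemma cvg_b : b k @[k --> \oo] --> (0 : R).
Proof.
have h1 : (2 * k.+1%:R^-1) @[k --> \oo] --> (0 : R).
  rewrite -(mulr0 (2 : R)); apply: cvgM; first exact: cvg_cst.
  exact: cvg_harmonic.
have h2 : Num.sqrt (2 * k.+1%:R^-1) @[k --> \oo] --> (0 : R).
  rewrite -[X in _ --> X]sqrtr0; apply: continuous_cvg h1; exact: sqrt_continuous.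
apply: cvg_trans h2; apply: near_eq_cvg; apply: nearW => k.
have k0 : 0 < 2 * k.+1%:R :> R by rewrite mulr_gt0.
apply/eqP; rewrite -(@eqrXn2 _ 2)// ?sqrtr_ge0 ?(ltW (b0 k))//.
rewrite /b exprMn exprVn !sqr_sqrtr ?(ltW k0)// ?mulr_ge0 ?invr_ge0//.
by apply/eqP; field; rewrite gt_eqF.
Qed.

Variable W : nat -> T -> R.
Hypothesis W_chi2 : forall k, chi2_stein P (W k) k.

Lemma cvg_of_bound (u : nat -> R) l C : (forall k, `|u k - l| <= C * b k) ->
  u k @[k --> \oo] --> l.
Proof.
move=> h; apply/subr_cvg0; apply/norm_cvg0P.
apply: (@squeeze_cvgr _ _ _ _ (fun=> 0) (fun k => C * b k)).
- by apply: nearW => k; rewrite normr_ge0 h.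
- exact: cvg_cst.
- by rewrite -(mulr0 C); apply: cvgM; [exact: cvg_cst|exact: cvg_b].
Qed.

Lemma chi2_edgeworth_cvg z :
  (fun k : nat => k.+1%:R / Num.sqrt (2 * k.+1%:R - 1)
     * (prob_le P (chi2_std (W k) k) z - Phi z)) @ \oo --> - (Phi3 z / 3).
Proof.
have [C hC] := chi2_edgeworth z.
pose A k := \int[P]_w (chi2_std (W k) k w * dfz z (chi2_std (W k) k w)).
have cA : A k @[k --> \oo] --> Phi3 z / 3.
  by apply: (@cvg_of_bound _ _ C) => k; exact: hC.
pose D k := \int[P]_w dfz z (chi2_std (W k) k w).
(* The residual coefficient is [1 / n - b X]. Its first part is of lower order because [dfz] is
   bounded; the second carries the limit. *)
have resid k : prob_le P (chi2_std (W k) k) z - Phi z = k.+1%:R^-1 * D k - b k * A k.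
  rewrite (prob_le_residual (W_chi2 k)).
  have aX := chi2_std_all_moments (W_chi2 k).
  have [_ mdf _ pdf _] := stein_pair_fz z aX (chi2_std_stein (W_chi2 k)).
  have i1 := integrable_WM aX mdf pdf; have i2 := integrable_W aX mdf pdf.
  rewrite -!RintegralZl// -RintegralB//; [|exact: integrableZ_fin..].
  have kE : k.+1%:R = k%:R + 1 :> R by rewrite natr1.
  apply: eq_Rintegral => w _; rewrite /b kE.
  have k1 : k%:R + 1 != 0 :> R by rewrite natr1.
  have s0 : Num.sqrt (2 * (k%:R + 1)) != 0 :> R by rewrite gt_eqF// sqrtr_gt0 natr1 mulr_gt0.
  by field; rewrite k1 s0.
have D1 k : `|D k| <= 1.
  have aX := chi2_std_all_moments (W_chi2 k).
  have [_ mdf _ _ _] := stein_pair_fz z aX (chi2_std_stein (W_chi2 k)).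
  apply: (@normr_Rintegral_le _ _ _ P (fun w => dfz z (chi2_std (W k) k w))) => [|w].
    exact: measurableT_comp mdf aX.1.
  exact: normr_dfz.
pose r k : R := Num.sqrt (2 * k.+1%:R - 1).
have r1 k : 1 <= r k.
  rewrite -[leLHS]sqrtr1 ler_wsqrtr// (kS k); have : 0 <= k%:R :> R by []. move: (k%:R) => x x0; lra.
have r0 k : 0 < r k by exact: lt_le_trans (r1 k).
pose q k : R := k.+1%:R * b k / r k.
have e k : k.+1%:R / Num.sqrt (2 * k.+1%:R - 1) * (prob_le P (chi2_std (W k) k) z - Phi z) =
   D k / r k - q k * A k.
  rewrite resid /q -/(r k); have k1 : k.+1%:R != 0 :> R by [].
  by field; rewrite gt_eqF//= k1.
have rk k : (r k)^-1 <= b k.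
  rewrite /b ler_pdivlMr ?sqrtr_gt0 ?mulr_gt0// ler_pdivrMl//.
  rewrite -(@ler_pXn2r _ 2) ?nnegrE ?mulr_ge0 ?(ltW (r0 k))//.
  have k0 : 0 <= k%:R :> R by [].
  rewrite exprMn !sqr_sqrtr (kS k); move: (k%:R) k0 => x x0; lra.
have c1 : (D k / r k) @[k --> \oo] --> (0 : R).
  apply: (@cvg_of_bound _ _ 1) => k; rewrite subr0 mul1r normrM.
  rewrite -[leRHS]mul1r ler_pM// gtr0_norm ?invr_gt0//.
(* As [n b = s] with [s = sqrt (2 n)] and [r = sqrt (2 n - 1)], [q] is [s / r]; from
   [(s - r) (s + r) = 1] one gets [0 <= q - 1 <= 1 / r]. *)
have c2 : q k @[k --> \oo] --> (1 : R).
  apply: (@cvg_of_bound _ _ 1) => k; rewrite mul1r.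
  pose s : R := Num.sqrt (2 * k.+1%:R).
  have k0 : 0 <= k%:R :> R by [].
  have s2 : s ^+ 2 = 2 * k.+1%:R by rewrite sqr_sqrtr// mulr_ge0.
  have r2 : r k ^+ 2 = 2 * k.+1%:R - 1.
    by rewrite sqr_sqrtr// (kS k); move: (k%:R) k0 => x x0; lra.
  have s0 : 0 < s by rewrite sqrtr_gt0 mulr_gt0.
  have sr : (s - r k) * (s + r k) = 1.
    by rewrite -subr_sqr s2 r2 opprB addrCA subrr addr0.
  have rk1 := r1 k; have rs : 0 <= s - r k <= 1 by apply/andP; split; nra.
  have nb : k.+1%:R * b k = s.
    apply: (mulIf (lt0r_neq0 s0)); rewrite -expr2 s2 /b -/s -mulrA divfK ?gt_eqF//.
    by rewrite mulrC.
  rewrite /q nb (_ : s / r k - 1 = (s - r k) / r k); last by field; rewrite gt_eqF.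
  case/andP: rs => rs0 rs1.
  rewrite ger0_norm ?divr_ge0 ?(ltW (r0 k))//.
  by rewrite (le_trans _ (rk k))// -[leRHS]mul1r ler_wpM2r// invr_ge0 ltW.
rewrite (funext e) -[X in _ --> X]add0r -[X in _ --> _ - X]mul1r.
by apply: cvgB => //; exact: cvgM.
Qed.

End limits.

(** * The Gaussian model *)

Section centered_gaussian.
Context {R : realType} d (T : measurableType d) (P : probability T R).

Lemma fine_expectation (X : T -> R) : fine ('E_P[X])%E = \int[P]_w X w.
Proof. by rewrite unlock. Qed.

Variables (X : T -> R) (v : R).
Hypothesis mX : measurable_fun setT X.
Hypothesis v0 : 0 <= v.
Hypothesis lawX : forall A : set R, measurable A -> P (X @^-1` A) = centered_normal_law v A.

(** [X] is distributed as [sqrt v] times a standard normal variable. For [v = 0] the law is the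
    point mass at 0 and the formula still holds, which spares later proofs the distinction. *)
Lemma ge0_integral_gaussian (f : R -> R) : continuous f -> (forall x, 0 <= f x) ->
  (\int[P]_w (f (X w))%:E = \int[stdN]_x (f (Num.sqrt v * x))%:E)%E.
Proof.
move=> cf f0.
have mf : measurable_fun setT (EFin \o f) by apply/measurable_EFinP; exact: continuous_measurable_fun.
have f0E x : (0 <= (EFin \o f) x)%E by rewrite lee_fin.
have [v1|v1] := ltrP 0 v.
  pose Q : probability R R := distribution (normal_prob (0 : R) (Num.sqrt v)) (@Rid R).
  have lawQ A : measurable A -> P (X @^-1` A) = Q A.
    by move=> mA; rewrite lawX// /centered_normal_law v1.
  rewrite (law_integral mX lawQ mf f0E) ge0_integral_distribution//.
  rewrite ge0_integral_normal_prob//=.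
  under eq_integral do rewrite -EFinM.
  rewrite ge0_integral_normal_scale ?sqrtr_gt0//.
  by apply: eq_integral => x _; rewrite add0r.
have -> : v = 0 by apply/eqP; rewrite eq_le v1.
have lawQ A : measurable A -> P (X @^-1` A) = \d_(0 : R) A.
  move=> mA; rewrite lawX// /centered_normal_law ltNge v1/=.
  by [].
rewrite (law_integral mX lawQ mf f0E) integral_dirac// diracT mul1e.
under eq_integral do rewrite sqrtr0 mul0r.
by rewrite integral_cst//= probability_setT mule1.
Qed.

Lemma gaussian_all_moments : all_moments P X.
Proof.
split => // p.
have cf : continuous (fun x : R => (1 + `|x|) ^+ p).
  move=> x; apply: (@continuous_comp _ _ _ (fun x : R => 1 + `|x|) (fun y => y ^+ p)); last exact: exprn_continuous.
  by apply: cvgD; [exact: cvg_cst|exact: norm_continuous].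
have f0 (x : R) : 0 <= (1 + `|x|) ^+ p by rewrite exprn_ge0 ?addr_ge0.
apply/integrableP; split.
  by apply/measurable_EFinP; apply: (measurableT_comp (f := fun x : R => (1 + `|x|) ^+ p)) => //; exact: continuous_measurable_fun.
under eq_integral do rewrite /= ger0_norm//.
rewrite (ge0_integral_gaussian cf f0).
have : stdN.-integrable setT (EFin \o (fun x => (1 + `|Num.sqrt v * x|) ^+ p)).
  apply: integrable_pgrowth.
    apply: (measurableT_comp (f := fun x : R => (1 + `|x|) ^+ p)); first exact: continuous_measurable_fun.
    exact: measurable_funM.
  apply: pgrowthX; apply: pgrowthD; first exact: pgrowth_cst.
  apply: (@le_pgrowth _ _ (fun x => Num.sqrt v * x)); first by move=> x; rewrite normr_id.
  by apply: pgrowthM; [exact: pgrowth_cst|exact: pgrowth_id].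
move=> /integrableP[_]; under eq_integral do rewrite /= ger0_norm//.
by [].
Qed.

Lemma gaussian_var : \int[P]_w X w ^+ 2 = v.
Proof.
rewrite /Rintegral (ge0_integral_gaussian (f := fun x : R => x ^+ 2))//; last 2 first.
- exact: exprn_continuous.
- by move=> x; exact: sqr_ge0.
transitivity (\int[stdN]_x (v * x ^+ 2)).
  by congr fine; apply: eq_integral => x _; rewrite exprMn sqr_sqrtr.
rewrite RintegralZl ?stdN_var ?mulr1//.
by apply: integrable_pgrowth => //; exact: (pgrowthX 2 pgrowth_id).
Qed.

Lemma gaussian_char th : \int[P]_w cos (X w + th) = expR (- v / 2) * cos th.
Proof.
have cc : continuous (fun x : R => cos (x + th)).
  move=> x; apply: (@continuous_comp _ _ _ (fun x => x + th) (@cos R)); last exact: continuous_cos.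
  by apply: cvgD; [exact: cvg_id|exact: cvg_cst].
have mc : measurable_fun setT (fun w => cos (X w + th)).
  by apply: (measurableT_comp (f := fun x : R => cos (x + th))) => //; exact: continuous_measurable_fun.
have i1 : P.-integrable setT (EFin \o (fun w => cos (X w + th))).
  by apply: (@integrable_bounded _ _ _ _ _ 1) => // w; exact: normr_cos_le1.
have ic : P.-integrable setT (EFin \o (fun w => 1 : R)) by exact: finite_measure_integrable_cst.
have i2 : stdN.-integrable setT (EFin \o (fun x => cos (Num.sqrt v * x + th))).
  apply: (@integrable_bounded _ _ _ _ _ 1) => [|x]; last exact: normr_cos_le1.
  exact: measurable_cos_affine.
have ic2 : stdN.-integrable setT (EFin \o (fun x => 1 : R)) by exact: finite_measure_integrable_cst.
(* Adding 1 makes the cosine nonnegative, as [ge0_integral_gaussian] requires. *)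
have E : \int[P]_w (cos (X w + th) + 1) = \int[stdN]_x (cos (Num.sqrt v * x + th) + 1).
  rewrite /Rintegral (ge0_integral_gaussian (f := fun x : R => cos (x + th) + 1)); last 2 first.
  - by move=> x; apply: cvgD; [exact: cc|exact: cvg_cst].
  - by move=> x; have := cos_geN1 (x + th); lra.
  by [].
rewrite !RintegralD// !Rintegral_prob_cst in E.
by rewrite (addIr _ E) stdN_char sqr_sqrtr.
Qed.

Lemma gaussian_law1 : v = 1 -> forall A : set R, measurable A -> P (X @^-1` A) = stdN A.
Proof. by move=> v1 A mA; rewrite lawX// /centered_normal_law v1 ltr01 sqrtr1 stdNE. Qed.

End centered_gaussian.

(** * Orthonormal bases for the covariance form *)

Section orthonormal_extension.
Context {R : realType} (n : nat).
Variable V : 'M[R]_n.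
Hypothesis V_sym : V^T = V.
Hypothesis V_pos : pos_def V.

Let B (u v : 'cV[R]_n) : R := bform u V v.

Lemma bform_sym u v : B u v = B v u.
Proof.
rewrite /B /bform -[in LHS](trmxK (u^T *m V *m v)) mxE.
by rewrite !trmx_mul trmxK V_sym mulmxA.
Qed.

Lemma bform_linear_l (M : 'M[R]_n) a u v c : bform (a *: u + v) M c = a * bform u M c + bform v M c.
Proof. by rewrite /bform linearD linearZ/= !mulmxDl -!scalemxAl !mxE. Qed.

Lemma pos_def_unitmx : V \in unitmx.
Proof.
rewrite -row_free_unit -kermx_eq0; apply/eqP/row_matrixP => i; rewrite row0.
apply/eqP; apply/negPn/negP => r0.
have : 0 < bform (row i (kermx V))^T V (row i (kermx V))^T.
  apply: V_pos; apply: contra r0 => /eqP h.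
  by rewrite -[row _ _]trmxK h trmx0.
rewrite /bform trmxK -row_mul mulmx_ker row0 mul0mx mxE.
by rewrite ltxx.
Qed.

Lemma invmx_sym : (invmx V)^T = invmx V.
Proof. by rewrite trmx_inv V_sym. Qed.

(** Fewer than [n] linear equations [B e x = 0] have a nonzero solution, which positive definiteness
    allows to normalize. It is inserted behind [a0], which has to remain the distinguished first
    vector. *)
Lemma orthonormal_extend a0 (s : seq 'cV[R]_n) : orthonormal_seq B (a0 :: s) ->
  ((size s).+1 < n)%N -> exists e, orthonormal_seq B (a0 :: e :: s).
Proof.
move=> os sn; set S := a0 :: s.
pose A : 'M[R]_((size s).+1, n) := \matrix_(i < (size s).+1) (nth 0 S i)^T.
have [x [x0 xA]] : exists x : 'cV[R]_n, x != 0 /\ A *m V *m x = 0.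
  have : kermx (A *m V)^T != 0.
    rewrite -mxrank_eq0 mxrank_ker -lt0n subn_gt0.
    by apply: leq_ltn_trans sn; exact: rank_leq_col.
  move=> /rowV0Pn[u /sub_kermxP uA u0].
  exists u^T; split; first by apply: contra u0 => /eqP h; rewrite -[u]trmxK h trmx0.
  by rewrite -[LHS]trmxK trmx_mul trmxK uA trmx0.
have Bx e : e \in S -> B e x = 0.
  move=> eS; have i : (index e S < (size s).+1)%N by rewrite -index_mem in eS.
  have := congr1 (fun M : 'cV[R]_((size s).+1) => M (Ordinal i) 0) xA.
  rewrite [RHS]mxE => <-; rewrite /B /bform.
  rewrite -[RHS]/((A *m V *m x) (Ordinal i) 0).
  have rA : row (Ordinal i) A = e^T by rewrite rowK nth_index.
  transitivity ((row (Ordinal i) (A *m V *m x)) 0 0); last by rewrite mxE.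
  by rewrite !row_mul rA.
have Bxx : 0 < B x x by exact: V_pos.
pose c := (Num.sqrt (B x x))^-1.
have BZl a u v : B (a *: u) v = a * B u v.
  by rewrite /B /bform linearZ/= -!scalemxAl mxE.
exists (c *: x).
have Be e : e \in S -> B e (c *: x) = 0.
  by move=> eS; rewrite bform_sym BZl bform_sym Bx// mulr0.
have Bee : B (c *: x) (c *: x) = 1.
  rewrite BZl bform_sym BZl mulrA -expr2 /c exprVn sqr_sqrtr ?(ltW Bxx)//.
  by rewrite mulVf// gt_eqF.
have nS : c *: x \notin S.
  by apply/negP => eS; have := Be _ eS; rewrite Bee => /eqP; rewrite oner_eq0.
apply: (orthonormal_perm (s := (c *: x) :: S)).
  exact: (permEl (perm_catCA [:: c *: x] [:: a0] s)).
case: os => us os; split; first by apply/andP; split.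
move=> e e'; rewrite !inE => /predU1P[->|eS] /predU1P[->|e'S].
- by rewrite eqxx Bee.
- by rewrite bform_sym Be//; case: eqP => // h; move: nS; rewrite h /S inE e'S.
- by rewrite Be//; case: eqP => // h; move: nS; rewrite -h /S inE eS.
- exact: os.
Qed.

Lemma orthonormal_completion a0 : B a0 a0 = 1 ->
  exists s, orthonormal_seq B (a0 :: s) /\ (size s).+1 = n.
Proof.
move=> B1.
have n0 : (0 < n)%N.
  move: V V_sym V_pos @B a0 B1; case: n => // V' _ _ B' a0.
  by rewrite /B' /bform mxE big_ord0 => /esym/eqP; rewrite oner_eq0.
suff H m : (m < n)%N -> exists s, orthonormal_seq B (a0 :: s) /\ size s = m.
  have [|s [os sz]] := H n.-1; first by rewrite prednK.
  by exists s; rewrite sz prednK.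
elim: m => [|m IH] mn.
  exists [::]; split => //; split => // e e'; rewrite !inE => /eqP-> /eqP->.
  by rewrite eqxx.
have [s [os sz]] := IH (ltnW mn).
have [|e oe] := orthonormal_extend os; first by rewrite sz.
by exists (e :: s); rewrite /= sz.
Qed.

(* With the orthonormal vectors as rows, [A V A^T = 1] means [V^-1 = A^T A]. *)
Lemma invmx_orthonormal s (g : 'cV[R]_n) : orthonormal_seq B s -> size s = n ->
  bform g (invmx V) g = \sum_(e <- s) ((e^T *m g) 0 0) ^+ 2.
Proof.
move=> [us os] sn.
pose A : 'M[R]_n := \matrix_(i < n) (nth 0 s i)^T.
have rA i : row i A = (nth 0 s i)^T by rewrite rowK.
have AVA : A *m V *m A^T = 1%:M.
  apply/matrixP => i j; rewrite !mxE.
  have <- : B (nth 0 s i) (nth 0 s j) = (i == j)%:R.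
    by rewrite os ?mem_nth ?sn// nth_uniq ?sn.
  rewrite /B /bform mxE; apply: eq_bigr => l _.
  by rewrite -rA -row_mul [in LHS]mxE [in RHS]mxE; congr (_ * _); rewrite !mxE.
have VAA : invmx V = A^T *m A.
  have h : V *m A^T *m A = 1%:M by apply: mulmx1C; rewrite mulmxA.
  by rewrite -[RHS](mulKmx pos_def_unitmx) [X in _ *m X]mulmxA h mulmx1.
rewrite /bform VAA mulmxA -trmx_mul -mulmxA.
rewrite mxE (big_nth 0) sn big_mkord; apply: eq_bigr => i _.
by rewrite mxE -expr2 -rA -row_mul [in RHS]mxE.
Qed.

End orthonormal_extension.

(** * The observed vector as a Gaussian family *)

Section model.
Context {R : realType} d (T : measurableType d) (P : probability T R).
Variables (G : R -> T -> R) (mu sigma : R) (t : nat -> R).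
Hypothesis gp : centered_gaussian_process P G.
Hypothesis sigma0 : 0 < sigma.
Hypothesis t0 : 0 < t 0%N.
Hypothesis tS : forall i, t i < t i.+1.

Lemma obs_time_gt0 i : 0 < t i.
Proof. by elim: i => // i IH; exact: lt_trans (tS i). Qed.

Lemma gaussian_process_moments s : 0 <= s -> all_moments P (G s).
Proof.
move=> ss; have [_ /(_ 1%N (fun=> s) (fun=> 1))] := gp.
rewrite (_ : (fun w => _) = G s); last by apply/funext => w; rewrite big_ord1 mul1r.
by case=> // mX [v [v0 law]]; exact: gaussian_all_moments mX v0 law.
Qed.

Lemma cov_funE s u : cov_fun P G s u = \int[P]_w (G s w * G u w).
Proof. by rewrite /cov_fun fine_expectation. Qed.

Variable k : nat.
Let n := k.+1.
Let V := Vmat P G t n.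
Hypothesis V_pos : pos_def V.

Let gv w : 'cV[R]_n := \col_(i < n) G (t i) w.
Let L (c : 'cV[R]_n) (w : T) : R := (c^T *m gv w) 0 0.
Let B (u v : 'cV[R]_n) : R := bform u V v.

Let V_sym : V^T = V.
Proof.
by apply/matrixP => i j; rewrite !mxE !cov_funE; apply: eq_Rintegral => w _; rewrite mulrC.
Qed.

Let LE c w : L c w = \sum_(i < n) c i 0 * G (t i) w.
Proof. by rewrite /L mxE; apply: eq_bigr => i _; rewrite !mxE. Qed.

Let L_lin a u v w : L (a *: u + v) w = a * L u w + L v w.
Proof. by rewrite /L linearD linearZ/= mulmxDl -scalemxAl !mxE. Qed.

Let L_gauss c : is_centered_gaussian P (L c).
Proof.
have [_ /(_ n (fun i => t i) (fun i => c i 0))] := gp.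
rewrite (_ : (fun w => _) = L c); last by apply/funext => w; rewrite LE.
by apply=> i; rewrite ltW// obs_time_gt0.
Qed.

Let L_var c : \int[P]_w L c w ^+ 2 = B c c.
Proof.
have i2 (i j : 'I_n) : P.-integrable setT (EFin \o (fun w => c i 0 * c j 0 * (G (t i) w * G (t j) w))).
  apply: integrableZ_fin; apply: all_moments_Lfun; apply: all_momentsM;
  by apply: gaussian_process_moments; rewrite ltW// obs_time_gt0.
transitivity (\int[P]_w (\sum_(j < n) \sum_(i < n) c i 0 * c j 0 * (G (t i) w * G (t j) w))).
  apply: eq_Rintegral => w _; rewrite expr2 LE mulr_sumr; apply: eq_bigr => j _.
  by rewrite mulr_suml; apply: eq_bigr => i _; ring.
rewrite Rintegral_sum => [|j _]; last exact: integrable_sum_fin.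
rewrite /B /bform mxE; apply: eq_bigr => j _.
rewrite Rintegral_sum// mxE mulr_suml; apply: eq_bigr => i _.
rewrite RintegralZl//; last first.
  apply: all_moments_Lfun; apply: all_momentsM;
  by apply: gaussian_process_moments; rewrite ltW// obs_time_gt0.
by rewrite !mxE cov_funE mulrAC.
Qed.

Let mL c : measurable_fun setT (L c). Proof. by have [] := L_gauss c. Qed.

Let L_char c th : \int[P]_w cos (L c w + th) = expR (- B c c / 2) * cos th.
Proof.
have [mX [v [v0 law]]] := L_gauss c.
by rewrite (gaussian_char mX v0 law) -L_var (gaussian_var mX v0 law).
Qed.

Let L_law e : B e e = 1 -> forall A : set R, measurable A -> P (L e @^-1` A) = stdN A.
Proof.
have [mX [v [v0 law]]] := L_gauss e.
by rewrite -L_var (gaussian_var mX v0 law); exact: (gaussian_law1 law).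
Qed.

Let B_sym u v : B u v = B v u. Proof. exact: bform_sym. Qed.
Let B_lin a u v c : B (a *: u + v) c = a * B u c + B v c.
Proof. exact: bform_linear_l. Qed.

Let Vi := invmx V.
Let tt := tvec t n.
Let tau := bform tt Vi tt.

Let Vu : V \in unitmx. Proof. exact: pos_def_unitmx. Qed.

Let VVi u : bform (Vi *m tt) V u = bform tt 1%:M u.
Proof. by rewrite /bform trmx_mul invmx_sym// mulmx1 -(mulmxA _ Vi V) mulVmx// mulmx1. Qed.

Lemma obs_quad_gt0 : 0 < tau.
Proof.
have -> : tau = bform (Vi *m tt) V (Vi *m tt) by rewrite VVi /tau /bform mulmx1 mulmxA.
apply: V_pos; apply/negP => /eqP h.
have : V *m (Vi *m tt) = 0 by rewrite h mulmx0.
rewrite mulmxA mulmxV// mul1mx => /matrixP/(_ ord0 ord0); rewrite !mxE => t00.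
by move: t0; rewrite t00 ltxx.
Qed.

(* Cauchy-Schwarz for the form of [V], applied to [V^-1 t] and a basis vector. *)
Lemma obs_quad_ge (i : 'I_n) : t i ^+ 2 <= V i i * tau.
Proof.
pose e : 'cV[R]_n := delta_mx i 0; pose u := Vi *m tt.
have Be : B e e = V i i by rewrite /B /bform trmx_delta -rowE -colE !mxE.
have Bu : B u u = tau by rewrite /B VVi /tau /bform mulmx1 mulmxA.
have Bue : B u e = t i by rewrite /B VVi /bform mulmx1 -colE !mxE.
have Vii : 0 < V i i.
  rewrite -Be; apply: V_pos; apply/negP => /eqP/matrixP/(_ i 0).
  by rewrite !mxE !eqxx => /eqP; rewrite oner_eq0.
(* This is [V i i] times the component of [u] orthogonal to [e]; its form expands to
   [V i i * (V i i * tau - t i ^+ 2)]. *)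
have : 0 <= B (V i i *: u + (- t i) *: e) (V i i *: u + (- t i) *: e).
  have [->|x0] := eqVneq (V i i *: u + (- t i) *: e) 0; last by rewrite ltW// V_pos.
  by rewrite /B /bform mulmx0 mxE.
have Z a x y : B (a *: x) y = a * B x y.
  by rewrite /B /bform linearZ/= -!scalemxAl mxE.
rewrite B_lin Z (B_sym u) (B_sym e) !B_lin !Z Be Bu (B_sym e) Bue => h.
have : 0 <= V i i * (V i i * tau - t i ^+ 2) by move: h; congr (0 <= _); ring.
by rewrite pmulr_rge0// subr_ge0.
Qed.

(** The numerator of [sigma2_hat] is the Gram determinant of [X] and [t] for [V^-1], hence unchanged
    when [mu t] is subtracted from [X]; divided by [tau] it leaves the form of the noise minus its
    component along [t], that is, the squares other than that of [L a0]. The last clause is the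
    independence of [Y_n] and [W]. *)
Lemma model_repr : exists W : T -> R, [/\ chi2_stein P W k,
  forall w, sigma2_hat P G mu sigma t n w = sigma ^+ 2 * (W w / n%:R),
  all_moments P (Y_n P G mu sigma t n),
  forall A : set R, measurable A -> P (Y_n P G mu sigma t n @^-1` A) = stdN A &
  forall (F : R -> R -> R) M, (forall x, continuous (F ^~ x)) -> (forall b, continuous (F b)) ->
    (forall b x, `|F b x| <= M) ->
    \int[P]_w F (Y_n P G mu sigma t n w) (W w) = \int[(P \x stdN)%E]_p F p.2 (W p.1)].
Proof.
have tau0 := obs_quad_gt0.
have st0 : 0 < Num.sqrt tau by rewrite sqrtr_gt0.
have st2 : Num.sqrt tau ^+ 2 = tau by rewrite sqr_sqrtr// ltW.
pose a0 : 'cV[R]_n := (Num.sqrt tau)^-1 *: (Vi *m tt).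
have BZ a u v : B (a *: u) v = a * B u v.
  by rewrite /B /bform linearZ/= -!scalemxAl mxE.
have B1 : B a0 a0 = 1.
  rewrite /a0 BZ B_sym BZ /B VVi.
  rewrite (_ : bform tt 1%:M (Vi *m tt) = tau); last by rewrite /tau /bform mulmx1 mulmxA.
  by rewrite mulrA -expr2 exprVn st2 mulVf// gt_eqF.
have [s [os sz]] := orthonormal_completion V_sym V_pos B1.
pose W := sumsq L s.
have La0 w : L a0 w = bform tt Vi (gv w) / Num.sqrt tau.
  by rewrite /L /a0 linearZ/= -scalemxAl mxE trmx_mul invmx_sym// mulrC.
have WE w : W w = bform (gv w) Vi (gv w) - (bform tt Vi (gv w)) ^+ 2 / tau.
  rewrite (invmx_orthonormal V_pos (gv w) os sz) big_cons -/(L a0 w) La0.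
  by rewrite exprMn exprVn st2 addrAC subrr add0r.
have XE w : Xvec G mu sigma t n w = mu *: tt + sigma *: gv w.
  by apply/colP => i; rewrite !mxE.
have tX w : bform tt Vi (Xvec G mu sigma t n w) = mu * tau + sigma * bform tt Vi (gv w).
  by rewrite XE /tau /bform mulmxDr -!scalemxAr !mxE.
have bs u v : bform u Vi v = bform v Vi u.
  by apply: bform_sym; exact: invmx_sym.
have XX w : bform (Xvec G mu sigma t n w) Vi (Xvec G mu sigma t n w) =
    mu ^+ 2 * tau + 2 * mu * sigma * bform tt Vi (gv w) + sigma ^+ 2 * bform (gv w) Vi (gv w).
  rewrite {1}XE bform_linear_l tX (bs (sigma *: gv w)).
  have -> : bform (Xvec G mu sigma t n w) Vi (sigma *: gv w) =
     sigma * (mu * bform tt Vi (gv w) + sigma * bform (gv w) Vi (gv w)).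
    rewrite XE /bform -scalemxAr linearD !linearZ/= !mulmxDl -!scalemxAl !mxE.
    by [].
  by ring.
have YE : Y_n P G mu sigma t n = L a0.
  apply/funext => w; rewrite /Y_n /mu_hat -/V -/Vi -/tt -/tau tX La0.
  rewrite -{2 3}st2; field.
  by rewrite !gt_eqF.
exists W; rewrite YE; split.
- have [os' _ _] := orthonormal_cons os.
  split; first exact: (sumsq_all_moments mL L_law os').
  move=> g g' dg cg' pg pg'.
  have := stein_sumsq L_lin B_sym B_lin mL L_char L_law os' dg cg' pg pg'.
  by have -> : size s = k by case: sz.
- move=> w; rewrite /sigma2_hat -/V -/Vi -/tt -/tau XX tX WE.
  by field; apply/andP; split; [rewrite pnatr_eq0|rewrite gt_eqF].
- exact: law_all_moments (mL a0) (L_law B1).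
- exact: L_law.
- move=> F M cF1 cF2 FM.
  exact: (joint_bounded L_lin B_sym B_lin mL L_char os cF1 cF2 FM).
Qed.

End model.

(** * The estimators *)

Section almost_sure.
Context {R : realType} d (T : measurableType d) (P : probability T R).

(** The moments are summable, so the series of [|Z k| ^ (p + 1)] has a finite integral, hence
    converges almost surely, and its terms tend to 0. *)
Lemma ae_cvg0_moments (Z : nat -> T -> R) (p : nat) (C : R) :
  (forall k, P.-integrable setT (EFin \o (fun w => `|Z k w| ^+ p.+1))) ->
  (forall k, \int[P]_w `|Z k w| ^+ p.+1 <= C * k.+1%:R^-1 ^+ 2) ->
  {ae P, forall w, Z k w @[k --> \oo] --> (0 : R)}.
Proof.
move=> iZ hZ.
pose f k w := (`|Z k w| ^+ p.+1)%:E.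
have f0 k w : (0 <= f k w)%E by rewrite lee_fin exprn_ge0.
have mf k : measurable_fun setT (f k) by have /integrableP[] := iZ k.
have C0 : 0 <= C.
  have h : 0 <= \int[P]_w `|Z 0%N w| ^+ p.+1 by apply: Rintegral_ge0 => w _; exact: exprn_ge0.
  by have := le_trans h (hZ 0%N); rewrite invr1 expr1n mulr1.
have fE k : (\int[P]_w f k w = (\int[P]_w `|Z k w| ^+ p.+1)%:E)%E.
  by rewrite /Rintegral fineK//; exact: integrable_fin_num (iZ k).
(* [1 / (k + 1)^2] is at most twice the term of this telescoping sum, which bounds the total by
   [2 C]. *)
have tele n : \sum_(0 <= k < n) (k.+1%:R^-1 - k.+2%:R^-1) <= (1 : R).
  have E : \sum_(0 <= k < n) (k.+1%:R^-1 - k.+2%:R^-1) = 1 - n.+1%:R^-1 :> R.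
    elim: n => [|n IH]; first by rewrite big_geq// invr1 subrr.
    by rewrite big_nat_recr//= IH addrA subrK.
  by rewrite E lerBlDr lerDl invr_ge0.
have sq (k : nat) : k.+1%:R^-1 ^+ 2 <= 2 * (k.+1%:R^-1 - k.+2%:R^-1) :> R.
  have -> : k.+1%:R^-1 - k.+2%:R^-1 = k.+1%:R^-1 * k.+2%:R^-1 :> R.
    have -> : k.+2%:R = k.+1%:R + 1 :> R by rewrite natr1.
    have k1 : 0 < k.+1%:R :> R by [].
    move: (k.+1%:R) k1 => x x0; field.
    by rewrite !gt_eqF ?addr_gt0.
  rewrite mulrCA expr2 ler_wpM2l ?invr_ge0//.
  rewrite -[leLHS]mul1r ler_pdivrMr// mulrAC ler_pdivlMr// mul1r.
  by rewrite -natrM ler_nat; lia.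
have S : (\int[P]_w \sum_(k <oo) f k w <= (2 * C)%:E)%E.
  rewrite integral_nneseries//.
  apply: lime_le; first by apply: is_cvg_nneseries => k _ _; exact: integral_ge0.
  apply: nearW => n.
  under eq_bigr do rewrite fE.
  rewrite sumEFin lee_fin.
  apply: (@le_trans _ _ (\sum_(0 <= k < n) (2 * C) * (k.+1%:R^-1 - k.+2%:R^-1))).
    apply: ler_sum => k _; apply: (le_trans (hZ k)).
    by rewrite mulrAC [_ * C]mulrC ler_wpM2l.
  by rewrite -mulr_sumr -[leRHS]mulr1 ler_wpM2l// mulr_ge0.
have iS : P.-integrable setT (fun w => \sum_(k <oo) f k w)%E.
  apply/integrableP; split; first exact: ge0_emeasurable_sum.
  under eq_integral do rewrite gee0_abs ?nneseries_ge0//.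
  exact: le_lt_trans S (ltry _).
have := integrable_ae measurableT iS.
apply: filterS => w /(_ Logic.I) fin.
have cs : cvgn (series (fun k => `|Z k w| ^+ p.+1)).
  apply: nondecreasing_is_cvgn.
    by apply: nondecreasing_series => k _ _; exact: exprn_ge0.
  exists (fine (\sum_(k <oo) f k w)) => _ [n _ <-].
  rewrite -lee_fin fineK// /series/= -sumEFin.
  exact: nneseries_lim_ge.
have c0 := cvg_series_cvg_0 cs.
apply/cvgrPdist_lt => e e0.
have ep : 0 < e ^+ p.+1 by exact: exprn_gt0.
have [N _ hN] := (@cvgrPdist_lt _ _ _ _ _ _ _).1 c0 _ ep.
exists N => // k /hN/=.
rewrite !sub0r !normrN ger0_norm ?exprn_ge0//.
by rewrite ltr_pXn2r// nnegrE ltW.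
Qed.

End almost_sure.

Section estimators.
Context {R : realType} d (T : measurableType d) (P : probability T R).
Variables (G : R -> T -> R) (mu sigma : R) (t : nat -> R).
Hypothesis gp : centered_gaussian_process P G.
Hypothesis sigma0 : 0 < sigma.
Hypothesis t0 : 0 < t 0%N.
Hypothesis tS : forall i, t i < t i.+1.
Hypothesis V_pos : forall n, pos_def (Vmat P G t n).

Let Y := Y_n P G mu sigma t.
Let Q := Q_n P G mu sigma t.

(** [Q_n] compares [W] with [n], [chi2_std] compares it with its mean [n - 1]; the difference of 1
    becomes the shift. *)
Lemma Q_chi2_std (k : nat) (W : T -> R) (w : T) :
  sigma2_hat P G mu sigma t k.+1 w = sigma ^+ 2 * (W w / k.+1%:R) ->
  Q k.+1 w = chi2_std W k w - (Num.sqrt (2 * k.+1%:R))^-1.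
Proof.
move=> h; rewrite /Q /Q_n h /chi2_std.
have n0 : 0 < k.+1%:R :> R by [].
have kE : k%:R = k.+1%:R - 1 :> R by rewrite -natr1 addrK.
rewrite kE; move: (k.+1%:R) n0 => n n0.
set s := Num.sqrt (2 * n).
have s0 : 0 < s by rewrite sqrtr_gt0 mulr_gt0.
have s2 : s ^+ 2 = 2 * n by rewrite sqr_sqrtr// mulr_ge0// ltW.
have -> : Num.sqrt (n / 2) = s / 2.
  rewrite (_ : n / 2 = (s / 2) ^+ 2); last by rewrite exprMn s2; field.
  by rewrite sqrtr_sqr ger0_norm// divr_ge0// ltW.
have nE : n = s ^+ 2 / 2 by rewrite s2; field.
by rewrite nE; field; rewrite !gt_eqF.
Qed.

Lemma Qbar_chi2_std (k : nat) (W : T -> R) : chi2_stein P W k ->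
  (forall w, sigma2_hat P G mu sigma t k.+1 w = sigma ^+ 2 * (W w / k.+1%:R)) ->
  Qbar_n P G mu sigma t k.+1 = chi2_std W k.
Proof.
move=> WC sW; have QE w := Q_chi2_std (sW w).
have aX := chi2_std_all_moments WC.
apply/funext => w; rewrite /Qbar_n -/Q fine_expectation QE.
under eq_Rintegral do rewrite QE.
rewrite RintegralB//; last 2 first.
- exact: all_moments_Lfun.
- exact: finite_measure_integrable_cst.
by rewrite chi2_std_mean// Rintegral_prob_cst sub0r opprK subrK.
Qed.

Lemma chi2_family : exists W : nat -> T -> R, forall k,
  chi2_stein P (W k) k /\ forall w, sigma2_hat P G mu sigma t k.+1 w = sigma ^+ 2 * (W k w / k.+1%:R).
Proof.
have /choice[W hW] : forall k, exists W : T -> R, chi2_stein P W k /\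
  forall w, sigma2_hat P G mu sigma t k.+1 w = sigma ^+ 2 * (W w / k.+1%:R).
  by move=> k; have [W [? ? _ _ _]] := model_repr mu gp sigma0 t0 tS (@V_pos k.+1); exists W.
by exists W.
Qed.

Let dist n := kolmogorov_dist P (Qbar_n P G mu sigma t n).

(** [sup] is an upper bound only for a bounded set, so the uniform estimate is used twice: to bound
    the supremum and to let each [z] be compared with it. *)
Lemma Qbar_kolmogorov_sup (n : nat) : (1 <= n)%N ->
  dist n <= Num.sqrt (2 * n%:R - 1) / n%:R /\
  forall z, `|prob_le P (Qbar_n P G mu sigma t n) z - Phi z| <= dist n.
Proof.
case: n => // k _; have [W hW] := chi2_family; have [WC sW] := hW k.
have b z : `|prob_le P (Qbar_n P G mu sigma t k.+1) z - Phi z| <=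
    Num.sqrt (2 * k.+1%:R - 1) / k.+1%:R.
  by rewrite (Qbar_chi2_std WC sW); exact: chi2_kolmogorov.
split.
  by apply: ge_sup; [exists `|prob_le P (Qbar_n P G mu sigma t k.+1) 0 - Phi 0|, 0|move=> _ [z _ <-]].
move=> z; apply: ub_le_sup; last by exists z.
by exists (Num.sqrt (2 * k.+1%:R - 1) / k.+1%:R) => _ [y _ <-].
Qed.

Lemma Qbar_edgeworth z :
  (fun n : nat => n%:R / Num.sqrt (2 * n%:R - 1)
     * (prob_le P (Qbar_n P G mu sigma t n) z - Phi z)) @ \oo --> - (Phi3 z / 3).
Proof.
have [W hW] := chi2_family.
(* The empty sample, index 0, is dropped; sample size [k + 1] has [k] degrees of freedom. *)
rewrite -cvg_shiftS.
have -> : (fun k => k.+1%:R / Num.sqrt (2 * k.+1%:R - 1)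
     * (prob_le P (Qbar_n P G mu sigma t k.+1) z - Phi z)) =
  (fun k => k.+1%:R / Num.sqrt (2 * k.+1%:R - 1) * (prob_le P (chi2_std (W k) k) z - Phi z)).
  by apply/funext => k; have [WC sW] := hW k; rewrite (Qbar_chi2_std WC sW).
by apply: chi2_edgeworth_cvg => k; have [] := hW k.
Qed.

(** At [z = 0] the Edgeworth limit is [phi 0 / 3]. Half of it is eventually exceeded, and serves as
    [C]; the crude estimate [phi 0 <= 1] makes it less than 1. *)
Lemma Qbar_kolmogorov_rate : exists C : R, 0 < C < 1 /\ exists n0 : nat, (1 <= n0)%N /\
  forall n : nat, (n0 <= n)%N ->
    C < n%:R / Num.sqrt (2 * n%:R - 1) * dist n
    /\ n%:R / Num.sqrt (2 * n%:R - 1) * dist n <= 1.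
Proof.
have p0 : 0 < phi (0 : R) by exact: phi_gt0.
have p1 : phi (0 : R) < 6.
  have s1 : 1 <= Num.sqrt (pi *+ 2) :> R.
    by rewrite -[leLHS]sqrtr1 ler_wsqrtr// mulr2n; have := pi_ge2 R; lra.
  rewrite phiE expr0n oppr0 mul0r expR0 mulr1.
  by apply: (@le_lt_trans _ _ 1); [rewrite invf_le1// (lt_le_trans _ s1)|rewrite ltr1n].
exists (phi 0 / 6); split; first by rewrite divr_gt0//= ltr_pdivrMr// mul1r.
have := @Qbar_edgeworth 0.
rewrite (_ : - (Phi3 0 / 3) = phi 0 / 3); last by rewrite /Phi3; field.
have lt63 : phi 0 / 6 < phi 0 / 3 :> R by lra.
move=> /cvgr_gt/(_ _ lt63)[N _ hN].
exists N.+1; split => // n nN.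
have n1 : (1 <= n)%N by exact: leq_trans nN.
have [d1 d2] := Qbar_kolmogorov_sup n1.
have n0 : 1 <= n%:R :> R by rewrite ler1n.
have r0 : 0 < Num.sqrt (2 * n%:R - 1) :> R.
  by rewrite sqrtr_gt0; move: (n%:R) n0 => x x0; lra.
have nr : 0 < n%:R / Num.sqrt (2 * n%:R - 1) :> R by rewrite divr_gt0// (lt_le_trans _ n0).
split; last first.
  apply: (le_trans (ler_wpM2l (ltW nr) d1)).
  by rewrite mulrA divfK ?divff ?gt_eqF// (lt_le_trans _ n0).
apply: (lt_le_trans (hN n (ltnW nN))).
rewrite ler_pM2l//.
exact: le_trans (ler_norm _) (d2 0).
Qed.

Lemma joint_clt : cvg_law_std_normal2 P (fun n w => (Y n w, Q n w)).
Proof.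
move=> f cf [M fM].
have cf1 q : continuous (fun y => f (y, q)).
  move=> y; apply: (@continuous_comp _ _ _ (fun y => (y, q)) f); last exact: cf.
  by apply: (@cvg_pair _ _ _ (nbhs y) (nbhs y) (nbhs q)); [exact: cvg_id|exact: cvg_cst].
have cf2 y : continuous (fun q => f (y, q)).
  move=> q; apply: (@continuous_comp _ _ _ (fun q => (y, q)) f); last exact: cf.
  by apply: (@cvg_pair _ _ _ (nbhs q) (nbhs y) (nbhs q)); [exact: cvg_cst|exact: cvg_id].
have mf1 q : measurable_fun setT (fun y => f (y, q)) by exact: continuous_measurable_fun.
pose h q := \int[stdN]_y f (y, q).
have ch : continuous h.
  (* Continuity is tested on sequences, the setting of [Rintegral_dominated]. *)
  move=> q; apply/(@cvg_nbhsP _ R^o) => u uq.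
  apply: (@Rintegral_dominated _ _ _ (stdN : probability R R) (fun n y => f (y, u n)) _ (fun=> M)) => //.
  - by move=> y; apply: (@cvg_comp _ _ _ u (fun q => f (y, q)) _ _ _ uq); exact: cf2.
  - exact: finite_measure_integrable_cst.
have hM q : `|h q| <= M.
  by apply: (@normr_Rintegral_le _ _ _ (stdN : probability R R) (fun y => f (y, q))).
have mh : measurable_fun setT h by exact: continuous_measurable_fun.
have -> : fine (\int[std_normal2]_p (f p)%:E)%E = \int[stdN]_q h q.
  rewrite -(@law_Rintegral _ _ _ (normal_prob (0 : R) 1) stdN (@Rid R))//.
  have hE q : h q = \int[normal_prob (0 : R) 1]_y f (y, q).
    by rewrite /h -(@law_Rintegral _ _ _ (normal_prob (0 : R) 1) stdN (@Rid R)).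
  under eq_Rintegral do rewrite hE.
  rewrite (@Rfubini2_bounded _ _ _ _ _ (normal_prob (0 : R) 1) (normal_prob (0 : R) 1) (fun x y => f (x, y)) M)//.
  - by congr fine; apply: eq_integral => -[x y] _.
  - exact: (@measurable_fun_caratheodory _ _ (measurableTypeR R) (fun x y => f (x, y))).
have [C hC] := chi2_clt P ch hM.
rewrite -cvg_shiftS; apply: (@cvg_of_bound _ _ _ C) => k.
have [W [WC sW _ _ joint]] := model_repr mu gp sigma0 t0 tS (@V_pos k.+1).
rewrite fine_expectation; set s := (Num.sqrt (2 * k.+1%:R))^-1.
have -> : \int[P]_w f (Y k.+1 w, Q k.+1 w) = \int[P]_w h (chi2_std W k w - s).
  pose F (b x : R) := f (b, (x - k%:R) * s - s).
  transitivity (\int[P]_w F (Y k.+1 w) (W w)).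
    by apply: eq_Rintegral => w _; rewrite (Q_chi2_std (sW w)).
  have cF b : continuous (F b).
    move=> x; apply: (@continuous_comp _ _ _ (fun x : R => (x - k%:R) * s - s) (fun q : R => f (b, q))); last exact: cf2.
    by apply: cvgB; [apply: cvgM; [apply: cvgB; [exact: cvg_id|exact: cvg_cst]|exact: cvg_cst]|exact: cvg_cst].
  have FM b x : `|F b x| <= M by exact: fM.
  have cF1 x : continuous (F ^~ x) by exact: (cf1 ((x - k%:R) * s - s)).
  rewrite (joint F M)//.
  rewrite -(@Rfubini1_bounded _ _ _ _ _ P stdN (fun w y => F y (W w)) M)//.
  apply: (measurable_fun_caratheodory (F := fun w y => F y (W w))) => [b|w]; last exact: cF1.
  apply: (measurableT_comp (f := F b)); first exact: continuous_measurable_fun.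
  exact: WC.1.1.
exact: hC WC.
Qed.

End estimators.

(** * Strong consistency *)

Section consistency.
Context {R : realType} d (T : measurableType d) (P : probability T R).
Variables (G : R -> T -> R) (mu sigma : R) (t : nat -> R).
Hypothesis gp : centered_gaussian_process P G.
Hypothesis sigma0 : 0 < sigma.
Hypothesis t0 : 0 < t 0%N.
Hypothesis tS : forall i, t i < t i.+1.
Hypothesis V_pos : forall n, pos_def (Vmat P G t n).

(** [sigma2_hat / sigma^2 = 1 - 1 / n + r X] with [r = sqrt (2 n) / n]. Since [r^4 = 4 / n^2],
    fourth moments are summable, with constant [4 * 15 = 60]. *)
Lemma sigma2_hat_consistent :
  {ae P, forall w, (fun n => sigma2_hat P G mu sigma t n w) @ \oo --> sigma ^+ 2}.
Proof.
have [W hW] := chi2_family mu gp sigma0 t0 tS V_pos.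
pose r k : R := Num.sqrt (2 * k.+1%:R) / k.+1%:R.
have r4 k : r k ^+ 4 = 4 * k.+1%:R^-1 ^+ 2.
  have n0 : 0 < k.+1%:R :> R by [].
  rewrite /r (_ : 4 = 2 * 2)%N// exprM expr_div_n sqr_sqrtr ?mulr_ge0//.
  by move: (k.+1%:R) n0 => n n0; field; rewrite gt_eqF.
pose Z k w := r k * chi2_std (W k) k w.
have : {ae P, forall w, Z k w @[k --> \oo] --> (0 : R)}.
  apply: (@ae_cvg0_moments _ _ _ _ Z 3 60) => k; have aX := chi2_std_all_moments (hW k).1.
    apply: (all_moments_integrable (f := fun x => `|r k * x| ^+ 4) aX).
      by apply: measurable_funX; apply: measurableT_comp => //; exact: measurable_funM.
    apply: pgrowthX; apply: (@le_pgrowth _ _ (fun x => r k * x)); first by move=> x; rewrite normr_id.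
    by apply: pgrowthM; [exact: pgrowth_cst|exact: pgrowth_id].
  rewrite (_ : \int[P]_w _ = r k ^+ 4 * \int[P]_w chi2_std (W k) k w ^+ 4); last first.
    rewrite -RintegralZl//; last first.
      apply: (all_moments_integrable (f := fun x => x ^+ 4) aX) => //.
      by apply: pgrowthX; exact: pgrowth_id.
    apply: eq_Rintegral => w _; rewrite -exprMn.
    by rewrite -normrX ger0_norm// exprn_even_ge0.
  rewrite r4 mulrAC (_ : 60 = 4 * 15 :> R); last by rewrite -natrM.
  by rewrite ler_wpM2r ?exprn_ge0// ler_wpM2l//; exact: chi2_std_m4_le (hW k).1.
apply: filterS => w cZ.
rewrite -cvg_shiftS.
rewrite [X in X @ \oo --> _](_ : _ = (fun k => sigma ^+ 2 * (1 - k.+1%:R^-1 + Z k w))).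
  rewrite (_ : sigma ^+ 2 = sigma ^+ 2 * (1 - 0 + 0)); last by rewrite subr0 addr0 mulr1.
  apply: cvgM; first by rewrite subr0 addr0 mulr1; exact: cvg_cst.
  apply: cvgD cZ; apply: cvgB; first exact: cvg_cst.
  exact: cvg_harmonic.
apply/funext => k /=; rewrite (hW k).2 /Z /r /chi2_std; congr (_ * _).
have n0 : 0 < k.+1%:R :> R by [].
have kE : k%:R = k.+1%:R - 1 :> R by rewrite -natr1 addrK.
rewrite kE; move: (k.+1%:R) n0 => n n0.
have : 0 < Num.sqrt (2 * n) by rewrite sqrtr_gt0 mulr_gt0.
move: (Num.sqrt (2 * n)) => s s0.
by field; rewrite !gt_eqF.
Qed.

(** The variance bound turns [t_n^2 <= V_nn tau] into [t_n^(2 - beta) <= c tau], so [tau] is at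
    least of order [n^de] with [de = alpha (2 - beta) > 0]. As [de] may be small, the order of the
    moment has to be adapted to it. *)
Lemma mu_hat_consistent :
  (exists c beta : R, 0 < c /\ beta < 2 /\
      forall s : R, 0 < s -> fine ('E_P[(fun w => G s w ^+ 2)%R])%E <= c * s `^ beta) ->
  (exists alpha c1 c2 : R, 0 < alpha /\ 0 < c1 /\ 0 < c2 /\
      forall i : nat, c1 * (i.+1)%:R `^ alpha <= t i <= c2 * (i.+1)%:R `^ alpha) ->
  {ae P, forall w, (fun n => mu_hat P G mu sigma t n w) @ \oo --> mu}.
Proof.
move=> [c [be [c0 [be2 VarG]]]] [al [c1 [c2 [al0 [c10 [_ tal]]]]]].
pose tau k := bform (tvec t k.+1) (invmx (Vmat P G t k.+1)) (tvec t k.+1).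
have tau0 k : 0 < tau k by exact: (@obs_quad_gt0 _ _ _ P G t t0 k (@V_pos k.+1)).
pose de := al * (2 - be).
have de0 : 0 < de by rewrite mulr_gt0// subr_gt0.
pose K1 := c1 `^ (2 - be).
have K10 : 0 < K1 by rewrite powR_gt0.
have tauB k : K1 * k.+1%:R `^ de <= c * tau k.
  have tk : 0 < t k by exact: obs_time_gt0.
  apply: (@le_trans _ _ (t k `^ (2 - be))).
    rewrite /K1 /de powRrM -powRM ?powR_ge0 ?(ltW c10)//.
    have /andP[le_tk _] := tal k.
    apply: ge0_ler_powR le_tk; rewrite ?nnegrE ?subr_ge0 ?(ltW be2) ?(ltW tk)//.
    by rewrite mulr_ge0 ?powR_ge0 ?(ltW c10).
  have h : t k ^+ 2 = t k `^ be * t k `^ (2 - be).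
    rewrite -powRD; last by apply/implyP => _; rewrite gt_eqF.
    by rewrite addrC subrK -[2]/(2%:R) powR_mulrn// ltW.
  have := @obs_quad_ge _ _ _ P G t k (@V_pos k.+1) ord_max.
  rewrite -/(tau k) mxE/= h => le1.
  have le2 : cov_fun P G (t k) (t k) <= c * t k `^ be.
    apply: le_trans (VarG _ tk); rewrite /cov_fun le_eqVlt; apply/orP; left; apply/eqP.
    by congr (fine 'E_P[_])%E; apply/funext => w; rewrite expr2.
  have A0 : 0 < t k `^ be by rewrite powR_gt0.
  rewrite -(ler_pM2l A0) mulrA [_ * c]mulrC; apply: (le_trans le1).
  by rewrite ler_wpM2r// ltW.
(* Chosen so that [tau^-(m + 1)] is [O (n^-2)]. *)
pose m := Num.bound (2 / de).
have dem : 2 <= de * m.+1%:R.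
  have : 2 / de < m%:R by rewrite archi_boundP// divr_ge0// ltW.
  rewrite ltr_pdivrMr// mulrC => /ltW h; apply: (le_trans h).
  by rewrite ler_wpM2l ?(ltW de0)// ler_nat.
have tauq k : (tau k)^-1 ^+ m.+1 <= (c / K1) ^+ m.+1 * k.+1%:R^-1 ^+ 2.
  have n1 : 1 <= k.+1%:R :> R by rewrite ler1n.
  have h : (tau k)^-1 <= (c / K1) * (k.+1%:R `^ de)^-1.
    by rewrite -mulrA -invfM ler_pdivlMr ?mulr_gt0// mulrC ler_pdivrMr.
  apply: (@le_trans _ _ (((c / K1) * (k.+1%:R `^ de)^-1) ^+ m.+1)).
    by rewrite lerXn2r// nnegrE ?invr_ge0 ?(ltW (tau0 k))// (le_trans _ h)// invr_ge0 ltW.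
  rewrite exprMn ler_wpM2l// ?exprn_ge0 ?divr_ge0 ?(ltW c0) ?(ltW K10)//.
  rewrite !exprVn lef_pV2 ?posrE ?exprn_gt0//.
  rewrite -!powR_mulrn ?powR_ge0// -powRrM.
  exact: ler_powR.
(* [ae_cvg0_moments] uses the exponent [p + 1 = 2 (m + 1)], which is even, so that [sqrt tau]
   contributes the whole power [tau^(m + 1)]. *)
pose p := (2 * m).+1.
pose Z k w := (Num.sqrt (tau k))^-1 * Y_n P G mu sigma t k.+1 w.
have ZE k w : mu_hat P G mu sigma t k.+1 w = mu + sigma * Z k w.
  have st0 : 0 < Num.sqrt (tau k) by rewrite sqrtr_gt0.
  rewrite /Z /Y_n -/(tau k); move: (mu_hat _ _ _ _ _ _ _) (Num.sqrt _) st0 => x s s0.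
  by field; rewrite !gt_eqF.
have : {ae P, forall w, Z k w @[k --> \oo] --> (0 : R)}.
  apply: (@ae_cvg0_moments _ _ _ _ Z p ((c / K1) ^+ m.+1 * \int[stdN]_x `|x| ^+ p.+1)) => k.
    have [W [_ _ aY _ _]] := model_repr mu gp sigma0 t0 tS (@V_pos k.+1).
    apply: (all_moments_integrable (f := fun x => `|(Num.sqrt (tau k))^-1 * x| ^+ p.+1) aY).
      by apply: measurable_funX; apply: measurableT_comp => //; exact: measurable_funM.
    apply: pgrowthX; apply: (@le_pgrowth _ _ (fun x => (Num.sqrt (tau k))^-1 * x)); first by move=> x; rewrite normr_id.
    by apply: pgrowthM; [exact: pgrowth_cst|exact: pgrowth_id].
  have [W [_ _ aY lawY _]] := model_repr mu gp sigma0 t0 tS (@V_pos k.+1).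
  have mp : measurable_fun setT (fun x : R => `|x| ^+ p.+1).
    by apply: measurable_funX; exact: normr_measurable.
  rewrite (_ : \int[P]_w _ = (tau k)^-1 ^+ m.+1 * \int[stdN]_x `|x| ^+ p.+1); last first.
    rewrite -(law_Rintegral aY.1 lawY mp) -RintegralZl//; last first.
      apply: (all_moments_integrable (f := fun x => `|x| ^+ p.+1) aY) => //.
      apply: pgrowthX; apply: (@le_pgrowth _ _ (fun x => x)); last exact: pgrowth_id.
      by move=> x; rewrite normr_id.
    apply: eq_Rintegral => w _; rewrite /Z normrM exprMn; congr (_ * _).
    rewrite -[p.+1]/(2 + 2 * m)%N -mulnS exprM; congr (_ ^+ _).
    by rewrite ger0_norm ?invr_ge0// exprVn sqr_sqrtr// ltW.
  rewrite [leRHS]mulrAC ler_wpM2r ?tauq//.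
  by apply: Rintegral_ge0 => x _; exact: exprn_ge0.
apply: filterS => w cZ.
rewrite -cvg_shiftS (_ : [sequence _]_n = (fun k => mu + sigma * Z k w)).
  rewrite (_ : mu = mu + sigma * 0); last by rewrite mulr0 addr0.
  by apply: cvgD; [rewrite mulr0 addr0; exact: cvg_cst|apply: cvgM; [exact: cvg_cst|exact: cZ]].
by apply/funext => k; exact: ZE.
Qed.

End consistency.

Unset Implicit Arguments.

Theorem theorem1p2 (R : realType) (d : measure_display) (T : measurableType d)
  (P : probability T R) (G : R -> T -> R) (mu sigma : R) (t : nat -> R) :
  centered_gaussian_process P G ->
  0 < sigma ->
  0 < t 0%N -> (forall i : nat, t i < t i.+1) ->
  let H1 := exists c beta : R, 0 < c /\ beta < 2 /\
      forall s : R, 0 < s -> fine ('E_P[(fun w => G s w ^+ 2)%R])%E <= c * s `^ beta in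
  let H2 := forall n : nat, pos_def (Vmat P G t n) in
  (* part 1 *)
  (H1 -> H2 ->
   (exists alpha c1 c2 : R, 0 < alpha /\ 0 < c1 /\ 0 < c2 /\
      forall i : nat, c1 * (i.+1)%:R `^ alpha <= t i <= c2 * (i.+1)%:R `^ alpha) ->
   {ae P, forall w, (fun n => mu_hat P G mu sigma t n w) @ \oo --> mu} /\
   {ae P, forall w, (fun n => sigma2_hat P G mu sigma t n w) @ \oo --> sigma ^+ 2})
  /\
  (* part 2 *)
  (H2 -> cvg_law_std_normal2 P
     (fun n w => (Y_n P G mu sigma t n w, Q_n P G mu sigma t n w)))
  /\
  (* part 3 *)
  (H2 ->
   (forall n : nat, (1 <= n)%N ->
      kolmogorov_dist P (Qbar_n P G mu sigma t n)
        <= Num.sqrt (2 * n%:R - 1) / n%:R)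
   /\
   (forall z : R,
      (fun n : nat => n%:R / Num.sqrt (2 * n%:R - 1)
         * (prob_le P (Qbar_n P G mu sigma t n) z - Phi z))
        @ \oo --> - (Phi3 z / 3))
   /\
   (exists C : R, 0 < C < 1 /\ exists n0 : nat, (1 <= n0)%N /\
      forall n : nat, (n0 <= n)%N ->
        C < n%:R / Num.sqrt (2 * n%:R - 1) * kolmogorov_dist P (Qbar_n P G mu sigma t n)
        /\ n%:R / Num.sqrt (2 * n%:R - 1) * kolmogorov_dist P (Qbar_n P G mu sigma t n) <= 1)).
Proof.
move=> gp sigma0 t0 tS H1 H2; split; last split.
- move=> h1 V_pos tal; split.
  + exact: mu_hat_consistent gp sigma0 t0 tS V_pos h1 tal.
  + exact: sigma2_hat_consistent gp sigma0 t0 tS V_pos.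
- move=> V_pos; exact: joint_clt gp sigma0 t0 tS V_pos.
- move=> V_pos; split=> [n n1|]; last split=> [z|].
  + exact: (Qbar_kolmogorov_sup mu gp sigma0 t0 tS V_pos n1).1.
  + exact: Qbar_edgeworth gp sigma0 t0 tS V_pos z.
  + exact: Qbar_kolmogorov_rate gp sigma0 t0 tS V_pos.
Qed.
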